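(* For every integer $n\ge0$, the number of $(2n+1)\times(2n+1)$ diagonally and antidiagonally symmetric alternating sign matrices satisfies $$|\mathrm{DASASM}(2n+1)|=3^{-n(n-1)/2}\,\bigl|\mathrm{SSYT}_{(n,n-1,n-1,\ldots,2,2,1,1)}(2n+1)\bigr|=\prod_{i=0}^n\frac{(3i)!}{(n+i)!}.$$
   Context: An alternating sign matrix (ASM) is a square matrix in which each entry is $0$, $1$ or $-1$, and along each row and each column the nonzero entries alternate in sign and have sum $1$. $\mathrm{DASASM}(m)$ is the set of $m\times m$ ASMs $A$ with $A_{ij}=A_{ji}=A_{m+1-j,m+1-i}$ for all $1\le i,j\le m$. $\mathrm{SSYT}_\lambda(k)$ is the set of semistandard Young tableaux of shape $\lambda$ with entries from $\{1,\ldots,k\}$. The partition $(n,n-1,n-1,\ldots,2,2,1,1)$ has the part $n$ once and each of the parts $n-1,n-2,\ldots,1$ exactly twice (it is $(1)$ for $n=1$ and empty for $n=0$). *)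

(* Defs.v *)
From mathcomp Require Import all_boot all_order all_algebra.

Set Implicit Arguments.
Unset Strict Implicit.
Unset Printing Implicit Defensive.

Import Order.TTheory GRing.Theory Num.Theory.
Local Open Scope ring_scope.

Definition asm_line (s : seq int) : bool :=
  let nz := [seq x <- s | x != 0] in
  sorted (fun x y => x * y < 0) nz && (\sum_(x <- nz) x == 1).

Definition is_asm (m : nat) (A : 'M[int]_m) : bool :=
  [&& [forall i, forall j, A i j \in [:: 0; 1; -1]],
      [forall i, asm_line [seq A i j | j : 'I_m]] &
      [forall j, asm_line [seq A i j | i : 'I_m]]].

(* Indices start at 0, so [rev_ord i], of value m - 1 - i, stands for the
   1-based index m + 1 - i. *)
Definition is_diag_antidiag_sym (m : nat) (A : 'M[int]_m) : bool :=
  [forall i, forall j,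
    (A i j == A j i) && (A j i == A (rev_ord j) (rev_ord i))].

(* ['M[int]_m] is not finite; the matrices are counted inside the finite type
   of matrices over the subtype {0, 1, -1} of [int], which contains all ASMs. *)
Definition asm_entry : finType := seq_sub [:: 0 : int; 1; -1].

Definition DASASM (m : nat) : {set 'M[asm_entry]_m} :=
  [set A : 'M[asm_entry]_m |
    let B : 'M[int]_m := map_mx val A in is_asm B && is_diag_antidiag_sym B].

Local Open Scope nat_scope.

(* The cells (row, column), both 0-based, of the diagram of a partition. *)
Definition cell (lam : seq nat) : finType :=
  {i : 'I_(size lam) & 'I_(nth 0 lam i)}.

Definition cell_row (lam : seq nat) (c : cell lam) : nat := tag c.
Definition cell_col (lam : seq nat) (c : cell lam) : nat := tagged c.

(* Entries lie in {1, ..., k}: the value 0 of ['I_k.+1] is excluded. *)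
Definition SSYT (lam : seq nat) (k : nat) : {set {ffun cell lam -> 'I_k.+1}} :=
  [set T : {ffun cell lam -> 'I_k.+1} |
    [&& [forall c, 0 < T c],
        [forall c, forall d,
          (cell_row c == cell_row d) && (cell_col c < cell_col d)
            ==> (T c <= T d)] &
        [forall c, forall d,
          (cell_col c == cell_col d) && (cell_row c < cell_row d)
            ==> (T c < T d)]]].

(* (n, n-1, n-1, ..., 2, 2, 1, 1) *)
Definition double_staircase (n : nat) : seq nat :=
  if n is n'.+1 then n :: flatten [seq [:: j; j] | j <- rev (iota 1 n')]
  else [::].

(* Main.v *)
(** Folded along its two axes of symmetry, a DASASM of order [2n+1] is a state of
    the six-vertex model on a triangle, in which [n] strands are reflected at the
    boundary and one further strand ends in the middle.  Attach a spectral
    parameter [u_l] to each of the [n] strands and [v] to the last one, and let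
    the quantum parameter be a primitive sixth root of unity [w], so that all
    weights become 1 at [u_l = v = 1].  The partition function [Z] is symmetric in
    the [u_l] (Yang-Baxter and reflection equations), even in each [u_l], invariant
    under inversion of all parameters, and reduces to a smaller [Z] at
    [v = w / u_p].  After multiplication by simple factors it is a polynomial in
    [v], and these properties prescribe more values than its degree; they are shared
    by a sum of two determinants [det (x_i ^ e_k)], where [x] runs over all [u_l ^ +-2] and one of
    [v ^ +-2], and [e = 0, 1, 3, 4, 6, 7, ...].  At [v = 1] the two determinants
    agree, and for [u_l = t ^ l] they are Vandermonde determinants in the
    [t ^ (2 * e_k)]; letting [t] be 1, [Z] becomes
    [3 ^ - C(n, 2) * \prod_(i < j) (e_j - e_i) / (j - i)].  The [e_k] are the strictly
    increasing rearrangement of [lambda_i + (2n+1) - i] for the double staircase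
    [lambda], and the last product counts its semistandard tableaux (via
    Gelfand-Tsetlin patterns). *)

Require Import Defs.
From mathcomp Require Import all_boot all_order all_fingroup all_algebra all_field.
From mathcomp Require Import ring zify.

Set Implicit Arguments.
Unset Strict Implicit.
Unset Printing Implicit Defensive.

Import Order.TTheory GRing.Theory Num.Theory.
Local Open Scope ring_scope.

(** * The six-vertex model at a sixth root of unity *)

(** Operators act on functions of all bits at once: the local relations are finite checks, and the
    rest is commutation of operators on disjoint strands. Two obstacles shape the proof.
    Transposition moves the unreflected strand to another label, so inversion costs a spare strand;
    hence [size L + 1 < #|I|] and the index type ['I_n.+2]. And the recursion gives a value at
    [v = w / u_p] only. Evenness turns [w] into [-w], inversion turns it into [1 / w], and both
    sides vanish at [v = 1 / u_p] and [v = -1 / u_p]; thus each [u_p] accounts for the six nodes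
    [w ^ k / u_p]. The choice of [w] matters beyond the weights: [w ^ 2] is a cube root of unity and
    the exponents [e_k] grow by 3 every two steps, so a determinant whose arguments include [y] and
    [w ^ 2 * y] splits. No topology enters: the homogeneous limit is a statement about Laurent
    polynomials that vanish at enough integers. *)

Section SixVertex.
Variables (I : finType) (K : numFieldType) (w : K).
Hypothesis w2 : w ^+ 2 = w - 1.

Lemma w_neq0 : w != 0.
Proof.
by apply: contra_eq_neq w2 => ->; rewrite expr0n sub0r eq_sym oppr_eq0 oner_neq0.
Qed.

Notation state := {ffun I -> bool}.
Notation vect := {ffun state -> K}.

(* A state records one bit per strand: the orientation of the edge of the strand
   that the sweep of the lattice has reached (equivalently, a partial row sum).
   Vertices act on vectors indexed by states. *)
Definition fl (i : I) (s : state) : state := [ffun k => s k (+) (k == i)].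

Definition op1 (i : I) (phi psi : bool -> K) (f : vect) : vect :=
  [ffun s : state => phi (s i) * f s + psi (s i) * f (fl i s)].

Definition op2 (i j : I) (phi psi : bool -> bool -> K) (f : vect) : vect :=
  [ffun s : state => phi (s i) (s j) * f s + psi (s i) (s j) * f (fl i (fl j s))].

Lemma flE i s k : fl i s k = s k (+) (k == i).
Proof. by rewrite ffunE. Qed.

Lemma flK i s : fl i (fl i s) = s.
Proof. by apply/ffunP => k; rewrite !flE addbK. Qed.

Lemma flC i j s : fl i (fl j s) = fl j (fl i s).
Proof. by apply/ffunP => k; rewrite !flE addbAC. Qed.

Lemma all_fl i s (L : seq I) : i \notin L -> all (fl i s) L = all s L.
Proof.
move=> iL; apply: eq_in_all => k kL; have ki : k != i by apply: contraNneq iL => <-.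
by rewrite flE (negPf ki) addbF.
Qed.

Lemma op2C i j phi psi f : op2 i j phi psi f = op2 j i (fun a b => phi b a) (fun a b => psi b a) f.
Proof. by apply/ffunP => s; rewrite !ffunE flC. Qed.

(* Normal forms of words in three commuting involutions. *)
Ltac sort_flips a b c :=
  do ?[rewrite flK | rewrite (flC b a) | rewrite (flC c a) | rewrite (flC c b)].

Definition scl (k : K) (f : vect) : vect := [ffun s : state => k * f s].

Lemma sclE k f s : scl k f s = k * f s.
Proof. by rewrite ffunE. Qed.

Lemma op1_op1 i j p q p' q' f : i != j ->
  op1 i p q (op1 j p' q' f) = op1 j p' q' (op1 i p q f).
Proof.
move=> ij; apply/ffunP => s; have ji : j != i by rewrite eq_sym.
rewrite !ffunE (negPf ij) (negPf ji) !addbF (flC j i); ring.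
Qed.

Lemma op1_op2 i j k p q p' q' f : i != j -> i != k ->
  op1 i p q (op2 j k p' q' f) = op2 j k p' q' (op1 i p q f).
Proof.
move=> ij ik; apply/ffunP => s.
have ji : j != i by rewrite eq_sym. have ki : k != i by rewrite eq_sym.
rewrite !ffunE (negPf ij) (negPf ik) (negPf ji) (negPf ki) !addbF.
rewrite (flC k i) (flC j i); ring.
Qed.

Lemma op2_op2 i l j k p q p' q' f : i != j -> i != k -> l != j -> l != k ->
  op2 i l p q (op2 j k p' q' f) = op2 j k p' q' (op2 i l p q f).
Proof.
move=> ij ik lj lk; apply/ffunP => s.
have ji : j != i by rewrite eq_sym. have ki : k != i by rewrite eq_sym.
have jl : j != l by rewrite eq_sym. have kl : k != l by rewrite eq_sym.
rewrite !ffunE (negPf ij) (negPf ik) (negPf ji) (negPf ki) !addbF.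
rewrite (negPf lj) (negPf lk) (negPf jl) (negPf kl) !addbF.
rewrite (flC k i) (flC j i) (flC k l) (flC j l); ring.
Qed.

(** [Q] plays the role of the support of [O]. It is expressed through commutation with everything
    that acts elsewhere, a property that passes to compositions and larger supports without a look
    at matrix entries. *)
Definition comm_off (Q : seq I) (O : vect -> vect) :=
  [/\ forall k f, O (scl k f) = scl k (O f),
      forall i p q f, i \notin Q -> O (op1 i p q f) = op1 i p q (O f) &
      forall i j p q f, i \notin Q -> j \notin Q ->
        O (op2 i j p q f) = op2 i j p q (O f)].

Lemma comm_off_op1 i p q : comm_off [:: i] (op1 i p q).
Proof.
split=> [k f|j p' q' f|j k p' q' f].
- by apply/ffunP => s; rewrite !ffunE; ring.
- by rewrite inE => ji; rewrite op1_op1 // eq_sym.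
- by rewrite !inE => ji ki; rewrite op1_op2 // eq_sym.
Qed.

Lemma comm_off_op2 i j p q : comm_off [:: i; j] (op2 i j p q).
Proof.
split=> [k f|k p' q' f|k l p' q' f].
- by apply/ffunP => s; rewrite !ffunE; ring.
- by rewrite !inE negb_or => /andP[ki kj]; rewrite op1_op2.
- rewrite !inE !negb_or => /andP[ki kj] /andP[li lj].
  by rewrite op2_op2 // eq_sym.
Qed.

Lemma comm_off_comp Q O O' :
  comm_off Q O -> comm_off Q O' -> comm_off Q (fun f => O (O' f)).
Proof.
move=> [H0 H1 H2] [H0' H1' H2'].
by split=> *; [rewrite H0' H0|rewrite H1' ?H1|rewrite H2' ?H2].
Qed.

Lemma comm_off_id Q : comm_off Q (fun f => f).
Proof. by []. Qed.

Lemma comm_off_sub Q Q' O : {subset Q <= Q'} -> comm_off Q O -> comm_off Q' O.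
Proof.
move=> sQ [H0 H1 H2]; have nQ i : i \notin Q' -> i \notin Q by apply/contra/sQ.
by split=> // [i p q f /nQ iQ|i j p q f /nQ iQ /nQ jQ]; [rewrite H1|rewrite H2].
Qed.

(* As [w ^+ 2 = w - 1], with [<x> = x - 1 / x] these are
   [awt x = <w x> / <w>], [kwt x = x / w + w / x] and [Bwt y = <1 / y> / <w>]. *)
Definition awt (x : K) : K := ((2 - w) * x + (1 + w) / x) / 3.
Definition kwt (x : K) : K := (1 - w) * x + w / x.
Definition Bwt (y : K) : K := (y^-1 - y) * (1 - 2 * w) / 3.

Definition eqd (al be : K) (x y : bool) : K := if x == y then al else be.

(* [Xop] is a vertex of the lattice, [Kop] a reflection at the boundary; [Mop] is
   the R-matrix that exchanges two parallel strands. *)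
Definition Xop (i j : I) (x : K) := op2 i j (eqd (awt x) (awt x^-1)) (eqd 1 0).
Definition Kop (i : I) (k : K) := op1 i (fun=> k) (fun=> 1).
Definition Mop (i j : I) (y : K) := op2 i j (eqd (awt y^-1) (Bwt y)) (eqd 0 1).

Lemma KopE i k f s : Kop i k f s = k * f s + f (fl i s).
Proof. by rewrite ffunE mul1r. Qed.

Lemma comm_off_scl Q O k f : comm_off Q O -> O (scl k f) = scl k (O f).
Proof. by case. Qed.

Lemma Kop_scl i x k f : Kop i x (scl k f) = scl k (Kop i x f).
Proof. exact: comm_off_scl (comm_off_op1 _ _ _). Qed.

Lemma Xop_scl i j x k f : Xop i j x (scl k f) = scl k (Xop i j x f).
Proof. exact: comm_off_scl (comm_off_op2 _ _ _ _). Qed.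

Lemma eqdC al be x y : eqd al be x y = eqd al be y x.
Proof. by rewrite /eqd eq_sym. Qed.

Lemma XopC i j x : Xop i j x =1 Xop j i x.
Proof.
by move=> f; rewrite /Xop op2C; apply/ffunP => s; rewrite !ffunE /= !(eqdC _ _ (s i)).
Qed.

Lemma MopC i j x : Mop i j x =1 Mop j i x.
Proof.
by move=> f; rewrite /Mop op2C; apply/ffunP => s; rewrite !ffunE /= !(eqdC _ _ (s i)).
Qed.

(** Only the bits of [a], [b] and [c] are involved, which leaves eight identities between rational
    functions of [x] and [y] modulo the equation of [w]. Likewise [reflection] amounts to four. *)
Lemma YBE a b c x y f : a != b -> a != c -> b != c -> x != 0 -> y != 0 ->
  Xop a c x (Xop b c y (Mop a b (x / y) f)) =
  Mop a b (x / y) (Xop b c y (Xop a c x f)).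
Proof.
move=> ab ac bc x0 y0; apply/ffunP => s.
have ba : b != a by rewrite eq_sym. have ca : c != a by rewrite eq_sym.
have cb : c != b by rewrite eq_sym.
rewrite !ffunE (negPf ab) (negPf ac) (negPf ba) (negPf ca) (negPf bc) (negPf cb) !eqxx.
rewrite !addbF !addbT /eqd; sort_flips a b c.
by case: (s a); case: (s b); case: (s c) => /=;
  rewrite ?(mul0r, add0r, addr0, mul1r) // /awt /Bwt; field: w2; rewrite ?x0 ?y0.
Qed.

Lemma reflection a b x y f : a != b -> x != 0 -> y != 0 ->
  Kop a (kwt x) (Xop a b (x * y) (Kop b (kwt y) (Mop a b (x / y) f))) =
  Mop a b (x / y) (Kop b (kwt y) (Xop a b (x * y) (Kop a (kwt x) f))).
Proof.
move=> ab x0 y0; apply/ffunP => s; have ba : b != a by rewrite eq_sym.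
rewrite !ffunE (negPf ab) (negPf ba) !eqxx !addbF !addbT /eqd.
do ?[rewrite flK | rewrite (flC b a)].
by case: (s a); case: (s b) => /=;
  rewrite ?(mul0r, add0r, addr0, mul1r) // /kwt /awt /Bwt; field: w2; rewrite ?x0 ?y0.
Qed.

Lemma comm_offX Q O i j x f : comm_off Q O -> i \notin Q -> j \notin Q ->
  O (Xop i j x f) = Xop i j x (O f).
Proof. by move=> [_ _ H] iQ jQ; apply: H. Qed.

Lemma comm_offM Q O i j x f : comm_off Q O -> i \notin Q -> j \notin Q ->
  O (Mop i j x f) = Mop i j x (O f).
Proof. by move=> [_ _ H] iQ jQ; apply: H. Qed.

Lemma comm_offK Q O i k f : comm_off Q O -> i \notin Q ->
  O (Kop i k f) = Kop i k (O f).
Proof. by move=> [_ H _] iQ; apply: H. Qed.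

Lemma Kop_M i k l x y f : i != k -> i != l ->
  Kop i x (Mop k l y f) = Mop k l y (Kop i x f).
Proof. exact: op1_op2. Qed.

(** * The state sum: exchange of strands and recursion *)

Section Lines.
Variable u : I -> K.

Definition Xs (i : I) (v : K) (L : seq I) (f : vect) : vect :=
  foldr (fun j g => Xop i j (v * u j) g) f L.

Definition Ys (i : I) (v : K) (L : seq I) (f : vect) : vect :=
  foldl (fun g j => Xop i j (v / u j) g) f L.

Fixpoint Bl (L : seq I) (f : vect) : vect :=
  if L is l :: L' then Kop l (kwt (u l)) (Xs l (u l) L' (Bl L' f)) else f.

(** The mirror image of [Bl]: operators in reverse order, parameters inverted. Transposition
    therefore exchanges the two halves ([adj_Bl], [adj_Br]). *)
Fixpoint Br (L : seq I) (f : vect) : vect :=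
  if L is l :: L' then Br L' (Ys l (u l)^-1 L' (Kop l (kwt (u l)^-1) f)) else f.

(** A reflected strand is a full row of sum 1, so its final bit is true. The bit of [c] stays free,
    as the central row is read only up to the center. *)
Definition fin_vect (L : seq I) : vect := [ffun s : state => (all s L)%:R].
Definition s0 : state := [ffun=> false].

(* The state sums are evaluated from the final bits back to the initial ones: the
   left half of the triangle, then the column of the strand [c], which is not
   reflected, then the right half. *)
Definition Zpart (L : seq I) (c : I) (v : K) : K :=
  Bl L (Xs c v L (Br L (fin_vect L))) s0.

Lemma comm_off_Xs i v L : comm_off (i :: L) (Xs i v L).
Proof.
elim: L => [|l L IH] /=; first exact: comm_off_id.
apply: (@comm_off_comp _ (Xop i l (v * u l))).
  by apply: comm_off_sub (comm_off_op2 _ _ _ _) => k; rewrite !inE => /orP[]->; rewrite ?orbT.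
by apply: comm_off_sub IH => k; rewrite !inE => /orP[]->; rewrite ?orbT.
Qed.

Lemma Ys_rcons i v L l f : Ys i v (rcons L l) f = Xop i l (v / u l) (Ys i v L f).
Proof. by rewrite /Ys -cats1 foldl_cat. Qed.

Lemma comm_off_Ys i v L : comm_off (i :: L) (Ys i v L).
Proof.
elim/last_ind: L => [|L l IH] /=; first exact: comm_off_id.
have H : comm_off (i :: rcons L l) (fun f => Xop i l (v / u l) (Ys i v L f)).
  apply: (@comm_off_comp _ (Xop i l (v / u l))).
    apply: comm_off_sub (comm_off_op2 _ _ _ _) => k; rewrite !inE mem_rcons inE.
    by case/orP=> ->; rewrite ?orbT.
  apply: comm_off_sub IH => k; rewrite !inE mem_rcons inE.
  by case/orP=> ->; rewrite ?orbT.
by case: H => H0 H1 H2; split=> *; rewrite !Ys_rcons; [rewrite H0|rewrite H1|rewrite H2].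
Qed.

Lemma comm_off_Bl L : comm_off L (Bl L).
Proof.
elim: L => [|l L IH] /=; first exact: comm_off_id.
apply: (@comm_off_comp _ (Kop l (kwt (u l)))).
  by apply: comm_off_sub (comm_off_op1 _ _ _) => k; rewrite !inE => ->.
apply: (@comm_off_comp _ (Xs l (u l) L)); first exact: comm_off_Xs.
by apply: comm_off_sub IH => k; rewrite !inE => ->; rewrite orbT.
Qed.

Lemma comm_off_Br L : comm_off L (Br L).
Proof.
elim: L => [|l L IH] /=; first exact: comm_off_id.
apply: (@comm_off_comp _ (Br L)).
  by apply: comm_off_sub IH => k; rewrite !inE => ->; rewrite orbT.
apply: (@comm_off_comp _ (Ys l (u l)^-1 L)); first exact: comm_off_Ys.
by apply: comm_off_sub (comm_off_op1 _ _ _) => k; rewrite !inE => ->.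
Qed.

Lemma Xs_cat i v L1 L2 f : Xs i v (L1 ++ L2) f = Xs i v L1 (Xs i v L2 f).
Proof. by rewrite /Xs foldr_cat. Qed.

Lemma Ys_cat i v L1 L2 f : Ys i v (L1 ++ L2) f = Ys i v L2 (Ys i v L1 f).
Proof. by rewrite /Ys foldl_cat. Qed.

Hypothesis u0 : forall i, u i != 0.

Lemma Xs_swap i v L1 a b L2 f : v != 0 -> uniq (i :: L1 ++ a :: b :: L2) ->
  Xs i v (L1 ++ a :: b :: L2) (Mop a b (u a / u b) f) =
  Mop a b (u a / u b) (Xs i v (L1 ++ b :: a :: L2) f).
Proof.
move=> v0 /=; rewrite mem_cat !inE !negb_or cat_uniq /= !inE !negb_or -!andbA.
move=> /and5P[iL1 ia ib iL2 /and5P[_ aL1 bL1 _ /and4P[ab aL2 bL2 _]]].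
rewrite !Xs_cat /= (comm_offM _ _ (comm_off_Xs _ _ _)) ?inE ?negb_or //; last first.
- by rewrite eq_sym ib.
- by rewrite eq_sym ia.
have -> g : Xop i a (v * u a) (Xop i b (v * u b) (Mop a b (u a / u b) g)) =
   Mop a b (u a / u b) (Xop i b (v * u b) (Xop i a (v * u a) g)).
  have -> : u a / u b = (v * u a) / (v * u b) by field; rewrite v0 !u0.
  by rewrite !(XopC i) YBE ?mulf_neq0 // eq_sym.
by rewrite (comm_offM _ _ (comm_off_Xs _ _ _)) // ?inE ?negb_or eq_sym ?ia ?ib.
Qed.

Lemma Ys_swap i v L1 a b L2 f : v != 0 -> uniq (i :: L1 ++ a :: b :: L2) ->
  Ys i v (L1 ++ a :: b :: L2) (Mop a b (u a / u b) f) =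
  Mop a b (u a / u b) (Ys i v (L1 ++ b :: a :: L2) f).
Proof.
move=> v0 /=; rewrite mem_cat !inE !negb_or cat_uniq /= !inE !negb_or -!andbA.
move=> /and5P[iL1 ia ib iL2 /and5P[_ aL1 bL1 _ /and4P[ab aL2 bL2 _]]].
rewrite !Ys_cat /= (comm_offM _ _ (comm_off_Ys _ _ _)) ?inE ?negb_or //; last first.
- by rewrite eq_sym ib.
- by rewrite eq_sym ia.
have -> g : Xop i b (v / u b) (Xop i a (v / u a) (Mop a b (u a / u b) g)) =
   Mop a b (u a / u b) (Xop i a (v / u a) (Xop i b (v / u b) g)).
  have ba : b != a by rewrite eq_sym.
  have -> : u a / u b = (v / u b) / (v / u a) by field; rewrite v0 !u0.
  by rewrite !(MopC a b) !(XopC i) YBE ?mulf_neq0 ?invr_eq0 // eq_sym.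
by rewrite (comm_offM _ _ (comm_off_Ys _ _ _)) // ?inE ?negb_or eq_sym ?ia ?ib.
Qed.

(** The R-matrix of two neighbouring strands travels through the lattice: past every third strand by
    [YBE], past the two corners and the vertex between them by [reflection]. *)
Lemma Bl_swap L1 a b L2 f : uniq (L1 ++ a :: b :: L2) ->
  Bl (L1 ++ a :: b :: L2) (Mop a b (u a / u b) f) =
  Mop a b (u a / u b) (Bl (L1 ++ b :: a :: L2) f).
Proof.
elim: L1 => [|l L1 IH] /=; last first.
  move=> /[dup] U /andP[lL U']; rewrite IH // Xs_swap //.
  rewrite Kop_M //; apply: contraNneq lL => <-; rewrite mem_cat !inE eqxx ?orbT //.
rewrite !inE negb_or -!andbA => /and4P[ab aL bL UL].
have ba : b != a by rewrite eq_sym.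
rewrite (comm_offM _ _ (comm_off_Bl _)) //.
move: (Bl L2 f) => g.
rewrite (comm_offK _ _ (comm_off_Xs _ _ _)) ?inE ?negb_or ?ba //.
rewrite (comm_offK _ _ (comm_off_Xs _ _ _)) ?inE ?negb_or ?ab //.
have -> : Xs a (u a) L2 (Xs b (u b) L2 (Mop a b (u a / u b) g)) =
          Mop a b (u a / u b) (Xs b (u b) L2 (Xs a (u a) L2 g)).
  elim: L2 aL bL UL => //= l L2 IH; rewrite !inE !negb_or.
  move=> /andP[al aL] /andP[bl bL] /andP[lL UL].
  have la : l != a by rewrite eq_sym. have lb : l != b by rewrite eq_sym.
  rewrite (comm_offX _ _ (comm_off_Xs a _ L2)) ?inE ?negb_or ?ba ?la //.
  rewrite IH // (comm_offX _ _ (comm_off_Xs b _ L2)) ?inE ?negb_or ?ab ?lb //.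
  have -> : u a / u b = (u a * u l) / (u b * u l) by field; rewrite !u0.
  by rewrite YBE ?mulf_neq0.
by rewrite reflection //; congr Mop; rewrite XopC mulrC.
Qed.

Lemma Br_swap L1 a b L2 f : uniq (L1 ++ a :: b :: L2) ->
  Br (L1 ++ a :: b :: L2) (Mop a b (u a / u b) f) =
  Mop a b (u a / u b) (Br (L1 ++ b :: a :: L2) f).
Proof.
elim: L1 f => [|l L1 IH] f /=; last first.
  move=> /[dup] U /andP[lL U']; rewrite -IH // -Ys_swap ?invr_eq0 //.
  rewrite Kop_M //; apply: contraNneq lL => <-; rewrite mem_cat !inE eqxx ?orbT //.
rewrite !inE negb_or -!andbA => /and4P[ab aL bL UL].
have ba : b != a by rewrite eq_sym.
rewrite -(comm_offM _ _ (comm_off_Br _)) //; congr Br.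
rewrite -(comm_offK _ _ (comm_off_Ys a _ _)) ?inE ?negb_or ?ba //.
rewrite -(comm_offK _ _ (comm_off_Ys b _ _)) ?inE ?negb_or ?ab //.
rewrite XopC mulrC.
have YY g : Ys b (u b)^-1 L2 (Ys a (u a)^-1 L2 (Mop a b (u a / u b) g)) =
          Mop a b (u a / u b) (Ys a (u a)^-1 L2 (Ys b (u b)^-1 L2 g)).
  elim/last_ind: L2 aL bL UL => // L2 l IH; rewrite !mem_rcons !inE !negb_or rcons_uniq.
  move=> /andP[al aL] /andP[bl bL] /andP[lL UL].
  have la : l != a by rewrite eq_sym. have lb : l != b by rewrite eq_sym.
  rewrite !Ys_rcons (comm_offX _ _ (comm_off_Ys b _ L2)) ?inE ?negb_or ?ab ?lb //.
  rewrite IH // (comm_offX _ _ (comm_off_Ys a _ L2)) ?inE ?negb_or ?ba ?la //.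
  have -> : u a / u b = ((u b)^-1 / u l) / ((u a)^-1 / u l) by field; rewrite !u0.
  by rewrite !(MopC a b) YBE ?mulf_neq0 ?invr_eq0.
rewrite -YY; congr Ys; congr Ys.
have -> : u a / u b = (u b)^-1 / (u a)^-1 by field; rewrite !u0.
by rewrite !(MopC a b) -[RHS]reflection ?invr_eq0 // (XopC b) mulrC.
Qed.

Lemma Mop_fin a b L y : a \in L -> b \in L ->
  Mop a b y (fin_vect L) = scl (awt y^-1) (fin_vect L).
Proof.
move=> aL bL; apply/ffunP => s; rewrite !ffunE /eqd.
case E: (all s L).
  by rewrite (allP E a aL) (allP E b bL) /=; ring.
case: eqP => Eab; first by ring.
suff -> : all (fl a (fl b s)) L = false by rewrite /=; ring.
have ab : a != b by apply: contra_notN Eab => /eqP->.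
apply/negbTE/allPn; case sb: (s b) Eab => Eab.
  by exists b; rewrite // !flE eqxx sb eq_sym (negPf ab).
by exists a; rewrite // !flE eqxx (negPf ab); case: (s a) Eab.
Qed.

(** The R-matrix is inserted at the final bits and removed at the initial ones. At both ends the
    bits of [a] and [b] agree, so it acts there by the same scalar [awt (u b / u a)], which must be
    nonzero to be cancelled. *)
Lemma Zpart_swap L1 a b L2 c v : v != 0 -> awt (u b / u a) != 0 ->
  uniq (c :: L1 ++ a :: b :: L2) ->
  Zpart (L1 ++ a :: b :: L2) c v = Zpart (L1 ++ b :: a :: L2) c v.
Proof.
move=> v0 A0 U; have /andP[_ U'] := U; have aL L : a \in L1 ++ a :: L.
  by rewrite mem_cat mem_head orbT.
have fE : fin_vect (L1 ++ b :: a :: L2) = fin_vect (L1 ++ a :: b :: L2).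
  by apply/ffunP => s; rewrite !ffunE !all_cat /= (andbCA (s b)).
apply: (mulfI A0); rewrite /Zpart.
set F := fin_vect (L1 ++ a :: b :: L2).
have E : Bl (L1 ++ a :: b :: L2) (Xs c v (L1 ++ a :: b :: L2)
   (Br (L1 ++ a :: b :: L2) (Mop a b (u a / u b) F))) =
  Mop a b (u a / u b) (Bl (L1 ++ b :: a :: L2) (Xs c v (L1 ++ b :: a :: L2)
   (Br (L1 ++ b :: a :: L2) F))).
  by rewrite Br_swap // Xs_swap // Bl_swap.
rewrite Mop_fin // in E; last by rewrite mem_cat !inE eqxx !orbT.
move/(congr1 (fun f : vect => f s0)): E.
case: (comm_off_Br (L1 ++ a :: b :: L2)) => -> _ _.
case: (comm_off_Xs c v (L1 ++ a :: b :: L2)) => -> _ _.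
case: (comm_off_Bl (L1 ++ a :: b :: L2)) => -> _ _.
by rewrite fE !ffunE /eqd eqxx mul0r addr0 invf_div.
Qed.

(* At argument [w] the vertex of [c] and [p] degenerates to a [cup], which joins the
   two strands; then [c] can be slid across the rest of the lattice as if it were a
   continuation of [p]. *)
Definition cup c p := op2 c p (eqd 1 0) (eqd 1 0).
Definition Ms p L f := foldl (fun g l => Mop l p (u l / u p) g) f L.

(** Crossing symmetry: multiplying the argument by [w] turns the diagonal weights of [Xop] into
    those of [Mop]. *)
Lemma awt_w y : y != 0 -> awt (w * y) = awt y^-1.
Proof.
move=> y0; have w0 := w_neq0.
by rewrite /awt; field: w2; rewrite w0 y0.
Qed.

Lemma awt_wV y : y != 0 -> awt (w * y)^-1 = Bwt y.
Proof.
move=> y0; have w0 := w_neq0.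
by rewrite /awt /Bwt; field: w2; rewrite w0 y0.
Qed.

Lemma cupX c p l y f : c != p -> c != l -> p != l -> y != 0 ->
  cup c p (Xop c l (w * y) f) = cup c p (Mop l p y f).
Proof.
move=> cp cl pl y0; apply/ffunP => s; rewrite !ffunE awt_w ?awt_wV //.
have lc : l != c by rewrite eq_sym. have lp : l != p by rewrite eq_sym.
have pc : p != c by rewrite eq_sym.
rewrite ?(negPf cp) ?(negPf pc) ?(negPf cl) ?(negPf lc) ?(negPf pl) ?(negPf lp) !eqxx.
rewrite !addbF !addbT /eqd; sort_flips c p l.
by case: (s c); case: (s p); case: (s l) => /=; ring.
Qed.

(** Each R-matrix in [Ms] moves [p] past one strand of [L2], until its row is the last of the right
    half. *)
Lemma Ms_Br p L1 L2 f : uniq (p :: L1 ++ L2) ->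
  Ms p L2 (Br (L1 ++ p :: L2) f) = Br (rcons (L1 ++ L2) p) (Ms p L2 f).
Proof.
elim: L2 L1 f => [|l L2 IH] L1 f U /=; first by rewrite cats0 cats1.
rewrite -Br_swap; last first.
  by rewrite -cat_rcons (uniq_catCA _ [:: p]) cat_rcons.
by rewrite -cat_rcons IH ?cat_rcons.
Qed.

Lemma Ms_rcons p L l f : Ms p (rcons L l) f = Mop l p (u l / u p) (Ms p L f).
Proof. by rewrite /Ms -cats1 foldl_cat. Qed.

Lemma Ms_fin p L Q : p \in Q -> {subset L <= Q} ->
  Ms p L (fin_vect Q) = scl (\prod_(l <- L) awt (u l / u p)^-1) (fin_vect Q).
Proof.
move=> pQ; elim/last_ind: L => [|L l IH] sL.
  by apply/ffunP => s; rewrite /= !ffunE big_nil mul1r.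
rewrite Ms_rcons IH; last first.
  by move=> k kL; apply: sL; rewrite mem_rcons inE kL orbT.
have lQ : l \in Q by apply: sL; rewrite mem_rcons mem_head.
rewrite /= /Mop; case: (comm_off_op2 l p (eqd (awt (u l / u p)^-1) (Bwt (u l / u p))) (eqd 0 1)).
move=> -> _ _; rewrite -/(Mop _ _ _ _) Mop_fin // -cats1 big_cat big_seq1.
by apply/ffunP => s; rewrite !ffunE mulrA.
Qed.

Lemma Br_rcons L p f : uniq (rcons L p) ->
  Br (rcons L p) f = Kop p (kwt (u p)^-1) (Ys p (u p)^-1 L (Br L f)).
Proof.
elim: L f => [|l L IH] f //=; rewrite mem_rcons inE negb_or rcons_uniq.
move=> /andP[/andP[lp lL] /andP[pL UL]]; rewrite IH ?rcons_uniq ?pL // Ys_rcons.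
rewrite (comm_offX _ _ (comm_off_Br _)) // XopC; congr (Kop _ _ (Ys _ _ _ (Xop _ _ _ _))).
exact: mulrC.
Qed.

Lemma cupXs c p L f : uniq (c :: p :: L) ->
  cup c p (Xs c (w / u p) L f) = cup c p (Ms p L f).
Proof.
move=> U; elim: L f U => //= l L IH f; rewrite !inE !negb_or -!andbA.
move=> /and5P[cp cl cL pl /and3P[pL lL UL]].
rewrite (_ : w / u p * u l = w * (u l / u p)); last by rewrite mulrAC mulrA.
rewrite cupX ?mulf_neq0 ?invr_eq0 //.
rewrite -(comm_offM _ _ (comm_off_Xs c _ L)) ?inE ?negb_or ?lL ?pL ?(eq_sym _ c) ?cp ?cl //.
by rewrite IH //= !inE negb_or cp cL pL.
Qed.

(* A row whose first vertex is a [cup] admits only one configuration. *)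
Lemma frozen p c v L (g : vect) : c \notin p :: L -> uniq (p :: L) ->
  (forall s : state, s p -> ~~ s c -> g s = 0) ->
  forall s : state, ~~ s c -> {in L, forall l, ~~ s l} ->
  (s p -> Xs p v L g s = 0) /\
  (~~ s p -> Xs p v L g s = \prod_(l <- L) awt (v * u l) * g s).
Proof.
move=> cpL U g0; elim: L cpL U => [|l L IH] cpL U s sc sL.
  by split=> sp /=; [rewrite g0|rewrite big_nil mul1r].
move: cpL U; rewrite /= !inE !negb_or -!andbA => /and3P[cp cl cL] /and4P[pl pL lL UL].
rewrite /= !inE negb_or cp cL pL in IH.
have sl : ~~ s l by rewrite sL ?mem_head.
have sL' : {in L, forall k, ~~ s k} by move=> k kL; rewrite sL ?inE ?kL ?orbT.
have [H1 H2] := IH isT UL s sc sL'.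
split=> sp; rewrite ffunE /eqd (negPf sl).
  by rewrite sp /= H1 // mulr0 mul0r addr0.
have [|k kL|H _] := IH isT UL (fl p (fl l s)).
- by rewrite !flE (negPf cp) (negPf cl) !addbF.
- have kp : k != p by apply: contraNneq pL => <-.
  have kl : k != l by apply: contraNneq lL => <-.
  by rewrite !flE (negPf kp) (negPf kl) !addbF sL'.
by rewrite (negPf sp) /= H2 // H ?mulr0 ?addr0 ?big_cons ?mulrA // !flE eqxx (negPf pl) (negPf sp).
Qed.

(** Stated as invariance under two local operators, so that everything acting on other strands
    preserves it at once ([cap_supp_comm]); [cap_suppP] gives the pointwise meaning. *)
Definition cap_supp p c h :=
  op2 p c (eqd 0 1) (eqd 0 0) h = h /\ op2 p c (eqd 0 0) (eqd 1 1) h = h.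

Lemma cap_suppP p c h : cap_supp p c h ->
  (forall s : state, s p = s c -> h s = 0) /\ (forall s, h (fl p (fl c s)) = h s).
Proof.
move=> [H1 H2]; split=> s.
  by move=> e; rewrite -H1 ffunE /eqd e eqxx !mul0r addr0.
by rewrite -[h in RHS]H2 ffunE /eqd if_same mul0r add0r if_same mul1r.
Qed.

(** On the support the bits of [p] and [c] are opposite: [l] agrees with exactly one of them.
    Passing from [p] to [c] thus exchanges the two diagonal weights, which amounts to inverting the
    argument. *)
Lemma capX p c l x h : p != c -> p != l -> c != l -> cap_supp p c h ->
  Xop p l x^-1 h = Xop c l x h.
Proof.
move=> pc pl cl /cap_suppP[h0 hpc]; apply/ffunP => s; rewrite !ffunE /eqd invrK.
have cp : c != p by rewrite eq_sym. have lp : l != p by rewrite eq_sym.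
have lc : l != c by rewrite eq_sym.
have E : h (fl c (fl l s)) = h (fl p (fl l s)).
  by rewrite -hpc; sort_flips p c l.
have hB : ~~ s p = s c -> h (fl p (fl l s)) = 0.
  by move=> e; apply: h0; rewrite !flE eqxx (negPf pl) (negPf cp) (negPf cl) addbF addbT !addbF.
rewrite E; move: (h0 s) hB; case: (s p); case: (s c); case: (s l) => /= H1 H2;
  try rewrite (H1 erefl); try rewrite (H2 erefl); ring.
Qed.

Lemma cap_supp_comm p c Q O h : p \notin Q -> c \notin Q -> comm_off Q O ->
  cap_supp p c h -> cap_supp p c (O h).
Proof. by move=> pQ cQ [_ _ H] [h1 h2]; split; rewrite -H ?h1 ?h2. Qed.

Lemma Ys_cap p c v L h : uniq (p :: c :: L) -> cap_supp p c h ->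
  Ys p v^-1 L h = Xs c v L h.
Proof.
move=> + hh; elim/last_ind: L => // L l IH.
rewrite /= !inE !mem_rcons !inE !negb_or rcons_uniq -!andbA.
move=> /and5P[pc pl pL cl /and3P[cL lL UL]].
rewrite Ys_rcons IH /= ?inE ?negb_or ?pc ?pL ?cL //.
rewrite -(comm_offX _ _ (comm_off_Xs c _ L)) ?inE ?negb_or ?pc ?pL ?(eq_sym l) ?cl //.
rewrite -invfM (capX (c := c)) // -cats1 Xs_cat //; exact: cap_supp_comm hh.
Qed.

(* The strand [c] may equivalently be turned back at the middle, as a strand [p]
   whose initial bit is summed over. *)
Lemma turn p c L v : uniq (c :: p :: L) ->
  Kop p 1 (Bl L (Ys p v^-1 L (Br L (fin_vect (p :: L))))) s0 = Zpart L c v.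
Proof.
rewrite /= inE negb_or -andbA => /and4P[cp cL pL UL].
have pc : p != c by rewrite eq_sym.
(* [f1] agrees with [fin_vect (p :: L)] where the bit of [c] is false, and nothing else is seen from
   [s0]. In addition it satisfies [cap_supp], so that the row of [p] can be traded for a row of
   [c]. *)
pose f1 : vect := [ffun s : state => (all s L)%:R * (s p != s c)%:R].
pose Pi := op1 c (fun b => (~~ b)%:R) (fun=> 0).
have PiE : Pi (fin_vect (p :: L)) = Pi f1.
  apply/ffunP => s; rewrite !ffunE; case: (s c) => /=; rewrite !mul0r // !addr0.
  by case: (s p); rewrite /= ?mulr1 ?mulr0.
pose G f := Bl L (Ys p v^-1 L (Br L f)).
have HG : comm_off (p :: L) G.
  apply: (@comm_off_comp _ (Bl L)).
    by apply: comm_off_sub (comm_off_Bl L) => k; rewrite inE => ->; rewrite orbT.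
  apply: (@comm_off_comp _ (Ys p v^-1 L)); first exact: comm_off_Ys.
  by apply: comm_off_sub (comm_off_Br L) => k; rewrite inE => ->; rewrite orbT.
have PG : Pi (G (fin_vect (p :: L))) = Pi (G f1).
  by case: HG => _ H _; rewrite /Pi -!H ?inE ?negb_or ?cp // -/Pi PiE.
have G1 (s : state) : ~~ s c -> G (fin_vect (p :: L)) s = G f1 s.
  move=> sc; move/(congr1 (fun f : vect => f s)): PG.
  by rewrite !ffunE sc !mul1r !mul0r !addr0.
have -> : Kop p 1 (G (fin_vect (p :: L))) s0 = Kop p 1 (G f1) s0.
  by rewrite !ffunE !G1 ?flE ?ffunE ?(negPf cp).
have Hf1 : cap_supp p c f1.
  split; apply/ffunP => s; rewrite !ffunE /eqd.
    by case: eqP => _; rewrite /= ?mulr0 ?mul0r ?addr0 ?mul1r.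
  rewrite !if_same mul0r add0r mul1r !eqxx (negPf pc) (negPf cp) !addbF.
  rewrite !all_fl //.
  by case: (s p); case: (s c).
rewrite /G (Ys_cap (c := c)) /= ?inE ?negb_or ?pc ?pL ?cL //; last first.
  exact: cap_supp_comm (comm_off_Br L) Hf1.
rewrite -(comm_offK _ _ (comm_off_Bl L)) // -(comm_offK _ _ (comm_off_Xs c _ L)) ?inE ?negb_or ?pc //.
rewrite -(comm_offK _ _ (comm_off_Br L)) // /Zpart; congr (Bl L (Xs c v L (Br L _)) _).
apply/ffunP => s; rewrite !ffunE !mul1r.
rewrite !all_fl //.
rewrite eqxx (negPf cp) !addbF; case: (s p); case: (s c); rewrite /=; ring.
Qed.

(** The vertex of [c] and [p] is a [cup]. The left row of [p] freezes, giving [kwt (u p)] and the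
    [awt (u p * u l)]. The column of [c] becomes R-matrices that carry [p] to the end of the right
    half and are absorbed by the final vector, giving the [awt (u l / u p)^-1]. The right corner of
    [p], summed over the initial bit, gives [1 + kwt (u p)^-1]. The row of [p] that is left is a
    strand turned back, hence [Zpart] at [v = u p] by [turn]. *)
Lemma Zpart_rec p L c : uniq (c :: p :: L) ->
  Zpart (p :: L) c (w / u p) =
  kwt (u p) * (1 + kwt (u p)^-1) *
  (\prod_(l <- L) (awt (u p * u l) * awt (u l / u p)^-1)) * Zpart L c (u p).
Proof.
move=> U; move: (U); rewrite /= inE negb_or -andbA => /and4P[cp cL pL UL].
have pc : p != c by rewrite eq_sym.
have w0 := w_neq0.
rewrite /Zpart /= -/(Br (p :: L) (fin_vect (p :: L))) divfK //.
set W := Br (p :: L) (fin_vect (p :: L)).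
have -> g : Xop c p w g = cup c p g.
  rewrite /Xop /cup; have -> : awt w = 1 by rewrite /awt; field: w2.
  by have -> : awt w^-1 = 0 by rewrite /awt; field: w2.
rewrite -[Br L (Ys _ _ _ _)]/W.
have cB f : cup c p (Bl L f) = Bl L (cup c p f).
  by case: (comm_off_Bl L) => _ _ H2; rewrite /cup H2.
rewrite -cB.
set H := Bl L (Xs c (w / u p) L W).
have cupH : cup c p H = scl (\prod_(l <- L) awt (u l / u p)^-1)
    (cup c p (Bl L (Br (rcons L p) (fin_vect (p :: L))))).
  rewrite /H !cB cupXs // -!cB /W -[p :: L]/([::] ++ p :: L) Ms_Br /= ?pL //.
  rewrite Ms_fin ?mem_head //; last by move=> k; rewrite inE => ->; rewrite orbT.
  case: (comm_off_Br (rcons L p)) => -> _ _; case: (comm_off_Bl L) => -> _ _.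
  by rewrite /cup; case: (comm_off_op2 c p (eqd 1 0) (eqd 1 0)) => ->.
have cup0 (s : state) : s p -> ~~ s c -> cup c p H s = 0.
  by move=> sp sc; rewrite ffunE /eqd sp (negPf sc) !mul0r addr0.
rewrite KopE.
have cpL : c \notin p :: L by rewrite inE negb_or cp.
have UpL : uniq (p :: L) by rewrite /= pL.
have [||_ H1] := frozen (u p) cpL UpL cup0 (s := s0).
- by rewrite ffunE.
- by move=> l; rewrite ffunE.
rewrite H1; last by rewrite ffunE.
have [||H0 _] := frozen (u p) cpL UpL cup0 (s := fl p s0).
- by rewrite !ffunE (negPf cp).
- move=> l lL; have lp : l != p by apply: contraNneq pL => <-.
  by rewrite !ffunE (negPf lp).
rewrite H0; last by rewrite !ffunE eqxx.
rewrite addr0 cupH sclE Br_rcons ?rcons_uniq ?pL //.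
set G := Bl L _.
(* [G] does not depend on the bit of [c], so flipping both bits in [cup] amounts to flipping that of
   [p] alone: at [s0] the [cup] acts as [Kop p 1]. *)
have Gc : op1 c (fun=> 0) (fun=> 1) G = G.
  have h0 : op1 c (fun=> 0) (fun=> 1) (fin_vect (p :: L)) = fin_vect (p :: L).
    apply/ffunP => s; rewrite ffunE mul0r add0r mul1r !ffunE; congr _%:R.
    by rewrite all_fl // inE negb_or cp.
  case: (comm_off_Bl L) => _ HB _; rewrite /G -HB //.
  rewrite -op1_op1 //.
  case: (comm_off_Ys p (u p)^-1 L) => _ HY _; rewrite -HY //.
  by case: (comm_off_Br L) => _ HR _; rewrite -HR // h0.
have -> : cup c p G s0 = Kop p 1 G s0.
  rewrite !ffunE /eqd eqxx !mul1r; congr (_ + _).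
  by rewrite -[G in RHS]Gc ffunE mul0r add0r mul1r.
rewrite /G -(comm_offK _ _ (comm_off_Bl L)) //.
have KK k f : Kop p 1 (Kop p k f) = scl (1 + k) (Kop p 1 f).
  by apply/ffunP => s; rewrite !ffunE flK; ring.
rewrite KK; case: (comm_off_Bl L) => -> _ _; rewrite sclE.
rewrite (comm_offK _ _ (comm_off_Bl L)) // (turn (c := c)) // /Zpart.
by rewrite [in RHS]big_split /=; ring.
Qed.
End Lines.

(** * Evenness in each parameter *)

Section Parity.
Variables (u u' : I -> K).

Lemma eq_Xs i v L f : {in L, u =1 u'} -> Xs u i v L f = Xs u' i v L f.
Proof.
elim: L => //= l L IH uL; rewrite uL ?mem_head // IH //.
by move=> k kL; apply: uL; rewrite inE kL orbT.
Qed.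

Lemma eq_Ys i v L f : {in L, u =1 u'} -> Ys u i v L f = Ys u' i v L f.
Proof.
elim: L f => //= l L IH f uL; rewrite uL ?mem_head // IH //.
by move=> k kL; apply: uL; rewrite inE kL orbT.
Qed.

Lemma eq_Bl L f : {in L, u =1 u'} -> Bl u L f = Bl u' L f.
Proof.
elim: L => //= l L IH uL; have uL' : {in L, u =1 u'}.
  by move=> k kL; apply: uL; rewrite inE kL orbT.
by rewrite uL ?mem_head // IH // eq_Xs.
Qed.

Lemma eq_Br L f : {in L, u =1 u'} -> Br u L f = Br u' L f.
Proof.
elim: L f => //= l L IH f uL; have uL' : {in L, u =1 u'}.
  by move=> k kL; apply: uL; rewrite inE kL orbT.
by rewrite uL ?mem_head // IH // eq_Ys.
Qed.

Definition signop p := op1 p (fun b => (-1) ^+ b) (fun=> 0).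

Lemma awtN x : awt (- x) = - awt x.
Proof. by rewrite /awt invrN; ring. Qed.

Lemma kwtN x : kwt (- x) = - kwt x.
Proof. by rewrite /kwt invrN; ring. Qed.

Lemma Kop_sign p k f : Kop p (- k) (signop p f) = scl (-1) (signop p (Kop p k f)).
Proof.
by apply/ffunP => s; rewrite !ffunE eqxx; case: (s p); rewrite /= ?expr0 ?expr1; ring.
Qed.

Lemma Xop_sign p l x f : p != l ->
  Xop p l (- x) (signop p f) = scl (-1) (signop p (Xop p l x f)).
Proof.
move=> pl; apply/ffunP => s; rewrite !ffunE eqxx (negPf pl) invrN !awtN /eqd.
by case: (s p); case: (s l); rewrite /= ?expr0 ?expr1; ring.
Qed.

Lemma Xs_sign p v L f : p \notin L ->
  Xs u p (- v) L (signop p f) = scl ((-1) ^+ size L) (signop p (Xs u p v L f)).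
Proof.
elim: L => [|l L IH] pL; first by apply/ffunP => s; rewrite sclE mul1r.
move: pL; rewrite inE negb_or => /andP[pl pL] /=; rewrite IH // mulNr.
case: (comm_off_op2 p l (eqd (awt (- (v * u l))) (awt (- (v * u l))^-1)) (eqd 1 0)).
move=> H _ _; rewrite /Xop H -/(Xop p l (- (v * u l)) _) Xop_sign //.
by apply/ffunP => s; rewrite !sclE exprS; ring.
Qed.

Lemma Ys_sign p v L f : p \notin L ->
  Ys u p (- v) L (signop p f) = scl ((-1) ^+ size L) (signop p (Ys u p v L f)).
Proof.
elim/last_ind: L => [|L l IH] pL; first by apply/ffunP => s; rewrite sclE mul1r.
move: pL; rewrite mem_rcons inE negb_or => /andP[pl pL].
rewrite !Ys_rcons IH // mulNr.
case: (comm_off_op2 p l (eqd (awt (- (v / u l))) (awt (- (v / u l))^-1)) (eqd 1 0)).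
move=> H _ _; rewrite /Xop H -/(Xop p l (- (v / u l)) _) Xop_sign //.
by apply/ffunP => s; rewrite !sclE size_rcons exprS; ring.
Qed.

(** Conjugation by the sign of the bit of [p] absorbs the change of parameter up to one factor [-1]
    for each of the [2 * size L + 1] vertices and two corners of [p]. The final bit of [p], being
    true, contributes one more, and the total is even. *)
Lemma Zpart_opp p L c v : uniq (c :: p :: L) -> u' p = - u p -> {in L, u =1 u'} ->
  Zpart u' (p :: L) c v = Zpart u (p :: L) c v.
Proof.
rewrite /= inE negb_or -andbA => /and4P[cp cL pL UL] up uL.
have pc : p != c by rewrite eq_sym.
rewrite /Zpart /= -!(eq_Xs _ _ _ uL) -(eq_Bl _ uL) -(eq_Br _ uL) -!(eq_Ys _ _ _ uL) up.
rewrite !invrN !kwtN mulrN.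
set F := fin_vect _.
have FE : F = scl (-1) (signop p F).
  apply/ffunP => s; rewrite !ffunE /=; case: (s p); rewrite /= ?expr1 ?mulr0; ring.
have C1 g : Br u L (signop p g) = signop p (Br u L g).
  by case: (comm_off_Br u L) => _ H _; apply: H.
have C2 g : Xs u c v L (signop p g) = signop p (Xs u c v L g).
  by case: (comm_off_Xs u c v L) => _ H _; apply: H; rewrite inE negb_or pc.
have C3 g : Bl u L (signop p g) = signop p (Bl u L g).
  by case: (comm_off_Bl u L) => _ H _; apply: H.
rewrite [in LHS]FE Kop_scl Kop_sign (comm_off_scl _ _ (comm_off_Ys _ _ _ _)).
rewrite (comm_off_scl _ _ (comm_off_Ys _ _ _ _)) Ys_sign //.
rewrite !(comm_off_scl _ _ (comm_off_Br _ _)) C1.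
rewrite !(comm_off_scl _ _ (comm_off_Xs _ c _ _)) C2 !(XopC c) !Xop_scl Xop_sign //.
rewrite !(comm_off_scl _ _ (comm_off_Bl _ _)) C3.
rewrite !(comm_off_scl _ _ (comm_off_Xs _ p _ _)) Xs_sign // !Kop_scl Kop_sign.
set G := Kop p _ _.
rewrite !sclE [signop p G s0]ffunE ffunE expr0 mul1r mul0r addr0 !mulrA.
have -> : (-1) * (-1) * (-1) ^+ size L * (-1) * (-1) ^+ size L * -1 = ((-1) ^+ size L) ^+ 2 :> K.
  by ring.
by rewrite -exprM mulnC exprM sqrrN !expr1n mul1r.
Qed.
End Parity.

(** * Inversion of all parameters *)

Section Inversion.

Definition ip (g f : vect) : K := \sum_(s : state) g s * f s.
Definition adj (O O' : vect -> vect) := forall g f, ip g (O f) = ip (O' g) f.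

Lemma adj_Kop i k : adj (Kop i k) (Kop i k).
Proof.
move=> g f; rewrite /ip.
rewrite (eq_bigr (fun s => k * g s * f s + g s * f (fl i s))); last first.
  by move=> s _; rewrite KopE; ring.
rewrite big_split /= [X in _ + X](reindex_inj (can_inj (flK i))) -big_split.
by apply: eq_bigr => s _; rewrite KopE flK /=; ring.
Qed.

Lemma adj_Xop i j x : adj (Xop i j x) (Xop i j x).
Proof.
move=> g f; rewrite /ip.
pose E (s : state) := eqd (awt x) (awt x^-1) (s i) (s j).
rewrite (eq_bigr (fun s => E s * g s * f s +
  eqd 1 0 (s i) (s j) * g s * f (fl i (fl j s)))); last first.
  by move=> s _; rewrite ffunE /E; ring.
have inj : injective (fun s : state => fl i (fl j s)).
  by apply: (can_inj (g := fun s => fl j (fl i s))) => s; rewrite !flK.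
rewrite big_split /= [X in _ + X](reindex_inj inj) -big_split.
apply: eq_bigr => s _; rewrite !ffunE /E /=.
have -> : fl i (fl j (fl i (fl j s))) = s by rewrite (flC j) !flK.
have -> : eqd 1 0 (s i (+) (i == j) (+) (i == i)) (s j (+) (j == j) (+) (j == i)) =
          eqd 1 0 (s i) (s j) :> K.
  by rewrite /eqd !eqxx (eq_sym j i); case: (i == j); case: (s i); case: (s j).
by ring.
Qed.

Variable u u' : I -> K.
Hypothesis uu' : forall i, u' i = (u i)^-1.

Lemma adj_Xs i v L : adj (Xs u i v L) (Ys u' i v L).
Proof.
elim: L => [|l L IH] g f //=.
by rewrite adj_Xop IH /= uu' invrK.
Qed.

Lemma adj_Ys i v L : adj (Ys u i v L) (Xs u' i v L).
Proof.
elim: L => [|l L IH] g f //=.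
by rewrite IH adj_Xop /= uu'.
Qed.

Lemma adj_Bl L : adj (Bl u L) (Br u' L).
Proof.
elim: L => [|l L IH] g f //=.
by rewrite adj_Kop adj_Xs IH uu' invrK.
Qed.

Lemma adj_Br L : adj (Br u L) (Bl u' L).
Proof.
elim: L => [|l L IH] g f //=.
by rewrite IH adj_Ys adj_Kop uu'.
Qed.

(** Summation over bits presents [fin_vect L] as the image of a point mass ([sumout_fin]), so that
    both ends of the state sum have the same form and can be exchanged. *)
Definition sumout (E : seq I) (f : vect) := foldl (fun g i => Kop i 1 g) f E.

Lemma adj_sumout E : adj (sumout E) (sumout (rev E)).
Proof.
elim: E => [|i E IH] g f //=.
by rewrite IH adj_Kop rev_cons /sumout -cats1 foldl_cat.
Qed.

Lemma Kop_fin i Q : i \notin Q -> Kop i 1 (fin_vect (i :: Q)) = fin_vect Q.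
Proof.
move=> iQ; apply/ffunP => s; rewrite KopE !ffunE /= !all_fl // flE eqxx.
by case: (s i); rewrite /= ?mulr0 ?mulr1 ?add0r ?addr0 // mul1r.
Qed.

Lemma sumout_fin E Q : uniq (E ++ Q) -> sumout E (fin_vect (E ++ Q)) = fin_vect Q.
Proof.
by elim: E => //= i E IH /andP[iE U]; rewrite Kop_fin // IH.
Qed.

Lemma sumout_comm Q O E f : comm_off Q O -> {in E, forall k, k \notin Q} ->
  sumout E (O f) = O (sumout E f).
Proof.
move=> OQ; elim: E f => //= k E IH f EQ.
rewrite -(comm_offK _ _ OQ) ?EQ ?mem_head // IH // => l lE.
by rewrite EQ // inE lE orbT.
Qed.

Lemma eq_fin Q Q' : Q =i Q' -> fin_vect Q = fin_vect Q'.
Proof. by move=> e; apply/ffunP => s; rewrite !ffunE (eq_all_r e). Qed.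

Definition compl (s : state) : state := [ffun i => ~~ s i].
Definition flip_all (f : vect) : vect := [ffun s => f (compl s)].

Lemma fl_compl i s : fl i (compl s) = compl (fl i s).
Proof. by apply/ffunP => k; rewrite !ffunE addNb. Qed.

Lemma flip_Kop i k f : flip_all (Kop i k f) = Kop i k (flip_all f).
Proof. by apply/ffunP => s; rewrite ffunE !KopE !ffunE fl_compl. Qed.

Lemma flip_Xop i j x f : flip_all (Xop i j x f) = Xop i j x (flip_all f).
Proof.
apply/ffunP => s; rewrite !ffunE !fl_compl /eqd.
by case: (s i); case: (s j).
Qed.

Lemma flip_Xs v i x L f : flip_all (Xs v i x L f) = Xs v i x L (flip_all f).
Proof. by elim: L => //= l L IH; rewrite flip_Xop IH. Qed.

Lemma flip_Ys v i x L f : flip_all (Ys v i x L f) = Ys v i x L (flip_all f).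
Proof. by elim: L f => //= l L IH f; rewrite IH flip_Xop. Qed.

Lemma flip_Bl v L f : flip_all (Bl v L f) = Bl v L (flip_all f).
Proof. by elim: L => //= l L IH; rewrite flip_Kop flip_Xs IH. Qed.

Lemma flip_Br v L f : flip_all (Br v L f) = Br v L (flip_all f).
Proof. by elim: L f => //= l L IH f; rewrite IH flip_Ys flip_Kop. Qed.

Lemma flip_sumout E f : flip_all (sumout E f) = sumout E (flip_all f).
Proof. by elim: E f => //= i E IH f; rewrite IH flip_Kop. Qed.

(* Transposition of the operators reads the lattice backwards and inverts the
   parameters; it exchanges initial and final bits, which flipping all bits restores
   up to the bits of the strands outside of [L]. *)
Lemma Zpart_inv p c L v : v != 0 -> uniq (c :: p :: L) ->
  Zpart u L c v = Zpart u' L p v^-1.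
Proof.
move=> v0 /=; rewrite inE negb_or -andbA => /and4P[cp cL pL UL].
have pc : p != c by rewrite eq_sym.
pose E := [seq i <- enum I | i \notin c :: L].
have UE : uniq (E ++ c :: L).
  rewrite cat_uniq filter_uniq ?enum_uniq //= cL UL !andbT.
  apply/negP => /orP[|/hasP[k kL]]; rewrite mem_filter inE ?eqxx //.
  by rewrite kL orbT.
have EL : {in L, forall k, k \notin E}.
  by move=> k kL; rewrite mem_filter inE kL orbT.
have Ec : c \notin E by rewrite mem_filter mem_head.
have mE i : i \in E ++ c :: L.
  by rewrite mem_cat mem_filter mem_enum andbT orNb.
pose d0 : vect := [ffun s => (s == s0)%:R].
have ip0 f : ip d0 f = f s0.
  rewrite /ip (bigD1 s0) //= big1 ?addr0; first by rewrite ffunE eqxx mul1r.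
  by move=> s /negPf ns; rewrite ffunE ns mul0r.
pose d1 := fin_vect (E ++ c :: L).
have d1E (s : state) : d1 s = (s == compl s0)%:R.
  rewrite ffunE; congr (nat_of_bool _)%:R; apply/allP/eqP => [H|-> k _]; last by rewrite !ffunE.
  by apply/ffunP => k; rewrite !ffunE H.
have ip1 f : ip f d1 = f (compl s0).
  rewrite /ip (bigD1 (compl s0)) //= big1 ?addr0; first by rewrite d1E eqxx mulr1.
  by move=> s /negPf ns; rewrite d1E ns mulr0.
have Fd0 : flip_all d0 = d1.
  apply/ffunP => s; rewrite d1E !ffunE; congr (nat_of_bool _)%:R.
  apply/eqP/eqP => [<-|->]; first by apply/ffunP => k; rewrite !ffunE negbK.
  by apply/ffunP => k; rewrite !ffunE.
have finL : fin_vect L = Kop c 1 (sumout E d1).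
  by rewrite sumout_fin // Kop_fin.
(* Here [turn] is used with [p] and [c] exchanged: transposing the left side produces a row of [c]
   that is turned back. *)
rewrite -(@turn u' c p L v^-1); last by rewrite /= inE negb_or pc pL cL.
rewrite invrK /Zpart finL -ip0 adj_Bl adj_Xs adj_Br adj_Kop adj_sumout ip1.
set O := fun f => Kop c 1 (Bl u' L (Ys u' c v L (Br u' L f))).
have OQ : comm_off (c :: L) O.
  have sL : {subset L <= c :: L} by move=> k kL; rewrite inE kL orbT.
  apply: (@comm_off_comp _ (Kop c 1)).
    by apply: comm_off_sub (comm_off_op1 _ _ _) => k; rewrite !inE => ->.
  apply: (@comm_off_comp _ (Bl u' L)); first exact: comm_off_sub (comm_off_Bl _ _).
  apply: (@comm_off_comp _ (Ys u' c v L)); first exact: comm_off_Ys.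
  exact: comm_off_sub (comm_off_Br _ _).
have flipO f : flip_all (O f) = O (flip_all f).
  by rewrite /O flip_Kop flip_Bl flip_Ys flip_Br.
have -> : sumout (rev E) (O d0) (compl s0) = flip_all (sumout (rev E) (O d0)) s0.
  by rewrite [in RHS]ffunE.
rewrite flip_sumout flipO Fd0 (sumout_comm _ OQ); last first.
  by move=> k; rewrite mem_rev mem_filter => /andP[].
rewrite /d1 (@eq_fin _ (rev E ++ c :: L)); last first.
  by move=> k; rewrite !mem_cat mem_rev.
rewrite sumout_fin // (perm_uniq (s2 := E ++ c :: L)) //.
by rewrite perm_cat2r perm_rev.
Qed.
End Inversion.
End SixVertex.

(** * The bialternants and the recursion at v = w / u_p *)

Section SeqDet.
Variable R : comNzRingType.

Definition seqdet (m : nat) (rows : seq (nat -> R)) : R :=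
  \det (\matrix_(i < m, k < m) nth (fun=> 0) rows i k).

Lemma seqdet_swap m r1 a b r2 : ((size r1).+1 < m)%N ->
  seqdet m (r1 ++ a :: b :: r2) = - seqdet m (r1 ++ b :: a :: r2).
Proof.
move=> lt; have lt' := ltnW lt.
pose i := Ordinal lt'; pose j := Ordinal lt; rewrite /seqdet.
have -> : (\matrix_(i < m, k < m) nth (fun=> 0) (r1 ++ a :: b :: r2) i k) =
  xrow i j (\matrix_(i < m, k < m) nth (fun=> 0) (r1 ++ b :: a :: r2) i k) :> 'M[R]_m.
  apply/matrixP => x y; rewrite !mxE; case: tpermP => [->|->|/eqP xi /eqP xj] /=.
  - by rewrite !nth_cat ltnn subnn /= ltnNge leqnSn /= subSn // subnn.
  - by rewrite !nth_cat ltnn subnn /= ltnNge leqnSn /= subSn // subnn.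
  rewrite !nth_cat; case: ltnP => // le.
  have: (x - size r1 > 1)%N.
    rewrite -!val_eqE /= in xi xj; lia.
  by case: (x - size r1)%N => [|[|]].
rewrite /xrow row_permE det_mulmx det_perm odd_tperm.
have -> : i != j by rewrite -val_eqE /= neq_ltn ltnSn.
by rewrite expr1 mulN1r.
Qed.

Lemma seqdet_dup m rows i j : (i < m)%N -> (j < m)%N -> i != j ->
  nth (fun=> 0) rows i =1 nth (fun=> 0) rows j -> seqdet m rows = 0.
Proof.
move=> im jm ij e; apply: (determinant_alternate (i1 := Ordinal im) (i2 := Ordinal jm)) => //.
by move=> k; rewrite !mxE e.
Qed.

End SeqDet.

Section Staircase.
Variables (K : numFieldType) (w : K).
Hypothesis w2 : w ^+ 2 = w - 1.

Definition stairexp (k : nat) : nat := k + k./2.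
Definition powrow (x : K) (k : nat) : K := x ^+ stairexp k.
Definition altern (s : seq K) : K := seqdet (size s) [seq powrow x | x <- s].

Lemma altern_swap r1 a b r2 : altern (r1 ++ a :: b :: r2) = - altern (r1 ++ b :: a :: r2).
Proof.
rewrite /altern !map_cat /= seqdet_swap !size_cat /= ?size_map //; lia.
Qed.

Lemma altern_dup a s : a \in s -> altern (a :: s) = 0.
Proof.
move=> aS; apply: (@seqdet_dup _ _ _ 0 (index a s).+1) => //=.
  by rewrite ltnS index_mem.
by move=> k; rewrite (nth_map 0) ?nth_index // index_mem.
Qed.

Lemma stairexpSS k : stairexp k.+2 = (stairexp k + 3)%N.
Proof. rewrite /stairexp; lia. Qed.

(* The exponents satisfy [e_(k+2) = e_k + 3], and [y] and [w ^+ 2 * y] have the same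
   cube: subtracting [y ^+ 3] times column [k] from column [k + 2] clears the first
   two rows but for a 2 x 2 block. *)
Lemma altern_factor y zs :
  altern (y :: w ^+ 2 * y :: zs) =
  (w ^+ 2 - 1) * y * \prod_(z <- zs) (z ^+ 3 - y ^+ 3) * altern zs.
Proof.
set s := _ :: _ :: zs; rewrite /altern /=.
pose m := size zs.
pose M : 'M[K]_(2 + m) := \matrix_(i, k) nth (fun=> 0) [seq powrow x | x <- s] i k.
pose U : 'M[K]_(2 + m) := \matrix_(i, k) ((i == k)%:R - y ^+ 3 *+ (i + 2 == k)%N).
have detU : \det U = 1.
  rewrite -det_tr det_trig.
    apply: big1 => i _; rewrite !mxE eqxx addn2.
    by rewrite (_ : (i.+2 == i) = false) ?subr0 //; lia.
  apply/is_trig_mxP => i j ij; rewrite !mxE -val_eqE /= addn2.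
  rewrite (_ : (j == i :> nat) = false); last by lia.
  by rewrite (_ : (j.+2 == i) = false) ?subr0 //; lia.
pose Q : 'M[K]_(m) := \matrix_(i, k) ((zs`_i ^+ 3 - y ^+ 3) * powrow zs`_i k).
pose T : 'M[K]_2 := \matrix_(i, k) (s`_i ^+ k).
pose g i k := nth (fun=> 0) [seq powrow x | x <- s] i k.
have MUE i k : \sum_j M i j * U j k = g i k - y ^+ 3 * (if (k < 2)%N then 0 else g i (k - 2)%N).
  rewrite (eq_bigr (fun j : 'I_(2 + m) =>
    g i j * (j == k)%:R - y ^+ 3 * (g i j * (j + 2 == k)%N%:R))); last first.
    by move=> j _; rewrite !mxE /= -(mulr_natr (y ^+ 3)) /g; ring.
  rewrite sumrB -mulr_sumr; congr (_ - _ * _).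
    by rewrite (bigD1 k) //= eqxx mulr1 big1 ?addr0 // => j /negPf ->; rewrite mulr0.
  case: ltnP => k2.
    rewrite big1 // => j _; rewrite (_ : (j + 2 == k)%N = false) ?mulr0 //; lia.
  have k2m : (k - 2 < 2 + m)%N by have := ltn_ord k; lia.
  rewrite (bigD1 (Ordinal k2m)) //= subnK // eqxx mulr1 big1 ?addr0 // => j.
  rewrite -val_eqE /= => jk; rewrite (_ : (j + 2 == k)%N = false) ?mulr0 //; lia.
have MU : M *m U = block_mx T 0 (\matrix_(i, k) (M *m U) (rshift 2 i) (lshift m k)) Q.
  rewrite -[LHS]submxK; congr block_mx; apply/matrixP => i k; rewrite !mxE ?MUE.
  - have -> : (lshift m k < 2)%N = true by case: k => [[|[|]]].
    rewrite mulr0 subr0 /g (nth_map 0) //=; last by case: i => [[|[|]]].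
    by rewrite /powrow /stairexp; case: k => [[|[|]]].
  - have -> : (rshift 2 k < 2)%N = false by [].
    rewrite /= addKn /g (nth_map 0) //=; last by case: i => [[|[|]]].
    rewrite /powrow stairexpSS exprD; case: i => [[|[|//]] ?] /=; first by ring.
    rewrite exprMn; have -> : (w ^+ 2 * y) ^+ 3 = y ^+ 3 by ring: w2.
    by ring.
  - by [].
  have -> : (rshift 2 k < 2)%N = false by [].
  rewrite /= addKn /g add2n /= (nth_map 0) // /powrow stairexpSS exprD; ring.
have -> : seqdet (size zs).+2 (powrow y :: powrow (w ^+ 2 * y) :: [seq powrow x | x <- zs])
  = \det M by [].
rewrite -[LHS]mulr1 -[X in _ * X = _]detU -det_mulmx MU det_lblock.
have -> : \det T = (w ^+ 2 - 1) * y.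
  rewrite (expand_det_row _ 0) !big_ord_recl big_ord0 /cofactor !det_mx11 !mxE /= /bump /=.
  ring.
pose D : 'M[K]_m := diag_mx (\row_i (zs`_i ^+ 3 - y ^+ 3)).
have -> : Q = D *m (\matrix_(i < m, k < m) nth (fun=> 0) [seq powrow x | x <- zs] i k).
  by apply/matrixP => i k; rewrite mul_diag_mx !mxE (nth_map 0).
rewrite -[RHS]mulrA det_mulmx det_diag (big_nth 0) big_mkord.
by congr (_ * (_ * _)); apply: eq_bigr => i _; rewrite mxE.
Qed.
End Staircase.

(** * Symmetries, recursion and special values of the conjectural evaluation *)

Section PartitionFunction.
Variables (I : finType) (K : numFieldType) (w : K).
Hypothesis w2 : w ^+ 2 = w - 1.
Implicit Types (u : I -> K) (L : seq I).

Definition xval (x : K) : K := x ^+ 2 + x ^- 2.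

Definition xs_of u L : seq K := flatten [seq [:: u l ^+ 2; u l ^- 2] | l <- L].

Fixpoint vandm u L : K :=
  if L is l :: L' then
    (u l ^- 2 - u l ^+ 2) * (\prod_(k <- L') (xval (u l) - xval (u k)) ^+ 2) * vandm u L'
  else 1.

(* The evaluation of the partition function to be proved; [vandm] is the Vandermonde
   determinant of the values [xs_of u L]. *)
Definition Phi u L c v : Prop :=
  Zpart w u L c v * v ^+ (3 * size L) * (v + 1) * vandm u L *
    \prod_(l <- L) (xval v - xval (u l)) =
  3^-1 ^+ 'C(size L, 2) *
    (v * altern (v ^+ 2 :: xs_of u L) + v ^+ (6 * size L) * altern (v ^- 2 :: xs_of u L)).

Lemma size_xs_of u L : size (xs_of u L) = (size L).*2.
Proof. by elim: L => //= l L IH; rewrite -[size (flatten _)]/(size (xs_of u L)) IH. Qed.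

Lemma w3 : w ^+ 3 = -1. Proof. by ring: w2. Qed.

Lemma prod_xs_of u L (f : K -> K) :
  \prod_(z <- xs_of u L) f z = \prod_(l <- L) (f (u l ^+ 2) * f (u l ^- 2)).
Proof.
elim: L => [|l L IH]; first by rewrite !big_nil.
by rewrite /= !big_cons -/(xs_of u L) IH mulrA.
Qed.

Lemma prodr_scale (J : eqType) (a : K) (f : J -> K) (s : seq J) :
  \prod_(j <- s) (a * f j) = a ^+ size s * \prod_(j <- s) f j.
Proof.
elim: s => [|j s IH]; first by rewrite !big_nil expr0 mulr1.
by rewrite !big_cons IH exprS /=; ring.
Qed.

Lemma Phi_nil u c v : Phi u [::] c v.
Proof.
rewrite /Phi /Zpart /= big_nil ffunE /altern /seqdet /= !det_mx11 !mxE /= /powrow.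
by rewrite /stairexp /= !muln0 !expr0; ring.
Qed.

Lemma altern_rot3 (a b c : K) s : altern (a :: b :: c :: s) = altern (c :: a :: b :: s).
Proof.
by rewrite (altern_swap [:: a]) (altern_swap [::]) opprK.
Qed.

Lemma altern_pairs s1 (a b c d : K) s2 :
  altern (s1 ++ [:: a, b, c, d & s2]) = altern (s1 ++ [:: c, d, a, b & s2]).
Proof.
rewrite -(cat_rcons a) altern_swap cat_rcons altern_swap opprK.
rewrite -(cat_rcons c) -(cat_rcons a) altern_swap cat_rcons altern_swap opprK.
by rewrite cat_rcons.
Qed.

Lemma Phi_swap u L1 a b L2 c v : (forall i, u i != 0) -> v != 0 ->
  awt w (u b / u a) != 0 -> uniq (c :: L1 ++ a :: b :: L2) ->
  Phi u (L1 ++ a :: b :: L2) c v -> Phi u (L1 ++ b :: a :: L2) c v.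
Proof.
move=> u0 v0 A0 U; rewrite /Phi (Zpart_swap w2 u0 v0 A0 U) !size_cat /=.
have -> : \prod_(l <- L1 ++ a :: b :: L2) (xval v - xval (u l)) =
          \prod_(l <- L1 ++ b :: a :: L2) (xval v - xval (u l)).
  by rewrite !big_cat !big_cons /= (mulrCA (xval v - xval (u a))).
have -> : vandm u (L1 ++ a :: b :: L2) = vandm u (L1 ++ b :: a :: L2).
  elim: L1 {U} => [|l L1 /= ->]; last first.
    by rewrite !big_cat !big_cons /= (mulrCA ((xval (u l) - xval (u a)) ^+ 2)).
  by rewrite /= !big_cons; ring.
have E x : altern (x :: xs_of u (L1 ++ a :: b :: L2)) = altern (x :: xs_of u (L1 ++ b :: a :: L2)).
  by rewrite /xs_of !map_cat !flatten_cat /= -!cat_cons altern_pairs.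
by rewrite !E.
Qed.

(** The arguments of each determinant contain a pair [y], [w ^ 2 * y]: in the first [y = u_p ^- 2],
    in the second [y = v ^- 2]. [altern_factor] removes it and leaves the determinants for [L] at
    [v = u_p], matching [Zpart_rec]. *)
Lemma Phi_rec u p L c : (forall i, u i != 0) -> uniq (c :: p :: L) ->
  Phi u L c (u p) -> Phi u (p :: L) c (w / u p).
Proof.
move=> u0 U; rewrite /Phi (Zpart_rec w2 u0 U) /=.
set z := Zpart _ _ _ _ _; set n := size L; set W := vandm u L.
set q := u p; have q0 : q != 0 by apply: u0.
have w0 := w_neq0 w2.
set N1 := altern (q ^+ 2 :: xs_of u L); set N2 := altern (q ^- 2 :: xs_of u L).
set v := w / q.
rewrite (_ : altern (v ^+ 2 :: _) = altern (q ^- 2 :: w ^+ 2 * q ^- 2 :: q ^+ 2 :: xs_of u L)); last first.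
  by rewrite /xs_of /= (altern_rot3 _ (q ^+ 2)) /v exprMn exprVn.
rewrite (_ : altern (v ^- 2 :: _) = altern (v ^- 2 :: w ^+ 2 * v ^- 2 :: q ^- 2 :: xs_of u L)); last first.
  rewrite /xs_of /= -/(xs_of u L); congr (altern [:: _, _, _ & _]).
  by rewrite /v /q; field; rewrite u0 w0.
rewrite !(altern_factor w2) !big_cons !prod_xs_of -/N1 -/N2.
set A := \prod_(l <- L) (awt _ _ * _).
set B := \prod_(l <- L) (xval q - xval (u l)).
set Bs := \prod_(l <- L) (xval q - xval (u l)) ^+ 2.
set C := \prod_(l <- L) (xval v - xval (u l)).
set H1 := \prod_(l <- L) _; set H2 := \prod_(l <- L) _.
have BsE : Bs = B ^+ 2 by rewrite /Bs prodrXl.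
(* Both products reduce to [H]: with [x = u_l ^ 6], [(x - a) (1 / x - a) = a (a + 1 / a - x - 1 /
   x)], and [a] is [q ^- 6] in the first, [q ^ 6] in the second. *)
pose H := \prod_(l <- L) (q ^+ 6 + q ^- 6 - u l ^+ 6 - u l ^- 6).
have HE a : a ^+ 2 + 1 = a * (q ^+ 6 + q ^- 6) ->
  \prod_(l <- L) (((u l ^+ 2) ^+ 3 - a) * ((u l ^- 2) ^+ 3 - a)) = a ^+ n * H.
  move=> aq; rewrite -prodr_scale; apply: eq_bigr => l _.
  transitivity ((a ^+ 2 + 1) - a * (u l ^+ 6 + u l ^- 6)); last by rewrite aq; ring.
  by field.
pose P := q ^+ (3 * n); have P0 : P != 0 by rewrite expf_neq0.
pose s : K := (-1) ^+ n; have s2 : s ^+ 2 = 1 by rewrite -exprM mulnC exprM sqrrN !expr1n.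
have P2 : q ^+ (6 * n) = P ^+ 2 by rewrite -exprM; congr (_ ^+ _); lia.
have q6n : (q ^+ 6) ^+ n = P ^+ 2 by rewrite -P2 exprM.
have v3 : v ^+ 3 = - q ^- 3 by rewrite /v expr_div_n w3; field.
have v6 : v ^+ 6 = q ^- 6 by rewrite (exprM v 3 2) v3; field.
have H1E : H1 = P ^- 2 * H.
  have q23 : (q ^- 2) ^+ 3 = q ^- 6 by rewrite exprVn -exprM.
  by rewrite /H1 q23 HE ?exprVn ?q6n //; field.
have H2E : H2 = P ^+ 2 * H.
  have vq : (v ^- 2) ^+ 3 = q ^+ 6 by rewrite exprVn -exprM v6 invrK.
  by rewrite /H2 vq HE ?q6n //; field.
have v3n : v ^+ (3 * n.+1) = - s / (P * q ^+ 3).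
  rewrite mulnS exprD (exprM v) v3 exprNn -/s exprVn -exprM -/P; field.
  by rewrite P0 q0.
have v6n : v ^+ (6 * n.+1) = P ^- 2 * q ^- 6.
  by rewrite mulnS exprD (exprM v) v6 exprVn q6n mulrC.
(* For each [l] the two weights and the two differences of [xval] multiply to [-1/3] times the
   factor of [H]. These [n] factors [1/3] raise the exponent ['C(n, 2)] to ['C(n.+1, 2)]. *)
have ABC : A * B * C = s * 3^-1 ^+ n * H.
  rewrite -exprMn mulN1r -prodr_scale -!big_split; apply: eq_bigr => l _ /=.
  by rewrite /awt /xval /v; field: w2; rewrite q0 u0 w0.
rewrite binS bin1 exprD P2 -/P.
set t := 3^-1 ^+ n in ABC *; set t2 := 3^-1 ^+ 'C(n, 2).
move=> IH; rewrite BsE H1E H2E v3n v6n.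
have kE : kwt w q * (1 + kwt w q^-1) = kwt w q * (w / q * (q - w) * (q + 1)).
  by rewrite /kwt; field: w2; rewrite q0.
transitivity ((z * P * (q + 1) * W * B) * (A * B * C) *
  (kwt w q * (w / q * (q - w)) * (- s / (P ^+ 2 * q ^+ 3)) * (v + 1) *
   (q ^- 2 - q ^+ 2) * (xval v - xval q))).
  by rewrite kE; field; rewrite q0 P0.
rewrite IH ABC /xval /kwt /v.
by field: w2 s2; rewrite q0 w0 P0.
Qed.

Lemma eq_sqr_data u u' L : {in L, forall l, u l ^+ 2 = u' l ^+ 2} ->
  [/\ xs_of u L = xs_of u' L, vandm u L = vandm u' L &
      forall a, \prod_(l <- L) (a - xval (u l)) = \prod_(l <- L) (a - xval (u' l))].
Proof.
move=> e; have ex : {in L, forall l, xval (u l) = xval (u' l)}.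
  by move=> l lL; rewrite /xval e.
split.
- by rewrite /xs_of; congr flatten; apply/eq_in_map => l lL; rewrite e.
- elim: L e ex => //= l L IH e ex; rewrite IH; first last.
  + by move=> k kL; apply: ex; rewrite inE kL orbT.
  + by move=> k kL; apply: e; rewrite inE kL orbT.
  rewrite e ?mem_head //; congr (_ * _ * _); apply: eq_big_seq => k kL.
  by rewrite !ex ?mem_head // inE kL orbT.
by move=> a; apply: eq_big_seq => l lL; rewrite ex.
Qed.

Lemma Phi_opp u u' p L c v : uniq (c :: p :: L) -> u' p = - u p ->
  {in L, u =1 u'} -> Phi u' (p :: L) c v -> Phi u (p :: L) c v.
Proof.
move=> U up uL; have e : {in p :: L, forall l, u l ^+ 2 = u' l ^+ 2}.
  by move=> l; rewrite inE => /orP[/eqP->|lL]; rewrite ?up ?sqrrN // uL.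
have [e1 e2 e3] := eq_sqr_data e.
by rewrite /Phi (Zpart_opp _ _ U up uL) e1 e2 e3.
Qed.

Lemma altern_inv u u' L r : (forall i, u' i = (u i)^-1) ->
  altern (r ++ xs_of u' L) = (-1) ^+ size L * altern (r ++ xs_of u L).
Proof.
move=> uu'; elim: L r => [|l L IH] r; first by rewrite mul1r.
rewrite /= -!/(xs_of _ L) altern_swap uu' exprVn invrK.
rewrite -2!cat_rcons IH !cat_rcons [size _]/= (exprS (-1)).
by rewrite -[xs_of u (l :: L)]/[:: u l ^+ 2, u l ^- 2 & xs_of u L]; ring.
Qed.

(** Inversion exchanges the two determinants and scales both sides by the same power of [v]; the
    sign from swapping the arguments within each pair also appears in [vandm]. *)
Lemma Phi_inv u u' p L c v : (forall i, u i != 0) -> (forall i, u' i = (u i)^-1) ->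
  v != 0 -> uniq (c :: p :: L) -> Phi u' L p v^-1 -> Phi u L c v.
Proof.
move=> u0 uu' v0 U; rewrite /Phi (Zpart_inv w uu' v0 U).
set n := size L; pose s : K := (-1) ^+ n.
have s2 : s ^+ 2 = 1 by rewrite -exprM mulnC exprM sqrrN !expr1n.
have xV x : xval x^-1 = xval x by rewrite /xval -exprVn invrK addrC exprVn.
have xu : forall a, \prod_(l <- L) (a - xval (u' l)) = \prod_(l <- L) (a - xval (u l)).
  by move=> a; apply: eq_bigr => l _; rewrite uu' xV.
have vE : vandm u' L = s * vandm u L.
  rewrite /s /n; elim: L {U xu s2 s n} => [|l L IH] /=; first by rewrite mulr1.
  rewrite IH uu' exprVn invrK (exprS (-1)) xV.
  rewrite (eq_bigr (fun k => (xval (u l) - xval (u k)) ^+ 2)); first by ring.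
  by move=> k _; rewrite uu' xV.
rewrite vE xV xu -!/([:: _] ++ xs_of u' L) !(altern_inv _ _ uu') /= -/n -/s.
rewrite !exprVn invrK.
set Z := Zpart _ _ _ _ _; set N1 := altern (v ^+ 2 :: _); set N2 := altern (v ^- 2 :: _).
set Q := \prod_(_ <- _) _; set P := v ^+ (3 * n).
have -> : v ^+ (6 * n) = P ^+ 2 by rewrite -exprM; congr (_ ^+ _); lia.
have P0 : P != 0 by rewrite expf_neq0.
move=> e; transitivity (s * P ^+ 2 * v * (Z / P * (v^-1 + 1) * (s * vandm u L) * Q)).
  by field: s2; rewrite v0 P0.
by rewrite e; field: s2; rewrite v0 P0 expf_neq0 ?pnatr_eq0.
Qed.

(** Both sides vanish: the left through [xval v - xval (u p)], the right because each determinant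
    has a repeated argument. *)
Lemma Phi_zero u p L c v : p \in L -> v ^+ 2 = u p ^+ 2 \/ v ^+ 2 = u p ^- 2 ->
  Phi u L c v.
Proof.
move=> pL e; rewrite /Phi.
have -> : \prod_(l <- L) (xval v - xval (u l)) = 0.
  apply/eqP; rewrite prodf_seq_eq0; apply/hasP; exists p => //=.
  by rewrite subr_eq0 /xval; case: e => ->; rewrite ?invrK // addrC.
have xL : u p ^+ 2 \in xs_of u L /\ u p ^- 2 \in xs_of u L.
  split; apply/flattenP; exists [:: u p ^+ 2; u p ^- 2]; rewrite ?inE ?eqxx ?orbT //;
  by apply/mapP; exists p.
have [x1 x2] := xL; have [e1 e2] : v ^+ 2 \in xs_of u L /\ v ^- 2 \in xs_of u L.
  by case: e => ->; rewrite ?invrK.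
by rewrite !altern_dup // !mulr0 addr0 mulr0.
Qed.

(** The factor [v + 1] is zero, and on the right equal determinants meet with coefficients [-1] and
    [1]. *)
Lemma Phi_m1 u L c : Phi u L c (-1).
Proof.
rewrite /Phi sqrrN expr1n invr1 addNr mulr0 !mul0r (_ : 6 * _ = 2 * (3 * size L))%N; last by lia.
by rewrite exprM sqrrN !expr1n; ring.
Qed.
End PartitionFunction.

(** * Interpolation in v *)

Section Laurent.
Variable K : fieldType.
Implicit Types (g h : K -> K).

(* On nonzero arguments, [g] is a Laurent polynomial with exponents in
   [[-k, d - k]]. *)
Definition laurent (k d : nat) g : Prop :=
  exists p : {poly K}, (size p <= d.+1)%N /\ forall t, t != 0 -> g t * t ^+ k = p.[t].

Lemma laurent_ext k d g h : (forall t, t != 0 -> g t = h t) -> laurent k d g -> laurent k d h.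
Proof. by move=> e [p [sp Hp]]; exists p; split=> // t t0; rewrite -e // Hp. Qed.

Lemma laurentC c : laurent 0 0 (fun=> c).
Proof. by exists c%:P; split=> [|t t0]; rewrite ?size_polyC_leq1 // hornerC mulr1. Qed.

Lemma laurentX : laurent 0 1 id.
Proof. by exists 'X; split=> [|t t0]; rewrite ?size_polyX // hornerX mulr1. Qed.

Lemma laurentV : laurent 1 0 GRing.inv.
Proof. by exists 1; split=> [|t t0]; rewrite ?size_poly1 // hornerC expr1 mulVf. Qed.

Lemma laurentD k d g h : laurent k d g -> laurent k d h -> laurent k d (fun t => g t + h t).
Proof.
move=> [p [sp Hp]] [q [sq Hq]]; exists (p + q); split=> [|t t0].
  by apply: leq_trans (size_polyD _ _) _; rewrite geq_max sp.
by rewrite mulrDl Hp // Hq // hornerD.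
Qed.

Lemma laurentM k d g k' d' h : laurent k d g -> laurent k' d' h ->
  laurent (k + k') (d + d') (fun t => g t * h t).
Proof.
move=> [p [sp Hp]] [q [sq Hq]]; exists (p * q); split=> [|t t0].
  apply: leq_trans (size_polyMleq _ _) _; lia.
by rewrite exprD mulrACA Hp // Hq // hornerM.
Qed.

Lemma laurentW k d k' d' g : (k <= k')%N -> (d + (k' - k) <= d')%N ->
  laurent k d g -> laurent k' d' g.
Proof.
move=> kk dd [p [sp Hp]]; exists (p * 'X^(k' - k)); split=> [|t t0].
  apply: leq_trans (size_polyMleq _ _) _; rewrite size_polyXn; lia.
by rewrite hornerM hornerXn -Hp // -mulrA -exprD subnKC.
Qed.

Lemma laurent_sum k d (J : Type) (s : seq J) (P : pred J) (G : J -> K -> K) :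
  (forall j, P j -> laurent k d (G j)) -> laurent k d (fun t => \sum_(j <- s | P j) G j t).
Proof.
move=> H; elim: s => [|j s IH].
  apply: (@laurent_ext _ _ (fun=> 0)) => [t t0|]; first by rewrite big_nil.
  by exists 0; split=> [|t t0]; rewrite ?size_poly0 // horner0 mul0r.
case Pj: (P j); last by apply: laurent_ext IH => t t0; rewrite big_cons Pj.
by apply: laurent_ext (laurentD (H j Pj) IH) => t t0; rewrite big_cons Pj.
Qed.

Lemma laurent_prod k d (J : Type) (s : seq J) (G : J -> K -> K) :
  (forall j, laurent k d (G j)) ->
  laurent (size s * k) (size s * d) (fun t => \prod_(j <- s) G j t).
Proof.
move=> H; elim: s => [|j s IH].
  by apply: laurent_ext (laurentC 1) => t t0; rewrite big_nil.
by apply: laurent_ext (laurentM (H j) IH) => t t0; rewrite big_cons.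
Qed.

Lemma laurent_pow m : laurent 0 m (fun t => t ^+ m).
Proof.
elim: m => [|m IH]; first exact: laurentC.
by apply: laurent_ext (laurentM laurentX IH) => t t0; rewrite exprS.
Qed.

Lemma laurent_powV m : laurent m 0 (fun t => t ^- m).
Proof.
elim: m => [|m IH]; first by apply: laurent_ext (laurentC 1) => t t0; rewrite expr0 invr1.
by apply: laurent_ext (laurentM laurentV IH) => t t0; rewrite exprS invfM.
Qed.

Lemma laurent_clear k d g : laurent k d g -> laurent 0 d (fun t => g t * t ^+ k).
Proof. by move=> [p [sp Hp]]; exists p; split=> // t t0; rewrite mulr1 Hp. Qed.

Lemma laurent_eq0 k d g (rs : seq K) : laurent k d g -> uniq rs -> (d < size rs)%N ->
  all (fun t => (t != 0) && (g t == 0)) rs -> forall t, t != 0 -> g t = 0.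
Proof.
move=> [p [sp Hp]] U sz /allP rs0 t t0; suff p0 : p = 0.
  by apply: (mulIf (expf_neq0 k t0)); rewrite Hp // p0 horner0 mul0r.
apply: contraTeq sz => p0; rewrite -leqNgt -ltnS.
apply: leq_trans sp; apply: max_poly_roots => //; apply/allP => x /rs0 /andP[x0 /eqP gx].
by rewrite /root -Hp // gx mul0r.
Qed.

End Laurent.

Section Evaluation.
Variables (I : finType) (K : numFieldType) (w : K).
Hypothesis w2 : w ^+ 2 = w - 1.
Implicit Types (u : I -> K) (L : seq I).
Notation state := {ffun I -> bool}.
Notation vect := {ffun state -> K}.

Definition laurentv k d (F : K -> vect) := forall s, laurent k d (fun t => F t s).

Lemma laurentv_op1 k d i p q (F : K -> vect) : laurentv k d F -> laurentv k d (fun t => op1 i p q (F t)).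
Proof.
move=> HF s.
apply: (@laurent_ext _ _ _ (fun t => p (s i) * F t s + q (s i) * F t (fl i s))).
  by move=> t t0; rewrite ffunE.
by apply: laurentD; apply: laurentM (laurentC _) (HF _).
Qed.

Lemma laurentv_op2 k d i j p q (F : K -> vect) : laurentv k d F -> laurentv k d (fun t => op2 i j p q (F t)).
Proof.
move=> HF s.
apply: (@laurent_ext _ _ _ (fun t => p (s i) (s j) * F t s + q (s i) (s j) * F t (fl i (fl j s)))).
  by move=> t t0; rewrite ffunE.
by apply: laurentD; apply: laurentM (laurentC _) (HF _).
Qed.

Lemma laurentv_Xs_const k d u i v L (F : K -> vect) :
  laurentv k d F -> laurentv k d (fun t => Xs w u i v L (F t)).
Proof. by move=> HF; elim: L => //= l L IH; apply: laurentv_op2. Qed.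

Lemma laurentv_Bl_const k d u L (F : K -> vect) :
  laurentv k d F -> laurentv k d (fun t => Bl w u L (F t)).
Proof.
by move=> HF; elim: L => //= l L IH; apply/laurentv_op1/laurentv_Xs_const.
Qed.

Lemma laurent_awt_scale a : laurent 1 2 (fun t => awt w (t * a)).
Proof.
apply: (@laurent_ext _ _ _ (fun t => (2 - w) * a / 3 * t + (1 + w) / a / 3 * t^-1)).
  by move=> t t0; rewrite /awt invfM; ring.
apply: laurentD; last by apply: laurentW (laurentM (laurentC _) (@laurentV _)).
exact: laurentW (laurentM (laurentC _) (@laurentX _)).
Qed.

Lemma laurent_awt_scaleV a : laurent 1 2 (fun t => awt w (t * a)^-1).
Proof.
apply: (@laurent_ext _ _ _ (fun t => (2 - w) / a / 3 * t^-1 + (1 + w) * a / 3 * t)).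
  by move=> t t0; rewrite /awt invrK invfM; ring.
apply: laurentD; first by apply: laurentW (laurentM (laurentC _) (@laurentV _)).
exact: laurentW (laurentM (laurentC _) (@laurentX _)).
Qed.

Lemma laurentv_Xs u c L f :
  laurentv (size L) (2 * size L) (fun t => Xs w u c t L f).
Proof.
elim: L => [|l L IH] s /=; first exact: laurentC.
apply: (@laurent_ext _ _ _ (fun t => eqd (awt w (t * u l)) (awt w (t * u l)^-1) (s c) (s l) *
   Xs w u c t L f s + eqd 1 0 (s c) (s l) * Xs w u c t L f (fl c (fl l s)))).
  by move=> t t0; rewrite [in RHS]ffunE.
rewrite -[(size L).+1]add1n mulnDr; apply: laurentD; last first.
  by apply: laurentW (laurentM (laurentC _) (IH _)); rewrite ?leq_addl //; lia.
apply: laurentM (IH _); rewrite /eqd.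
by case: (s c == s l); [exact: laurent_awt_scale|exact: laurent_awt_scaleV].
Qed.

Lemma laurent_Zpart u L c : laurent (size L) (2 * size L) (fun t => Zpart w u L c t).
Proof. exact/laurentv_Bl_const/laurentv_Xs. Qed.

Lemma laurent_xval_sub (a : K) : laurent 2 4 (fun t => xval t - a).
Proof.
apply: (@laurent_ext _ _ _ (fun t => t ^+ 2 + t ^- 2 + - a)) => //.
apply: laurentD; last exact: laurentW (laurentC _).
apply: laurentD; first exact: laurentW (laurent_pow _ 2).
exact: laurentW (laurent_powV _ 2).
Qed.

Lemma altern_expand (S : seq K) : exists a : 'I_(size S).+1 -> K,
  forall x, altern (x :: S) = \sum_k a k * x ^+ stairexp k.
Proof.
pose M (x : K) : 'M[K]_((size S).+1) :=
  \matrix_(i, k) nth (fun=> 0) [seq powrow y | y <- x :: S] i k.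
exists (fun k => cofactor (M 0) ord0 k) => x.
rewrite /altern /seqdet (expand_det_row _ ord0); apply: eq_bigr => k _.
rewrite mxE mulrC /=; congr (_ * _); rewrite /cofactor; congr (_ * \det _).
by apply/matrixP => i j; rewrite !mxE.
Qed.

(** The largest exponent is [stairexp n.*2 = 3 * n], hence degree at most [6 * n] in [t] for
    argument [t ^ 2]; the factor [t ^ (6 * n)] clears the poles for argument [t ^- 2]. *)
Lemma laurent_altern (S : seq K) n : size S = n.*2 ->
  laurent 0 (6 * n).+1 (fun t => t * altern (t ^+ 2 :: S)) /\
  laurent 0 (6 * n).+1 (fun t => t ^+ (6 * n) * altern (t ^- 2 :: S)).
Proof.
move=> sS; have [a aE] := altern_expand S.
have e3 (k : 'I_(size S).+1) : (2 * stairexp k <= 6 * n)%N.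
  have := ltn_ord k; rewrite /stairexp; move: (nat_of_ord k) => j; lia.
split.
  rewrite -[(6 * n).+1]add1n -[0%N]addn0; apply: laurentM (@laurentX _) _.
  apply: (@laurent_ext _ _ _ (fun t => \sum_k a k * t ^+ (2 * stairexp k))).
    by move=> t t0; rewrite aE; apply: eq_bigr => k _; rewrite exprM.
  apply: laurent_sum => k _.
  by apply: laurentW (laurentM (laurentC _) (laurent_pow _ _)) => //; rewrite subn0 addn0 add0n.
apply: (@laurent_ext _ _ _ (fun t => \sum_k a k * t ^+ (6 * n - 2 * stairexp k))).
  move=> t t0; rewrite aE mulr_sumr; apply: eq_bigr => k _.
  by rewrite exprB ?unitfE // exprVn (exprM t 2); ring.
apply: laurent_sum => k _.
apply: laurentW (laurentM (laurentC _) (laurent_pow _ _)) => //; lia.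
Qed.

(** With [n = size L], the factor [v ^ (3 * n)] splits: [v ^ n] clears the poles of [Zpart], where
    each vertex of [c] has exponents from -1 to 1, and [v ^ (2 * n)] those of the differences of
    [xval]. The degree is then at most [2n + 4n + 1]. *)
Lemma laurent_Phi u L c :
  laurent 0 (6 * size L).+1
    (fun v => Zpart w u L c v * v ^+ (3 * size L) * (v + 1) * vandm u L *
    \prod_(l <- L) (xval v - xval (u l)) -
  3^-1 ^+ 'C(size L, 2) *
    (v * altern (v ^+ 2 :: xs_of u L) + v ^+ (6 * size L) * altern (v ^- 2 :: xs_of u L))).
Proof.
set n := size L.
have [A1 A2] := @laurent_altern (xs_of u L) n (size_xs_of u L).
apply: (@laurent_ext _ _ _ (fun v => Zpart w u L c v * v ^+ (3 * n) * (v + 1) * vandm u L *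
    \prod_(l <- L) (xval v - xval (u l)) + - 3^-1 ^+ 'C(n, 2) *
    (v * altern (v ^+ 2 :: xs_of u L) + v ^+ (6 * n) * altern (v ^- 2 :: xs_of u L)))).
  by move=> t t0; rewrite mulNr.
apply: laurentD; last first.
  by apply: laurentW (laurentM (laurentC _) (laurentD A1 A2)) => //; lia.
have B := laurent_prod (K := K) L (fun l => laurent_xval_sub (xval (u l))).
have X1 : laurent 0 1 (fun v : K => v + 1).
  by apply: laurentD (@laurentX _) (laurentW _ _ (laurentC _)).
have := laurentM (laurentM (laurentM (laurent_clear (laurent_Zpart u L c)) (laurent_clear B)) X1)
  (laurentC (vandm u L)).
rewrite -/n => H; apply: laurentW (laurent_ext _ H) => //; first by lia.
by move=> t t0; rewrite (_ : 3 * n = n + n * 2)%N ?exprD; [ring|lia].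
Qed.
End Evaluation.

Section Interpolation.
Variables (I : finType) (K : numFieldType) (w : K).
Hypothesis w2 : w ^+ 2 = w - 1.
Implicit Types (u : I -> K) (L : seq I).

Let w0 := w_neq0 w2.

Lemma Phi_ext u u' L c v : {in L, u =1 u'} -> Phi w u L c v -> Phi w u' L c v.
Proof.
move=> uL; have [|e1 e2 e3] := @eq_sqr_data _ _ u u' L.
  by move=> l lL; rewrite uL.
by rewrite /Phi /Zpart (eq_Bl _ _ uL) (eq_Xs _ _ _ _ uL) (eq_Br _ _ uL) e1 e2 e3.
Qed.

(** Invert, apply [Phi_rec], invert back. Each inversion renames the unreflected strand, here from
    [c] to [q] and back, which is where the strand [q] is needed. *)
Lemma Phi_recV u p q L c : (forall i, u i != 0) -> uniq (q :: c :: p :: L) ->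
  Phi w u L c (u p) -> Phi w u (p :: L) c (w^-1 / u p).
Proof.
move=> u0 U H; pose u' i := (u i)^-1.
have u'0 i : u' i != 0 by rewrite invr_eq0.
have Uc : uniq (c :: q :: p :: L) by move: U; rewrite /= !inE !(eq_sym c) !negb_or -!andbA => /and5P[-> -> -> -> ->].
have Uq : uniq (q :: p :: L) by case/andP: Uc.
have U' : uniq (q :: c :: L).
  by apply: subseq_uniq U; rewrite /= !eqxx; exact: subseq_cons.
apply: (@Phi_inv _ _ w u u' q) => //; first by rewrite mulf_neq0 ?invr_eq0.
have -> : (w^-1 / u p)^-1 = w / u' p by rewrite /u' invfM !invrK.
apply: Phi_rec => //.
apply: (@Phi_inv _ _ w u' u c) => //; first by move=> i; rewrite invrK.
by rewrite invrK.
Qed.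

Lemma Phi_move u L1 p L2 c v : (forall i, u i != 0) -> v != 0 ->
  uniq (c :: p :: L1 ++ L2) -> {in L1, forall l, awt w (u l / u p) != 0} ->
  Phi w u (p :: L1 ++ L2) c v -> Phi w u (L1 ++ p :: L2) c v.
Proof.
move=> u0 v0; elim/last_ind: L1 L2 => // L1 a IH L2 U A0 H.
rewrite cat_rcons; apply: Phi_swap => //.
- by apply: A0; rewrite mem_rcons mem_head.
- move: U; rewrite cat_rcons => U.
  rewrite -(perm_uniq (s1 := c :: p :: L1 ++ a :: L2)) // perm_cons.
  by rewrite -cat1s perm_catCA.
apply: IH; rewrite -?cat_rcons //.
by move=> l lL; apply: A0; rewrite mem_rcons inE lL orbT.
Qed.

(** A zero satisfies [x ^ 2 = - w], a primitive cube root of unity, hence [x ^ 4 + x ^ 2 + 1 = 0],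
    which no positive [x] does. *)
Lemma awt_neq0 x : 0 < x -> awt w x != 0.
Proof.
move=> x0; rewrite /awt mulf_neq0 ?invr_eq0 ?pnatr_eq0 //; apply/negP => /eqP e.
have xn0 : x != 0 by rewrite gt_eqF.
have e1 : x ^+ 2 = - w.
  have e2 : x * (2 - w) + (1 + w) / x = 0 by rewrite mulrC.
  have n2 : 2 - w != 0.
    rewrite subr_eq0; apply: contra_eq_neq w2 => <-.
    by rewrite -subr_eq0 (_ : _ - _ = 3%:R) ?pnatr_eq0 //; ring.
  apply: (mulfI n2); transitivity (x * (x * (2 - w) + (1 + w) / x) - (1 + w)); last first.
    by rewrite e2; ring: w2.
  by field.
have e2 : x ^+ 4 + x ^+ 2 + 1 = 0 by rewrite (exprM x 2 2) e1; ring: w2.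
have: 0 < x ^+ 4 + x ^+ 2 + 1 by rewrite !addr_gt0 ?exprn_gt0.
by rewrite e2 ltxx.
Qed.

Lemma norm_w : `|w| = 1.
Proof.
apply/eqP; rewrite -(pexpr_eq1 (n := 6)) // -normrX.
by rewrite (_ : w ^+ 6 = 1) ?normr1 //; ring: w2.
Qed.

Lemma w_pow_inj : {in iota 0 6 &, injective (fun k => w ^+ k)}.
Proof.
have n1 : w != 1 by apply: contra_eq_neq w2 => ->; rewrite expr1n subrr oner_neq0.
have nN : w != -1.
  apply: contra_eq_neq w2 => ->; rewrite -subr_eq0 (_ : _ - _ = 3%:R) ?pnatr_eq0 //; ring.
have h1 : w ^+ 2 != 1.
  by rewrite -subr_eq0 (_ : _ - 1 = (w - 1) * (w + 1)) ?mulf_neq0 ?subr_eq0 // ?addr_eq0 //; ring.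
have h2 : w ^+ 3 != 1 by rewrite (w3 w2) eq_sym -subr_eq0 opprK (pnatr_eq0 K 2).
have h3 : w ^+ 4 != 1.
  by rewrite (_ : w ^+ 4 = - w) ?eqr_oppLR //; ring: w2.
have h4 : w ^+ 5 != 1.
  rewrite (_ : w ^+ 5 = 1 - w); last by ring: w2.
  by rewrite -subr_eq0 addrAC subrr sub0r oppr_eq0.
have H j k : (j < k < 6)%N -> w ^+ j != w ^+ k.
  move=> /andP[jk k6]; rewrite -(subnKC (ltnW jk)) exprD -subr_eq0.
  rewrite -{1}[w ^+ j]mulr1 -mulrBr mulf_neq0 ?expf_neq0 // subr_eq0 eq_sym.
  by case: (k - j)%N (subn_gt0 j k) (leq_subr j k) jk => [|[|[|[|[|[|i]]]]]] //; lia.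
move=> j k; rewrite !mem_iota /= !add0n => j6 k6 e.
case: (ltngtP j k) => // jk.
  by have := H j k; rewrite jk k6 e eqxx => /(_ isT).
by have := H k j; rewrite jk j6 e eqxx => /(_ isT).
Qed.

(* Makes the interpolation points [w ^+ k / u l], [u p] and [-1] distinct, and the
   R-matrix weights of [Zpart_swap] nonzero. *)
Definition generic u L :=
  [/\ forall i, u i != 0, {in L, forall l, 1 < u l} & {in L &, injective u}].

Lemma generic_sub u L L' : {subset L' <= L} -> generic u L -> generic u L'.
Proof.
move=> s [h1 h2 h3]; split=> // [l /s|]; first exact: h2.
by move=> x y /s xL /s yL; apply: h3.
Qed.

(** For [k = 0, 3] both sides vanish. [k = 1] is the recursion and [k = 5] its inverted form;
    [k = 4, 2] are the same two with [-u_p] for [u_p], as [w ^ 4 = - w] and [w ^ 2 = - w^-1]. *)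
Lemma Phi_root u p L c k : generic u (p :: L) -> uniq (c :: p :: L) ->
  (size L + 2 < #|I|)%N -> (k < 6)%N ->
  (forall v, v != 0 -> Phi w u L c v) -> Phi w u (p :: L) c (w ^+ k / u p).
Proof.
move=> [u0 _ _] U card k6 IH.
have [q qU] : exists q, q \notin c :: p :: L.
  apply/existsP; rewrite -negb_forall; apply: contraL card => /forallP H.
  rewrite -leqNgt cardT; have := uniq_leq_size (enum_uniq I) (s2 := c :: p :: L).
  by move=> /(_ (fun x _ => H x)) /=; rewrite addn2.
have Uq : uniq (q :: c :: p :: L) by rewrite /= in U *; rewrite qU.
have [cp pL] : c != p /\ p \notin L.
  by move: U; rewrite /= inE negb_or -andbA => /and4P[].
pose u' i := if i == p then - u p else u i.
have u'p : u' p = - u p by rewrite /u' eqxx.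
have uL : {in L, u =1 u'}.
  by move=> l lL; rewrite /u'; case: eqP lL pL => // -> ->.
have u'0 i : u' i != 0 by rewrite /u'; case: ifP; rewrite ?oppr_eq0.
have IH' v : v != 0 -> Phi w u' L c v by move=> v0; apply: (Phi_ext uL); apply: IH.
have ww2 : w ^+ 2 = - w^-1 by field: w2.
have ww4 : w ^+ 4 = - w by ring: w2.
have ww5 : w ^+ 5 = w^-1 by field: w2.
case: k k6 => [|[|[|[|[|[|//]]]]]] _.
- by apply: (@Phi_zero _ _ _ _ p); rewrite ?mem_head // mul1r exprVn; right.
- by apply: Phi_rec; rewrite ?expr1 //; apply: IH.
- rewrite ww2 mulNr -mulrN -invrN -u'p.
  apply: (Phi_opp U u'p uL); apply: (Phi_recV u'0 Uq); exact: IH'.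
- apply: (@Phi_zero _ _ _ _ p); rewrite ?mem_head // (w3 w2) mulN1r sqrrN exprVn; by right.
- rewrite ww4 mulNr -mulrN -invrN -u'p.
  apply: (Phi_opp U u'p uL); apply: (Phi_rec w2 u'0 U); exact: IH'.
by rewrite ww5; apply: (Phi_recV u0 Uq); apply: IH.
Qed.

(* For [L] of size [n], both sides of [Phi] are polynomials in [v] of degree at most
   [6n + 1], which agree at the [6n + 2] points [-1], [u p] and [w ^+ k / u l] for
   [l] in [L] and [k < 6]. *)
Lemma Phi_all u L c v : generic u L -> uniq (c :: L) -> (size L + 1 < #|I|)%N ->
  v != 0 -> Phi w u L c v.
Proof.
have [n] := ubnP (size L); elim: n L c v => // n IH L c v.
rewrite ltnS; case: L => [|p L] sL gL U card v0; first exact: Phi_nil.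
pose g v := Zpart w u (p :: L) c v * v ^+ (3 * size (p :: L)) * (v + 1) * vandm u (p :: L) *
    \prod_(l <- p :: L) (xval v - xval (u l)) -
  3^-1 ^+ 'C(size (p :: L), 2) *
    (v * altern (v ^+ 2 :: xs_of u (p :: L)) +
     v ^+ (6 * size (p :: L)) * altern (v ^- 2 :: xs_of u (p :: L))).
have gPhi x : Phi w u (p :: L) c x <-> g x = 0.
  by rewrite /g /Phi; split=> [->|/eqP]; rewrite ?subrr // subr_eq0 => /eqP.
apply/gPhi; case: (gL) => u0 u1 uinj.
pose ws := [seq w ^+ k / u l | l <- p :: L, k <- iota 0 6].
have pL : uniq (p :: L) by case/andP: U.
have wsP x : x \in ws -> exists l k, [/\ l \in p :: L, (k < 6)%N & x = w ^+ k / u l].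
  by move=> /allpairsP[[l k] [lL + ->]]; rewrite mem_iota => kL; exists l, k.
(* Absolute values separate the nodes: those in [ws] lie inside the unit circle, [-1] on it and
   [u p] outside. *)
have ws1 x : x \in ws -> `|x| < 1.
  move=> /wsP[l [k [lL _ ->]]]; rewrite normrM normrX norm_w expr1n mul1r normfV.
  by rewrite invf_lt1 ?normr_gt0 // gtr0_norm ?(lt_trans ltr01) ?u1.
have Uws : uniq ws.
  apply: allpairs_uniq => // -[l k] [l' k'] /allpairsP[[a b] [aL bk [-> ->]]].
  move=> /allpairsP[[a' b'] [aL' bk' [-> ->]]]; move: aL aL' bk bk' => /=.
  move=> aL aL' bk bk' e.
  have ea : a = a'.
    apply: uinj => //; move/(congr1 Num.norm): (e).
    rewrite !normrM !normrX norm_w !expr1n !mul1r !normfV => /invr_inj.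
    by rewrite !gtr0_norm ?(lt_trans ltr01) ?u1.
  by move: e; rewrite ea => /(mulIf (invr_neq0 (u0 _))) /w_pow_inj ->.
have szws : size ws = (6 * size (p :: L))%N by rewrite size_allpairs mulnC.
have gws x : x \in ws -> (x != 0) && (g x == 0).
  move=> /wsP[l [k [lL k6 ->]]]; rewrite mulf_neq0 ?expf_neq0 ?invr_eq0 //=.
  apply/eqP/gPhi.
  have [L1 [L2 E]] : exists L1 L2, p :: L = L1 ++ l :: L2.
    by case/splitPr: lL => L1 L2; exists L1, L2.
  have PE : perm_eq (p :: L) (l :: L1 ++ L2).
    by rewrite E -cat1s perm_catCA.
  have mE := perm_mem PE.
  have szE : size (L1 ++ L2) = size L by have := perm_size PE => /= -[].
  have UE : uniq (c :: l :: L1 ++ L2).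
    by rewrite -(perm_uniq (s1 := c :: p :: L)) // perm_cons.
  have gE : generic u (l :: L1 ++ L2) by apply: generic_sub gL => y; rewrite mE.
  (* The recursion treats the first strand of the list, so [l] is brought to the front. *)
  rewrite E; apply: Phi_move => //.
  - by rewrite mulf_neq0 ?expf_neq0 ?invr_eq0.
  - move=> k' kL1; apply: awt_neq0; apply: divr_gt0; apply: lt_trans ltr01 _; apply: u1.
      by rewrite mE inE mem_cat kL1 orbT.
    by [].
  apply: Phi_root => //; first by rewrite szE addn2 -(addn1 (size L).+1).
  move=> y y0; apply: IH => //.
  - by rewrite szE.
  - by apply: generic_sub gE => z; rewrite inE => ->; rewrite orbT.
  - by move: UE; rewrite /= inE negb_or -andbA => /and4P[_ -> _ ->].
  - by move: card; rewrite szE /= !addn1 => /ltnW.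
clear wsP; clearbody ws.
apply: (@laurent_eq0 _ 0 (6 * size (p :: L)).+1 g (-1 :: u p :: ws)) => //.
- exact: laurent_Phi.
- rewrite !cons_uniq Uws inE negb_or andbT -andbA; apply/and3P; split.
  + rewrite lt_eqF // (lt_trans _ (u1 p (mem_head _ _))) //.
    by rewrite (lt_trans _ ltr01) // oppr_lt0.
  + by apply/negP => /ws1; rewrite normrN1 ltxx.
  + apply/negP => /ws1; rewrite gtr0_norm ?(lt_trans ltr01) ?u1 ?mem_head //.
    by move=> /(lt_trans (u1 p (mem_head _ _))); rewrite ltxx.
- by rewrite -szws.
apply/allP => x; rewrite !inE => /or3P[/eqP->|/eqP->|/gws//].
  by rewrite oppr_eq0 oner_neq0; apply/eqP/gPhi/Phi_m1.
by rewrite u0; apply/eqP/gPhi; apply: (@Phi_zero _ _ _ _ p); rewrite ?mem_head //; left.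
Qed.
End Interpolation.

(** * The homogeneous limit *)

Section PrincipalSpecialization.
Variable K : numFieldType.

Definition powdet (e : nat -> nat) (m : nat) (s : seq K) : K :=
  seqdet m [seq (fun k => x ^+ e k) | x <- s].

(** The sign does not depend on the exponents [e], so it cancels between the determinants for [id]
    and for [stairexp]. *)
Lemma powdet_perm m (s s' : seq K) : size s' = m -> perm_eq s s' ->
  exists b : bool, forall e, powdet e m s = (-1) ^+ b * powdet e m s'.
Proof.
move=> <- {m} pss; have [p sE] := tuple_permP (t := in_tuple s') pss.
have sE' (i : 'I_(size s')) : s`_i = s'`_(p i).
  by rewrite sE (nth_map i) ?size_enum_ord // nth_ord_enum (tnth_nth 0).
exists (odd_perm p) => e; rewrite -det_perm -det_mulmx -row_permE.
congr (\det _); apply/matrixP => i j; rewrite !mxE !(nth_map 0) ?sE' //.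
by rewrite (perm_size pss).
Qed.

(** On a geometric progression rows and columns change roles: up to column factors the matrix is a
    Vandermonde matrix in the [T ^ e k]. *)
Lemma powdet_geom e n (T : K) : T != 0 ->
  powdet e n.*2.+1 [seq T ^+ i / T ^+ n | i <- iota 0 n.*2.+1] =
  (\prod_(k < n.*2.+1) T ^- (n * e k)) *
  \prod_(i < n.*2.+1) \prod_(j < n.*2.+1 | (i < j)%N) (T ^+ e j - T ^+ e i).
Proof.
move=> T0; set m := n.*2.+1.
pose a : 'rV[K]_m := \row_k T ^+ e k.
pose d : 'rV[K]_m := \row_k T ^- (n * e k).
transitivity (\det (Vandermonde m a *m diag_mx d)).
  congr (\det _); apply/matrixP => i k; rewrite mul_mx_diag !mxE (nth_map 0) ?size_map ?size_iota //.
  rewrite (nth_map 0%N) ?size_iota // nth_iota // add0n exprMn exprVn -!exprM.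
  by rewrite mulnC.
rewrite det_mulmx det_diag det_Vandermonde mulrC; congr (_ * _).
  by apply: eq_bigr => k _; rewrite mxE.
by apply: eq_bigr => i _; apply: eq_bigr => j _; rewrite !mxE.
Qed.

Lemma powdet_id_cons a s : powdet id (size s).+1 (a :: s) =
  \prod_(b <- s) (b - a) * powdet id (size s) s.
Proof.
have V r : powdet id (size r) r = \prod_(i < size r) \prod_(j < size r | (i < j)%N) (r`_j - r`_i).
  pose x : 'rV[K]_(size r) := \row_i r`_i.
  rewrite -[LHS]det_tr; transitivity (\det (Vandermonde (size r) x)).
    by congr (\det _); apply/matrixP => i j; rewrite !mxE (nth_map 0).
  rewrite det_Vandermonde; apply: eq_bigr => i _; apply: eq_bigr => j _.
  by rewrite !mxE.
rewrite (V s) (V (a :: s)) /= big_ord_recl big_mkcond big_ord_recl /= mul1r.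
congr (_ * _).
  by rewrite (big_nth 0) big_mkord; apply: eq_bigr.
apply: eq_bigr => i _; rewrite big_mkcond big_ord_recl /= mul1r [RHS]big_mkcond.
by apply: eq_bigr.
Qed.
End PrincipalSpecialization.

Section IsLaurent.
Variable K : fieldType.
Implicit Types (g h : K -> K).

Definition isLaurent g : Prop := exists k d, laurent k d g.

Lemma isLaurent_ext g h : (forall t, t != 0 -> g t = h t) -> isLaurent g -> isLaurent h.
Proof. by move=> e [k [d H]]; exists k, d; apply: laurent_ext H. Qed.

Lemma isLaurentC c : isLaurent (fun=> c).
Proof. by exists 0, 0; apply: laurentC. Qed.

Lemma isLaurentD g h : isLaurent g -> isLaurent h -> isLaurent (fun t => g t + h t).
Proof.
move=> [k [d H]] [k' [d' H']]; exists (k + k')%N, (d + d' + k + k')%N.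
by apply: laurentD; [apply: laurentW H|apply: laurentW H']; lia.
Qed.

Lemma isLaurentM g h : isLaurent g -> isLaurent h -> isLaurent (fun t => g t * h t).
Proof.
by move=> [k [d H]] [k' [d' H']]; exists (k + k')%N, (d + d')%N; apply: laurentM.
Qed.

Lemma isLaurent_pow m : isLaurent (fun t => t ^+ m).
Proof. by exists 0, m; apply: laurent_pow. Qed.

Lemma isLaurent_powV m : isLaurent (fun t => t ^- m).
Proof. by exists m, 0; apply: laurent_powV. Qed.

Lemma isLaurent_prod (J : Type) (s : seq J) (P : pred J) (G : J -> K -> K) :
  (forall j, isLaurent (G j)) -> isLaurent (fun t => \prod_(j <- s | P j) G j t).
Proof.
move=> H; elim: s => [|j s IH].
  by apply: isLaurent_ext (isLaurentC 1) => t t0; rewrite big_nil.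
have [] := boolP (P j) => Pj.
  by apply: isLaurent_ext (isLaurentM (H j) IH) => t t0; rewrite big_cons Pj.
by apply: isLaurent_ext IH => t t0; rewrite big_cons (negPf Pj).
Qed.

Lemma isLaurent_sum (J : Type) (s : seq J) (P : pred J) (G : J -> K -> K) :
  (forall j, isLaurent (G j)) -> isLaurent (fun t => \sum_(j <- s | P j) G j t).
Proof.
move=> H; elim: s => [|j s IH].
  by apply: isLaurent_ext (isLaurentC 0) => t t0; rewrite big_nil.
have [] := boolP (P j) => Pj.
  by apply: isLaurent_ext (isLaurentD (H j) IH) => t t0; rewrite big_cons Pj.
by apply: isLaurent_ext IH => t t0; rewrite big_cons (negPf Pj).
Qed.

Definition unitLaurent g := isLaurent g /\ isLaurent (fun t => (g t)^-1).

Lemma unitLaurentV g : unitLaurent g -> unitLaurent (fun t => (g t)^-1).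
Proof.
by move=> [H1 H2]; split=> //; apply: isLaurent_ext H1 => t t0; rewrite invrK.
Qed.

Lemma unitLaurentM g h : unitLaurent g -> unitLaurent h -> unitLaurent (fun t => g t * h t).
Proof.
move=> [H1 H2] [H1' H2']; split; first exact: isLaurentM.
by apply: isLaurent_ext (isLaurentM H2 H2') => t t0; rewrite invfM.
Qed.

End IsLaurent.

Section LaurentParameters.
Variables (I : finType) (K : numFieldType) (w : K) (u : K -> I -> K).
Hypothesis uL : forall i, unitLaurent (u ^~ i).
Notation state := {ffun I -> bool}.
Notation vect := {ffun state -> K}.

Definition isLaurentv (F : K -> vect) := forall s, isLaurent (fun t => F t s).

Lemma isLaurent_awt x : unitLaurent x -> isLaurent (fun t => awt w (x t)).
Proof.
move=> [H1 H2]; apply: isLaurentM (isLaurentC _).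
by apply: isLaurentD; apply: isLaurentM => //; apply: isLaurentC.
Qed.

Lemma isLaurent_kwt x : unitLaurent x -> isLaurent (fun t => kwt w (x t)).
Proof.
by move=> [H1 H2]; apply: isLaurentD; apply: isLaurentM => //; apply: isLaurentC.
Qed.

Lemma isLaurentv_Kop i x F : unitLaurent x -> isLaurentv F ->
  isLaurentv (fun t => Kop i (kwt w (x t)) (F t)).
Proof.
move=> /isLaurent_kwt Hx HF s.
apply: (@isLaurent_ext _ (fun t => kwt w (x t) * F t s + F t (fl i s))).
  by move=> t t0; rewrite KopE.
exact: isLaurentD (isLaurentM _ _) _.
Qed.

Lemma isLaurentv_Xop i j x F : unitLaurent x -> isLaurentv F ->
  isLaurentv (fun t => Xop w i j (x t) (F t)).
Proof.
move=> Hx HF s; have H1 := isLaurent_awt Hx; have H2 := isLaurent_awt (unitLaurentV Hx).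
apply: (@isLaurent_ext _ (fun t => eqd (awt w (x t)) (awt w (x t)^-1) (s i) (s j) * F t s +
   eqd 1 0 (s i) (s j) * F t (fl i (fl j s)))).
  by move=> t t0; rewrite [in RHS]ffunE.
apply: isLaurentD; last exact: isLaurentM (isLaurentC _) _.
by apply: isLaurentM => //; rewrite /eqd; case: (s i == s j).
Qed.

Lemma isLaurentv_Xs i v L F : unitLaurent v -> isLaurentv F ->
  isLaurentv (fun t => Xs w (u t) i (v t) L (F t)).
Proof.
by move=> Hv HF; elim: L => //= l L IH; apply: isLaurentv_Xop => //; apply: unitLaurentM.
Qed.

Lemma isLaurentv_Ys i v L F : unitLaurent v -> isLaurentv F ->
  isLaurentv (fun t => Ys w (u t) i (v t) L (F t)).
Proof.
move=> Hv; elim: L F => //= l L IH F HF; apply: IH; apply: isLaurentv_Xop => //.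
exact/unitLaurentM/unitLaurentV.
Qed.

Lemma isLaurentv_Bl L F : isLaurentv F -> isLaurentv (fun t => Bl w (u t) L (F t)).
Proof.
by move=> HF; elim: L => //= l L IH; apply: isLaurentv_Kop => //; apply: isLaurentv_Xs.
Qed.

Lemma isLaurentv_Br L F : isLaurentv F -> isLaurentv (fun t => Br w (u t) L (F t)).
Proof.
elim: L F => //= l L IH F HF; apply: IH.
apply: isLaurentv_Ys; first exact: unitLaurentV.
by apply: isLaurentv_Kop => //; apply: unitLaurentV.
Qed.

Lemma isLaurent_Zpart L c : isLaurent (fun t => Zpart w (u t) L c 1).
Proof.
apply: isLaurentv_Bl; apply: (@isLaurentv_Xs c (fun=> 1)).
  by split; apply: isLaurentC.
by apply: isLaurentv_Br => s; apply: isLaurentC.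
Qed.

End LaurentParameters.

Lemma map_index_uniq (T : eqType) (s : seq T) :
  uniq s -> [seq index x s | x <- s] = iota 0 (size s).
Proof.
move=> Us; apply: (@eq_from_nth _ 0%N); rewrite ?size_map ?size_iota // => i i_s.
have x0 : T by case: (s) i_s.
by rewrite (nth_map x0) // index_uniq // nth_iota.
Qed.

Section HomogeneousLimit.
Variables (I : finType) (K : numFieldType) (w : K).
Hypothesis w2 : w ^+ 2 = w - 1.
Variables (L : seq I) (c : I).
Hypothesis U : uniq (c :: L).
Hypothesis card : (size L + 1 < #|I|)%N.
Let n := size L.
Let m := n.*2.+1.

(** Two pairs contribute four differences, whose product is the square of the difference of their
    [xval]. *)
Lemma powdet_xs_of (u : I -> K) L' : (forall i, u i != 0) ->
  powdet id (size L').*2 (xs_of u L') = vandm u L'.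
Proof.
move=> u0; elim: L' => [|l L' IH]; first by rewrite /powdet /seqdet det_mx00.
rewrite doubleS -(size_xs_of u L') /= -/(xs_of u L').
rewrite (powdet_id_cons _ (_ :: _)) powdet_id_cons size_xs_of IH.
rewrite big_cons !prod_xs_of /=.
suff -> : \prod_(k <- L') (xval (u l) - xval (u k)) ^+ 2 =
    \prod_(k <- L') ((u k ^+ 2 - u l ^+ 2) * (u k ^- 2 - u l ^+ 2)) *
    \prod_(k <- L') ((u k ^+ 2 - u l ^- 2) * (u k ^- 2 - u l ^- 2)) by ring.
rewrite -big_split; apply: eq_bigr => k _ /=.
by rewrite /xval; field; rewrite !u0.
Qed.

(** The exponents start at 1: with the inverses, and the argument 1 supplied by [v = 1], the
    determinants then have as arguments all of [T ^ -n, ..., T ^ n] for [T = t ^ 2]. *)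
Definition geomu (t : K) (i : I) : K := t ^+ (index i L).+1.

Lemma xs_of_geomu t : xs_of (geomu t) L =
  flatten [seq [:: (t ^+ 2) ^+ i.+1; (t ^+ 2) ^- i.+1] | i <- iota 0 n].
Proof.
rewrite /n -map_index_uniq; last by case/andP: U.
rewrite /xs_of -map_comp; congr flatten; apply: eq_map => l /=.
by rewrite /geomu -!exprM mulnC.
Qed.

Lemma perm_geom (T : K) : T != 0 -> perm_eq
  (1 :: flatten [seq [:: T ^+ i.+1; T ^- i.+1] | i <- iota 0 n])
  [seq T ^+ i / T ^+ n | i <- iota 0 m].
Proof.
move=> T0; rewrite /m; elim: n => [|k IH]; first by rewrite /= expr0 divr1.
have -> : iota 0 k.+1.*2.+1 = 0%N :: rcons [seq i.+1 | i <- iota 0 k.*2.+1] k.*2.+2.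
  rewrite doubleS -[LHS]/(0%N :: iota 1 k.*2.+2); congr (_ :: _).
  by rewrite -[in LHS](addn1 k.*2.+1) iotaD cats1 (iotaDl 1 0).
rewrite -[in iota 0 k.+1]addn1 iotaD map_cat flatten_cat.
rewrite map_cons map_rcons -map_comp expr0 mul1r -cats1 -cat_cons.
rewrite (eq_map (_ : _ =1 (fun i => T ^+ i / T ^+ k))); last first.
  by move=> i /=; rewrite !exprS; field; rewrite T0 expf_neq0.
have -> : T ^+ k.*2.+2 / T ^+ k.+1 = T ^+ k.+1.
  by rewrite -addnn -addnS -addSn exprD mulfK ?expf_neq0.
move: IH; set X := flatten _; set Y := [seq _ | i <- _] => /seq.permP IH.
clearbody X Y.
apply/seq.permP => P; have := IH P; rewrite add0n -[flatten [:: _]]/[:: _; _].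
rewrite /= !count_cat /=; lia.
Qed.

Lemma Zpart_geomu t : 1 < t ->
  Zpart w (geomu t) L c 1 *
    ((\prod_(k < m) (t ^+ 2) ^- (n * k)) *
     \prod_(i < m) \prod_(j < m | (i < j)%N) ((t ^+ 2) ^+ j - (t ^+ 2) ^+ i)) =
  3^-1 ^+ 'C(n, 2) *
    ((\prod_(k < m) (t ^+ 2) ^- (n * stairexp k)) *
     \prod_(i < m) \prod_(j < m | (i < j)%N) ((t ^+ 2) ^+ stairexp j - (t ^+ 2) ^+ stairexp i)).
Proof.
move=> t1; have t0 : 0 < t by apply: lt_trans t1.
have tn0 : t != 0 by rewrite gt_eqF.
have T0 : t ^+ 2 != 0 by rewrite expf_neq0.
have u0 i : geomu t i != 0 by rewrite expf_neq0.
have gen : generic (geomu t) L.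
  split=> // [l lL|x y xL yL]; first by rewrite exprn_egt1.
  by rewrite /geomu => /(ieexprIn t0 (negbT (gt_eqF t1))) [] /index_inj ->.
have := Phi_all w2 gen U card (oner_neq0 K).
rewrite /Phi !expr1n !mul1r mulr1 -powdet_xs_of // -/n invr1.
set S := xs_of _ L; set Z := Zpart _ _ _ _ _.
have sS : size S = n.*2 by rewrite size_xs_of.
have -> : altern (1 :: S) = powdet stairexp m (1 :: S) by rewrite /m -sS.
move=> e.
have : Z * powdet id m (1 :: S) = 3^-1 ^+ 'C(n, 2) * powdet stairexp m (1 :: S).
  (* The factor 2 is [v + 1] on the left and the two equal determinants on the right. The product
     over [L] completes [vandm] to the Vandermonde determinant of [1 :: S]. *)
  apply: (mulfI (_ : 2 != 0 :> K)); first by rewrite pnatr_eq0.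
  transitivity (3^-1 ^+ 'C(n, 2) * (powdet stairexp m (1 :: S) + powdet stairexp m (1 :: S))).
    rewrite -e; rewrite /m -sS powdet_id_cons prod_xs_of sS.
    rewrite (eq_bigr (fun l => xval 1 - xval (geomu t l))); first by ring.
    by move=> l _; rewrite /xval expr1n invr1; field; rewrite u0.
  by ring.
have sz : size [seq (t ^+ 2) ^+ i / (t ^+ 2) ^+ n | i <- iota 0 m] = m.
  by rewrite size_map size_iota.
have [b Eb] := powdet_perm sz (perm_geom T0).
rewrite /S xs_of_geomu !Eb !powdet_geom // -/m mulrCA [RHS]mulrCA.
by apply: mulfI; rewrite signr_eq0.
Qed.

(* [T ^ b - T ^ a = (T - 1) * T ^ a * (1 + T + ... + T ^ (b - a - 1))]: the
   powers of [T - 1] cancel from both Vandermonde determinants, after which the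
   identity can be evaluated at [T = 1]. *)
Let qvandm (e : nat -> nat) (T : K) : K :=
  \prod_(i < m) \prod_(j < m | (i < j)%N) (T ^+ e i * \sum_(r < e j - e i) T ^+ r).

Lemma qvandmE e T : {homo e : i j / (i <= j)%N} ->
  \prod_(i < m) \prod_(j < m | (i < j)%N) (T ^+ e j - T ^+ e i) =
  (\prod_(i < m) \prod_(j < m | (i < j)%N) (T - 1)) * qvandm e T.
Proof.
move=> me; rewrite /qvandm -big_split; apply: eq_bigr => i _.
rewrite -big_split; apply: eq_bigr => j ij /=.
rewrite mulrCA -subrX1 mulrBr mulr1 -exprD subnKC //.
by apply: me; apply: ltnW.
Qed.

Lemma stairexp_homo : {homo stairexp : i j / (i <= j)%N}.
Proof. by move=> i j ij; rewrite /stairexp; apply: leq_add => //; apply: half_leq. Qed.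

Lemma isLaurent_qvandm e : isLaurent (fun t => qvandm e (t ^+ 2)).
Proof.
apply: isLaurent_prod => i; apply: isLaurent_prod => j.
apply: isLaurentM.
  by apply: isLaurent_ext (isLaurent_pow _ (2 * e i)) => t _; rewrite exprM.
apply: isLaurent_sum => r.
by apply: isLaurent_ext (isLaurent_pow _ (2 * r)) => t _; rewrite exprM.
Qed.

Lemma Zpart_homogeneous :
  Zpart w (fun=> 1) L c 1 * \prod_(i < m) \prod_(j < m | (i < j)%N) (j - i)%:R =
  3^-1 ^+ 'C(n, 2) *
    \prod_(i < m) \prod_(j < m | (i < j)%N) (stairexp j - stairexp i)%:R.
Proof.
pose M e t := \prod_(k < m) ((t ^+ 2) ^- (n * e k) : K).
pose g t := Zpart w (geomu t) L c 1 * (M id t * qvandm id (t ^+ 2)) +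
  (- 3^-1 ^+ 'C(n, 2)) * (M stairexp t * qvandm stairexp (t ^+ 2)).
have MLaurent e : isLaurent (M e).
  apply: isLaurent_prod => k.
  by apply: isLaurent_ext (isLaurent_powV _ (2 * (n * e k))) => t _; rewrite exprM.
have [k [d gL]] : isLaurent g.
  apply: isLaurentD; apply: isLaurentM; rewrite ?isLaurentC //.
  - apply: (@isLaurent_Zpart _ _ w geomu) => i; split; last exact: isLaurent_powV.
    exact: isLaurent_pow.
  - by apply: isLaurentM => //; apply: isLaurent_qvandm.
  - exact: isLaurentC.
  by apply: isLaurentM => //; apply: isLaurent_qvandm.
have g0 t : 1 < t -> g t = 0.
  move=> t1; have := Zpart_geomu t1.
  rewrite (qvandmE (e := id)) // (qvandmE _ stairexp_homo).
  set D := \prod_(i < m) \prod_(j < m | _) (_ - 1); rewrite -!/(M _ t) => e.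
  have D0 : D != 0.
    apply/prodf_neq0 => i _; apply/prodf_neq0 => j _.
    by rewrite subr_eq0 gt_eqF // exprn_egt1.
  apply: (mulfI D0); rewrite mulr0 /g mulrDr mulNr mulrN; apply/eqP; rewrite subr_eq0; apply/eqP.
  transitivity (Zpart w (geomu t) L c 1 * (M id t * (D * qvandm id (t ^+ 2)))); first by ring.
  by rewrite e; ring.
(* [g] vanishes at the integers [2, ..., d + 2], more points than its degree allows, and hence at
   [t = 1], which [Zpart_geomu] excludes. *)
have := laurent_eq0 gL (rs := [seq i.+2%:R | i <- iota 0 d.+1]) _ _ _ (oner_neq0 K).
rewrite size_map size_iota ltnSn map_inj_uniq ?iota_uniq => [H|]; last first.
  by move=> i j /eqP; rewrite eqr_nat => /eqP[].
have {H} : g 1 = 0.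
  apply: H => //; apply/allP => _ /mapP[i _ ->].
  by rewrite pnatr_eq0 g0 ?eqxx // ltr1n.
have M1 e : M e 1 = 1 by rewrite /M big1 // => i _; rewrite !expr1n invr1.
have q1 e : qvandm e (1 ^+ 2) = \prod_(i < m) \prod_(j < m | (i < j)%N) (e j - e i)%:R.
  apply: eq_bigr => i _; apply: eq_bigr => j _; rewrite !expr1n mul1r.
  by rewrite (eq_bigr (fun=> 1)) ?sumr_const ?card_ord // => r _; rewrite expr1n.
rewrite /g !M1 !q1 !mul1r mulNr => /eqP; rewrite subr_eq0 => /eqP <-.
congr (_ * _); rewrite /Zpart.
have e1 : {in L, geomu 1 =1 (fun=> 1)} by move=> l _; rewrite /geomu expr1n.
by rewrite (eq_Bl _ _ e1) (eq_Xs _ _ _ _ e1) (eq_Br _ _ e1).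
Qed.
End HomogeneousLimit.

(** * From alternating sign matrices to the partition function *)

(* The nonzero entries of [s] are alternately 1 and -1, starting with 1 if the
   initial partial sum [b] is 0 and with -1 if it is 1; if [e] holds, then the
   final partial sum is 1. *)
Fixpoint alternating (e b : bool) (s : seq int) : bool :=
  if s is x :: s' then
    if x == 0 then alternating e b s'
    else (x == if b then -1 else 1) && alternating e (~~ b) s'
  else e ==> b.

Section Walks.
Variables (I : finType) (fixed : pred I).
Notation state := {ffun I -> bool}.

Definition flip_at (v : I * I) (s : state) : state :=
  if v.1 == v.2 then fl v.1 s else fl v.1 (fl v.2 s).

(* The entries 0, 1, -1 along the vertices [P]: a nonzero entry flips the bits of
   both strands through the vertex and requires these to be equal, as in
   [Xop] with argument 1; a pair [(i, i)] stands for [Kop i 1]. *)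
Fixpoint walks (P : seq (I * I)) (s : state) : seq (seq int) :=
  if P is v :: P' then
    [seq 0 :: t | t <- walks P' s] ++
    (if s v.1 == s v.2 then
       [seq (if s v.1 then -1 else 1) :: t | t <- walks P' (flip_at v s)]
     else [::])
  else if [forall i, fixed i ==> s i] then [:: [::]] else [::].

Definition strand (i : I) (P : seq (I * I)) (t : seq int) : seq int :=
  [seq x.2 | x <- zip P t & (x.1.1 == i) || (x.1.2 == i)].

Lemma flip_atE v s i : flip_at v s i = s i (+) ((v.1 == i) || (v.2 == i)).
Proof.
rewrite /flip_at; case: ifP => [/eqP<-|ne]; first by rewrite orbb flE eq_sym.
rewrite !flE !(eq_sym i); case: (eqVneq v.1 i) => [e|_]; last by rewrite addbF.
by rewrite -e eq_sym ne addbF.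
Qed.

Lemma uniq_walks P s : uniq (walks P s).
Proof.
elim: P s => [|v P IH] s /=; first by case: ifP.
rewrite cat_uniq map_inj_uniq ?IH /=; last by move=> ? ? [].
case: ifP => // _; rewrite map_inj_uniq ?IH ?andbT; last by move=> ? ? [].
apply/hasP => -[_ /mapP[t _ ->]] /mapP[t' _ [/eqP]].
by case: (s v.1).
Qed.

(** Both strands through a vertex read the same entry, and a nonzero entry determines the bit of any
    strand that admits it. So the equality of bits required by [walks] follows from conditions on
    single strands. *)
Lemma mem_walks P s t : (t \in walks P s) =
  (size t == size P) && [forall i, alternating (fixed i) (s i) (strand i P t)].
Proof.
elim: P s t => [|v P IH] s t /=.
  have E : [forall i, alternating (fixed i) (s i) (strand i [::] t)] =
           [forall i, fixed i ==> s i].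
    by apply: eq_forallb => i; rewrite /strand; case: t.
  by rewrite E; case: ifP; rewrite ?inE ?andbT ?andbF ?size_eq0.
case: t => [|x t].
  by rewrite mem_cat /=; apply/negbTE; rewrite negb_or; apply/andP; split;
    [apply/mapP => -[]|case: ifP => // _; apply/mapP => -[]].
rewrite eqSS mem_cat.
have strandE i : strand i (v :: P) (x :: t) =
    if (v.1 == i) || (v.2 == i) then x :: strand i P t else strand i P t.
  by rewrite /strand /=; case: ifP.
have mapE y (S : seq (seq int)) : (x :: t \in [seq y :: t' | t' <- S]) = (x == y) && (t \in S).
  apply/mapP/andP => [[t' H [-> ->]]|[/eqP-> H]]; first by rewrite eqxx.
  by exists t.
rewrite mapE.
have -> : (x :: t \in if s v.1 == s v.2 then
    [seq (if s v.1 then -1 else 1) :: t0 | t0 <- walks P (flip_at v s)] else [::]) =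
  [&& s v.1 == s v.2, x == (if s v.1 then -1 else 1) & t \in walks P (flip_at v s)].
  by case: ifP => // _; rewrite mapE.
rewrite !IH; have [x0|xn0] /= := eqVneq x 0.
  rewrite x0 (_ : (0 == (if s v.1 then -1 else 1)) = false) ?andbF ?orbF; last by case: (s v.1).
  congr (_ && _); apply: eq_forallb => i; rewrite -x0 strandE.
  by case: ifP => //= _; rewrite x0 eqxx.
case: (size t == size P); rewrite ?andbF //=.
apply/and3P/forallP => [[/eqP e1 xE /forallP H] i|H].
  have := H i; rewrite strandE flip_atE; case: ifP => vi; last by rewrite addbF.
  have -> : s i = s v.1 by case/orP: vi => /eqP <-.
  by rewrite /= (negPf xn0) xE addbT.
have H1 := H v.1; have H2 := H v.2; rewrite !strandE !eqxx ?orbT /= (negPf xn0) in H1 H2.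
have [/eqP x1 _] := andP H1; have [/eqP x2 _] := andP H2.
have e : s v.1 = s v.2 by move: x2; rewrite x1; case: (s v.1); case: (s v.2).
split; [by rewrite e|by rewrite x1|apply/forallP => i].
have := H i; rewrite strandE flip_atE; case: ifP => vi; last by rewrite addbF.
by rewrite /= (negPf xn0) addbT => /andP[].
Qed.

Variables (K : numFieldType) (w : K).
Notation vect := {ffun state -> K}.

Definition unit_step (v : I * I) (f : vect) : vect :=
  if v.1 == v.2 then Kop v.1 1 f else Xop w v.1 v.2 1 f.

Lemma awt1 : awt w 1 = 1.
Proof. by rewrite /awt; field. Qed.

Lemma kwt1 : kwt w 1 = 1.
Proof. by rewrite /kwt; field. Qed.

Lemma size_walks P s :
  (size (walks P s))%:R =
  foldr unit_step [ffun s : state => [forall i, fixed i ==> s i]%:R] P s.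
Proof.
elim: P s => [|v P IH] s /=; first by rewrite ffunE; case: ifP.
rewrite size_cat size_map natrD IH /unit_step /flip_at.
have [<-|ne] := eqVneq v.1 v.2; first by rewrite eqxx size_map IH KopE mul1r.
rewrite ffunE /eqd invr1 awt1 if_same mul1r.
by case: ifP => _; rewrite ?size_map ?IH ?mul1r // mul0r.
Qed.

End Walks.

(** * The folded lattice as a list of vertices *)

Section Triangle.
Variable n : nat.

(* [triangle] lists the cells [(a, b)] with [a < n], [a <= b] and [a + b <= 2n], one for
   each orbit of the symmetries other than the center, in the order of the vertices
   in [Zpart].  The cell lies on the strands [a] and [minn b (2n - b)]. *)
Definition left_rows (s : seq nat) : seq (nat * nat) :=
  flatten [seq [seq (a, b) | b <- iota a (n - a)] | a <- s].
Definition right_rows (s : seq nat) : seq (nat * nat) :=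
  flatten [seq [seq (a, (2 * n - b)%N) | b <- rev (iota a (n - a))] | a <- s].
Definition triangle : seq (nat * nat) :=
  left_rows (iota 0 n) ++ [seq (a, n) | a <- iota 0 n] ++ right_rows (rev (iota 0 n)).

(** Strands below [n] are reflected and strand [n] ends in the middle. Label [n + 1] lies on no
    vertex: it is the spare strand required by inversion. *)
Definition lab (k : nat) : 'I_n.+2 := inord k.
Definition strands (p : nat * nat) : 'I_n.+2 * 'I_n.+2 :=
  (lab p.1, lab (minn p.2 (2 * n - p.2))).
Definition nested : pred 'I_n.+2 := fun i => (i < n)%N.

Lemma lab_inj k l : (k <= n)%N -> (l <= n)%N -> (lab k == lab l) = (k == l).
Proof.
move=> kn ln; rewrite -val_eqE /= !inordK //; lia.
Qed.

Section Steps.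
Variables (K : numFieldType) (w : K).
Notation vect := {ffun {ffun 'I_n.+2 -> bool} -> K}.
Implicit Type f : vect.
Let one (i : 'I_n.+2) : K := 1.

Lemma Xs_steps a (B : seq nat) f : (a <= n)%N -> {in B, forall b, (b <= n)%N && (a != b)} ->
  Xs w one (lab a) 1 [seq lab b | b <- B] f =
  foldr (unit_step w) f [seq (lab a, lab b) | b <- B].
Proof.
move=> an; elim: B => //= b B IH H; rewrite IH; last by move=> k kB; apply: H; rewrite inE kB orbT.
have /andP[bn ab] := H b (mem_head _ _).
by rewrite /unit_step /= lab_inj // (negPf ab) mulr1.
Qed.

Lemma Ys_steps a (B : seq nat) f : (a <= n)%N -> {in B, forall b, (b <= n)%N && (a != b)} ->
  Ys w one (lab a) 1^-1 [seq lab b | b <- B] f =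
  foldr (unit_step w) f [seq (lab a, lab b) | b <- rev B].
Proof.
move=> an; elim: B f => //= b B IH f H; rewrite IH; last by move=> k kB; apply: H; rewrite inE kB orbT.
have /andP[bn ab] := H b (mem_head _ _).
rewrite rev_cons map_rcons foldr_rcons; congr foldr.
by rewrite /unit_step /= lab_inj // (negPf ab) invr1 mulr1.
Qed.

Lemma strands_left a b : (b <= n)%N -> strands (a, b) = (lab a, lab b).
Proof. by move=> bn; rewrite /strands /= (_ : minn b (2 * n - b) = b) //; lia. Qed.

Lemma strands_right a b : (b <= n)%N -> strands (a, (2 * n - b)%N) = (lab a, lab b).
Proof.
by move=> bn; rewrite /strands /= (_ : minn (2 * n - b) (2 * n - (2 * n - b)) = b) //; lia.
Qed.

Lemma Bl_steps m a f : (a + m = n)%N ->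
  Bl w one [seq lab k | k <- iota a m] f =
  foldr (unit_step w) f [seq strands p | p <- left_rows (iota a m)].
Proof.
elim: m a => [|m IH] a am //; rewrite /left_rows /= map_cat foldr_cat.
rewrite -/(left_rows _) -IH; last by rewrite addSnnS.
have -> : (n - a = m.+1)%N by lia.
rewrite /= strands_left; last by lia.
rewrite /unit_step /= eqxx kwt1 Xs_steps; last 2 first.
- by lia.
- by move=> k; rewrite mem_iota; lia.
congr (Kop _ _ (foldr _ _ _)); rewrite -map_comp; apply/eq_in_map => k.
by rewrite mem_iota => kk /=; rewrite strands_left //; lia.
Qed.

Lemma Br_steps m a f : (a + m = n)%N ->
  Br w one [seq lab k | k <- iota a m] f =
  foldr (unit_step w) f [seq strands p | p <- right_rows (rev (iota a m))].
Proof.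
elim: m a f => [|m IH] a f am //.
rewrite [iota a m.+1]/= rev_cons /right_rows map_rcons flatten_rcons map_cat foldr_cat.
rewrite -/(right_rows _) -IH; last by rewrite addSnnS.
have -> : (n - a = m.+1)%N by lia.
rewrite [iota a m.+1]/= rev_cons !map_rcons foldr_rcons strands_right; last by lia.
rewrite /= {2}/unit_step /= eqxx invr1 kwt1; congr Br.
rewrite -{1}(invr1 K) Ys_steps; last 2 first.
- by lia.
- by move=> k; rewrite mem_iota; lia.
congr foldr; rewrite -map_comp; apply/eq_in_map => k.
by rewrite mem_rev mem_iota => kk /=; rewrite strands_right //; lia.
Qed.

Lemma Zpart_steps :
  Zpart w one [seq lab k | k <- iota 0 n] (lab n) 1 =
  (size (walks nested [seq strands p | p <- triangle] (s0 _)))%:R.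
Proof.
rewrite (size_walks _ w) /triangle !map_cat !foldr_cat /Zpart.
rewrite Br_steps // Bl_steps // Xs_steps //; last first.
  by move=> k; rewrite mem_iota; lia.
have -> : fin_vect K [seq lab k | k <- iota 0 n] =
    [ffun s : {ffun 'I_n.+2 -> bool} => [forall i, nested i ==> s i]%:R].
  apply/ffunP => s; rewrite !ffunE; congr (nat_of_bool _)%:R.
  apply/allP/forallP => [H i|H _ /mapP[k + ->]].
    apply/implyP => ni; apply: H; apply/mapP; exists (val i); first by rewrite mem_iota.
    by rewrite /lab inord_val.
  by rewrite mem_iota => kn; have /implyP := H (lab k); apply; rewrite /nested inordK //; lia.
suff H : forall B g, {in B, forall b, b < n}%N ->
    foldr (unit_step w) g [seq (lab n, lab b) | b <- B] =
    foldr (unit_step w) g [seq strands p | p <- [seq (a, n) | a <- B]].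
  by rewrite H // => k; rewrite mem_iota.
elim=> //= b B IH g H; rewrite IH; last by move=> k kB; apply: H; rewrite inE kB orbT.
have bn := H b (mem_head _ _); rewrite strands_left //.
rewrite /unit_step /= !lab_inj ?(ltnW bn) // (eq_sym n) (ltn_eqF bn); exact: XopC.
Qed.
End Steps.
End Triangle.

(** * Alternating sequences and their reversal *)

Definition final_sum (b : bool) (s : seq int) : bool := foldl (fun c x => c (+) (x != 0)) b s.

Definition signs : seq int := [:: 0; 1; -1].

Lemma alternating_cat e b s t :
  alternating e b (s ++ t) = alternating false b s && alternating e (final_sum b s) t.
Proof.
elim: s b => //= x s IH b; rewrite !IH; case: eqP => [_|_].
  by rewrite addbF.
by rewrite addbT andbA.
Qed.

Lemma alternating_true b s :
  alternating true b s = alternating false b s && final_sum b s.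
Proof. by rewrite -[in LHS](cats0 s) alternating_cat. Qed.

Lemma alternating_signs e b s : alternating e b s -> all (fun x => x \in signs) s.
Proof.
elim: s b => //= x s IH b; rewrite !inE; case: eqP => [_ /IH //|_ /andP[xE /IH ->]].
by move: xE; case: b => ->; rewrite ?orbT.
Qed.

(** In a line of total 1, the partial sum from the far end is 1 minus the one from the near end;
    reversal therefore negates the bits. *)
Lemma alternating_rev b s : alternating false b s ->
  alternating false (~~ final_sum b s) (rev s) /\
  final_sum (~~ final_sum b s) (rev s) = ~~ b.
Proof.
elim: s b => //= x s IH b; rewrite rev_cons -cats1 alternating_cat /final_sum foldl_cat.
rewrite -!/(final_sum _ _); have [x0|xn0] := eqVneq x 0.
  by rewrite addbF => /IH[-> ->]; rewrite /= x0 eqxx /= addbF.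
rewrite addbT => /andP[xE /IH[-> ->]]; rewrite /= (negPf xn0) /= negbK.
by rewrite xE addbT.
Qed.

Lemma alternating_revT s : alternating true false (rev s) = alternating true false s.
Proof.
suff H t : alternating true false t -> alternating true false (rev t).
  by apply/idP/idP => /H //; rewrite revK.
rewrite !alternating_true => /andP[/alternating_rev[h1 h2] e].
by rewrite e in h1 h2; rewrite h1 h2.
Qed.

Lemma asm_lineE s : all (fun x => x \in signs) s ->
  asm_line s = alternating true false s.
Proof.
move=> sS; rewrite /asm_line; set nz := [seq x <- s | x != 0].
have -> : alternating true false s = alternating true false nz.
  rewrite /nz; elim: s false {sS nz} => //= x s IH b; case: eqP => [_|/eqP xn0] //=.
  by rewrite (negPf xn0) IH.
have nzS : all (fun x => (x == 1) || (x == -1)) nz.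
  rewrite /nz all_filter; apply: sub_all sS => x; rewrite !inE.
  by case: eqP => //= _.
clearbody nz => {s sS}.
pose r := fun x y : int => x * y < 0.
(* The bit is encoded as a fictitious entry in front: 1 if [b] holds, -1 otherwise. *)
have sumP (b : bool) : all (fun x => (x == 1) || (x == -1)) nz ->
    alternating true b nz = path r (if b then 1 else -1) nz && (\sum_(x <- nz) x == (~~ b)%:R).
  elim: nz b {nzS} => [|x nz IH] b /=; first by rewrite big_nil; case: b.
  move=> /andP[/orP[]/eqP -> nzS]; rewrite big_cons; case: b; rewrite /r //=.
    by rewrite (IH true) //=; congr (_ && _); move: (\sum_(_ <- _) _) => S; lia.
  by rewrite (IH false) //=; congr (_ && _); move: (\sum_(_ <- _) _) => S; lia.
rewrite sumP //=.
(* In an alternating sequence the sum after a first entry [x] is 0 or [-x], so the total is [x] or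
   0; a total of 1 forces [x = 1]. *)
have first_pos x t : all (fun y => (y == 1) || (y == -1)) t -> (x == 1) || (x == -1) ->
    path r x t -> (\sum_(y <- t) y == 0) || (\sum_(y <- t) y == - x).
  elim: t x => [|y t IH] x /=; first by rewrite big_nil eqxx.
  move=> /andP[y1 tS] x1 /andP[xy pt]; rewrite big_cons.
  have := IH y tS y1 pt; move: xy y1 x1 {pt IH}; rewrite /r.
  by move: (\sum_(_ <- _) _) => S; nia.
case: nz nzS {sumP} => [_|x nz /= /andP[x1 nzS]]; first by rewrite /= big_nil.
rewrite big_cons; apply/andP/andP => [[pt s1]|[/andP[_ pt] s1]]; split=> //.
have := first_pos _ _ nzS x1 pt; rewrite pt andbT.
by move: s1 x1; rewrite /r; move: (\sum_(_ <- _) _) => S; lia.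
Qed.

Lemma filter_singletons (T : eqType) (P : pred T) (s : seq T) x :
  uniq s -> x \in s -> {in s, forall y, P y = (y == x)} -> [seq y <- s | P y] = [:: x].
Proof.
move=> Us xs PE; rewrite -(filter_pred1_uniq Us xs); apply: eq_in_filter => y ys.
exact: PE.
Qed.

Lemma rev_iota_sub N i m : (i + m <= N.+1)%N ->
  [seq (N - b)%N | b <- rev (iota i m)] = iota (N.+1 - i - m) m.
Proof.
move=> le; apply: (@eq_from_nth _ 0%N); rewrite size_map size_rev ?size_iota // => j jm.
rewrite (nth_map 0%N) ?size_rev ?size_iota // nth_rev ?size_iota // !nth_iota //; lia.
Qed.

Lemma flatten_staircase (T : Type) (g : nat -> T) (r : seq T) i n : (i < n)%N ->
  flatten [seq (if (a < i)%N then [:: g a] else if a == i then r else [::]) | a <- iota 0 n] =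
    [seq g a | a <- iota 0 i] ++ r /\
  flatten [seq (if (a < i)%N then [:: g a] else if a == i then r else [::])
            | a <- rev (iota 0 n)] = r ++ [seq g a | a <- rev (iota 0 i)].
Proof.
move=> ni; set f := fun a => if _ then _ else _.
have iotaE : iota 0 n = iota 0 i ++ i :: iota i.+1 (n - i.+1).
  by rewrite -[X in iota 0 X](subnKC ni) addSnnS iotaD /=; congr (_ ++ _ :: iota _ _); lia.
have f1 s : {in s, forall a, (a < i)%N} -> flatten (map f s) = map g s.
  by move=> H; rewrite -(flatten_map1 g); congr flatten; apply/eq_in_map => a /H; rewrite /f => ->.
have f2 s : {in s, forall a, (i < a)%N} -> flatten (map f s) = [::].
  elim: s => //= a s IH H; rewrite IH; last by move=> b bs; apply: H; rewrite inE bs orbT.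
  have := H a (mem_head _ _); rewrite /f; by case: ltngtP.
have fi : f i = r by rewrite /f ltnn eqxx.
rewrite iotaE rev_cat rev_cons -cats1 !map_cat !flatten_cat /= fi !cats0.
rewrite (f2 (iota i.+1 _)) ?(f2 (rev (iota i.+1 _))) ?(f1 (iota 0 i)) ?(f1 (rev (iota 0 i))) ?cats0 //;
  by move=> a; rewrite ?mem_rev mem_iota; lia.
Qed.

(** * Strands of the triangle and rows of the matrix *)

Section Bijection.
Variable n : nat.

(** The representative in the triangle of the orbit of [(i, j)]: reflected in the diagonal so that
    the row index is the smaller one, and also in the antidiagonal if the cell lies beyond it. *)
Definition canon (i j : nat) : nat * nat :=
  if (i + j <= 2 * n)%N then (minn i j, maxn i j)
  else ((2 * n - maxn i j)%N, (2 * n - minn i j)%N).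

Definition on_strand (i : nat) (p : nat * nat) : bool :=
  (p.1 == i) || (minn p.2 (2 * n - p.2) == i)%N.

(** The order of the triangle is chosen for this: strand [i] goes down column [i] to the diagonal,
    along row [i] to the antidiagonal and up column [2n - i], which is row [i] of the matrix folded,
    from left to right. *)
Lemma triangle_strand i : (i < n)%N ->
  [seq p <- triangle n | on_strand i p] = [seq canon i j | j <- iota 0 (2 * n).+1].
Proof.
move=> ni.
have nE : n = (i + (n - i.+1).+1)%N by lia.
have Lrow a : (a < n)%N -> [seq p <- [seq (a, b) | b <- iota a (n - a)] | on_strand i p] =
    if (a < i)%N then [:: (a, i)] else if a == i then [seq (i, b) | b <- iota i (n - i)] else [::].
  move=> an; rewrite filter_map; case: ltngtP => ai.
  - rewrite (@filter_singletons _ _ _ i) ?iota_uniq ?mem_iota //; first by lia.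
    by move=> b; rewrite mem_iota /on_strand /=; lia.
  - rewrite (@eq_in_filter _ _ pred0) ?filter_pred0 // => b.
    by rewrite mem_iota /on_strand /=; lia.
  by rewrite ai (@eq_in_filter _ _ predT) ?filter_predT // => b _; rewrite /on_strand /= eqxx.
have Rrow a : (a < n)%N ->
    [seq p <- [seq (a, (2 * n - b)%N) | b <- rev (iota a (n - a))] | on_strand i p] =
    if (a < i)%N then [:: (a, (2 * n - i)%N)] else
    if a == i then [seq (i, b) | b <- iota n.+1 (n - i)] else [::].
  move=> an; rewrite filter_map; case: ltngtP => ai.
  - rewrite (@filter_singletons _ _ _ i) ?rev_uniq ?iota_uniq ?mem_rev ?mem_iota //; first by lia.
    by move=> b; rewrite mem_rev mem_iota /on_strand /=; lia.
  - rewrite (@eq_in_filter _ _ pred0) ?filter_pred0 // => b.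
    by rewrite mem_rev mem_iota /on_strand /=; lia.
  rewrite ai (@eq_in_filter _ _ predT) ?filter_predT; last first.
    by move=> b _; rewrite /on_strand /= eqxx.
  have := @rev_iota_sub (2 * n) i (n - i); rewrite (_ : (2 * n).+1 - i - (n - i) = n.+1)%N; last by lia.
  by move=> <-; [rewrite -map_comp|lia].
have Crow : [seq p <- [seq (a, n) | a <- iota 0 n] | on_strand i p] = [:: (i, n)].
  rewrite filter_map (@filter_singletons _ _ _ i) ?iota_uniq ?mem_iota //.
  by move=> b; rewrite mem_iota /on_strand /=; lia.
rewrite /triangle !filter_cat Crow /left_rows /right_rows !filter_flatten -!map_comp.
have -> : flatten [seq [seq p <- [seq (a, b) | b <- iota a (n - a)] | on_strand i p] | a <- iota 0 n] =
    [seq (a, i) | a <- iota 0 i] ++ [seq (i, b) | b <- iota i (n - i)].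
  rewrite -(flatten_staircase (fun a => (a, i)) _ ni).1; congr flatten.
  by apply/eq_in_map => a; rewrite mem_iota /= => an; rewrite Lrow.
have -> : flatten [seq [seq p <- [seq (a, (2 * n - b)%N) | b <- rev (iota a (n - a))]
      | on_strand i p] | a <- rev (iota 0 n)] =
    [seq (i, b) | b <- iota n.+1 (n - i)] ++ [seq (a, (2 * n - i)%N) | a <- rev (iota 0 i)].
  rewrite -(flatten_staircase (fun a => (a, (2 * n - i)%N)) _ ni).2; congr flatten.
  by apply/eq_in_map => a; rewrite mem_rev mem_iota /= => an; rewrite Rrow.
have -> : iota 0 (2 * n).+1 =
    iota 0 i ++ iota i (n - i) ++ iota n 1 ++ iota n.+1 (n - i) ++ iota ((2 * n).+1 - i) i.
  have E : (2 * n).+1 = (i + ((n - i) + (1 + ((n - i) + i))))%N by lia.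
  rewrite [X in iota 0 X]E !iotaD.
  by do ?congr (_ ++ _); congr (iota _ _); lia.
rewrite !map_cat -!catA; congr (_ ++ _ ++ _ ++ _ ++ _).
- by apply/eq_in_map => a; rewrite mem_iota /canon => ai; rewrite ifT; [congr pair|]; lia.
- by apply/eq_in_map => a; rewrite mem_iota /canon => ai; rewrite ifT; [congr pair|]; lia.
- by rewrite /= /canon ifT; [congr [:: (_, _)]|]; lia.
- by apply/eq_in_map => a; rewrite mem_iota /canon => ai; rewrite ifT; [congr pair|]; lia.
have := @rev_iota_sub (2 * n) 0 i; rewrite subn0 => <-; last by lia.
rewrite -map_comp; apply/eq_in_map => a; rewrite mem_rev mem_iota /canon /= => ai.
by rewrite ifF; [congr pair|]; lia.
Qed.

Lemma triangle_center :
  [seq p <- triangle n | on_strand n p] = [seq canon n j | j <- iota 0 n].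
Proof.
rewrite /triangle !filter_cat /left_rows /right_rows !filter_flatten -!map_comp.
have flatten0 (s : seq nat) (f : nat -> seq (nat * nat)) :
    {in s, forall a, f a = [::]} -> flatten [seq f a | a <- s] = [::].
  elim: s => //= a s IH H; rewrite H ?mem_head // IH // => b bs.
  by apply: H; rewrite inE bs orbT.
rewrite !flatten0 ?cats0 /=.
- rewrite filter_map (@eq_in_filter _ _ predT) ?filter_predT.
    by apply/eq_in_map => a; rewrite mem_iota /canon => an; rewrite ifT; [congr pair|]; lia.
  by move=> a; rewrite mem_iota /on_strand /=; lia.
- move=> a; rewrite mem_rev mem_iota /= => an; rewrite filter_map.
  rewrite (@eq_in_filter _ _ pred0) ?filter_pred0 // => b.
  by rewrite mem_rev mem_iota /on_strand /=; lia.
move=> a; rewrite mem_iota /= => an; rewrite filter_map.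
rewrite (@eq_in_filter _ _ pred0) ?filter_pred0 // => b.
by rewrite mem_iota /on_strand /=; lia.
Qed.

End Bijection.

(** * Symmetric matrices as walks *)

Section DASASMCount.
Variable n : nat.
Notation m := (2 * n).+1.

Lemma mem_triangle p : (p \in triangle n) =
  [&& (p.1 < n)%N, (p.1 <= p.2)%N & (p.1 + p.2 <= 2 * n)%N].
Proof.
case: p => a b /=; rewrite /triangle !mem_cat; apply/or3P/and3P.
  case=> [/allpairsPdep[x [y [xn yn [-> ->]]]]|/mapP[x xn [-> ->]]|/allpairsPdep[x [y [xn yn [-> ->]]]]].
  - by rewrite !mem_iota in xn yn; split; lia.
  - by rewrite !mem_iota in xn; split; lia.
  by rewrite !mem_rev !mem_iota in xn yn; split; lia.
move=> [an ab abn]; case: (ltngtP b n) => bn.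
- apply: Or31; apply/allpairsPdep; exists a, b; rewrite !mem_iota; split=> //; lia.
- apply: Or33; apply/allpairsPdep; exists a, (2 * n - b)%N; rewrite !mem_rev !mem_iota.
  by split; [lia|lia|congr pair; lia].
by apply: Or32; apply/mapP; exists a; rewrite ?mem_iota ?bn //; lia.
Qed.

Lemma uniq_triangle : uniq (triangle n).
Proof.
have L : uniq (left_rows n (iota 0 n)).
  apply: allpairs_uniq_dep => [|a _|[a b] [a' b'] _ _ /= [-> ->]] //; exact: iota_uniq.
have R : uniq (right_rows n (rev (iota 0 n))).
  apply: allpairs_uniq_dep => [|a _|].
  - by rewrite rev_uniq iota_uniq.
  - by rewrite rev_uniq iota_uniq.
  move=> _ _ /allpairsPdep[a [b [an bn ->]]] /allpairsPdep[a' [b' [an' bn' ->]]] /= [e1 e2].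
  subst a'; congr Tagged; rewrite !mem_rev !mem_iota in an bn bn'; lia.
rewrite /triangle !cat_uniq L R andbT /= map_inj_uniq ?iota_uniq ?andbT; last by move=> a b [].
apply/andP; split; last first.
  apply/hasPn => _ /allpairsPdep[a [b [an bn ->]]]; apply/mapP => -[c cn [_ e]].
  by rewrite !mem_rev !mem_iota in an bn cn; lia.
apply/hasPn => p; rewrite mem_cat => pM; apply/allpairsPdep => -[a [b [an bn pE]]].
rewrite !mem_iota in an bn; case/orP: pM => [/mapP[c cn]|/allpairsPdep[c [d [cn dn]]]].
  by rewrite pE => -[_ e]; lia.
by rewrite pE => -[_ e]; rewrite !mem_rev !mem_iota in cn dn; lia.
Qed.

Lemma strand_map (v : nat * nat -> int) (x : 'I_n.+2) :
  strand x [seq strands n p | p <- triangle n] [seq v p | p <- triangle n] =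
  [seq v p | p <- triangle n & on_strand n x p].
Proof.
rewrite /strand; have -> : zip [seq strands n p | p <- triangle n] [seq v p | p <- triangle n] =
    [seq (strands n p, v p) | p <- triangle n] by elim: (triangle n) => //= p s ->.
rewrite filter_map -map_comp; congr map; apply: eq_in_filter => -[a b].
rewrite mem_triangle /= => pT; rewrite /on_strand /=.
have labE k : (k <= n)%N -> (lab n k == x) = (k == x).
  by move=> kn; rewrite -val_eqE /= inordK //; lia.
by rewrite !labE //; lia.
Qed.

Lemma mem_walks_triangle (v : nat * nat -> int) :
  ([seq v p | p <- triangle n] \in
     walks (@nested n) [seq strands n p | p <- triangle n] (s0 _)) <->
  (forall i, (i < n)%N -> alternating true false [seq v (canon n i j) | j <- iota 0 m]) /\
  alternating false false [seq v (canon n n j) | j <- iota 0 n].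
Proof.
rewrite mem_walks !size_map eqxx /=; split=> [/forallP H|[H1 H2]].
  split=> [i ni|].
    have := H (lab n i); rewrite strand_map ffunE /nested /= !inordK; [|lia].
    by rewrite ni triangle_strand // -map_comp.
  have := H (lab n n); rewrite strand_map ffunE /nested /= !inordK; [|lia].
  by rewrite ltnn triangle_center // -map_comp.
apply/forallP => x; rewrite strand_map ffunE /nested.
have := ltn_ord x; move: (nat_of_ord x) => i ilt.
case: (ltngtP i n) => [lt|gt|->].
- by rewrite triangle_strand // -map_comp; apply: H1.
- rewrite (@eq_in_filter _ _ pred0) ?filter_pred0 // => -[a b].
  by rewrite mem_triangle /on_strand /=; lia.
by rewrite triangle_center -map_comp.
Qed.

Implicit Type A : 'M[asm_entry]_m.

Definition entry A (i j : nat) : int := val (A (inord i) (inord j)).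
Definition code A : seq int := [seq entry A p.1 p.2 | p <- triangle n].

Lemma entry_row A (i : nat) :
  [seq map_mx val A (inord i) j | j : 'I_m] = [seq entry A i j | j <- iota 0 m].
Proof.
rewrite -val_enum_ord -map_comp; apply: eq_map => j /=.
by rewrite mxE /entry inord_val.
Qed.

Lemma entry_signs A i j : entry A i j \in signs.
Proof. exact: (valP (A (inord i) (inord j))). Qed.

Lemma entry_inj A A' :
  (forall i j, (i < m)%N -> (j < m)%N -> entry A i j = entry A' i j) -> A = A'.
Proof.
move=> H; apply/matrixP => i j; apply: val_inj.
by have := H i j (ltn_ord i) (ltn_ord j); rewrite /entry !inord_val.
Qed.

Lemma DASASM_P A : reflect
  [/\ forall i j, (i < m)%N -> (j < m)%N -> entry A i j = entry A j i,
      forall i j, (i < m)%N -> (j < m)%N -> entry A j i = entry A (2 * n - j) (2 * n - i) &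
      forall i, (i < m)%N -> alternating true false [seq entry A i j | j <- iota 0 m]]
  (A \in DASASM m).
Proof.
have rowE (i : 'I_m) : asm_line [seq map_mx val A i j | j : 'I_m] =
    alternating true false [seq entry A i j | j <- iota 0 m].
  rewrite -{1}(inord_val i) entry_row asm_lineE //.
  by apply/allP => _ /mapP[j _ ->]; apply: entry_signs.
have revE (i : 'I_m) : (rev_ord i : nat) = (2 * n - i)%N by rewrite /= subSS.
rewrite inE; apply: (iffP andP) => [[/and3P[_ /forallP H2 _] /forallP H4]|[S1 S2 S3]].
  have H i j : (i < m)%N -> (j < m)%N -> (entry A i j == entry A j i) &&
      (entry A j i == entry A (2 * n - j) (2 * n - i)).
    move=> im jm; have /forallP/(_ (inord j)) := H4 (inord i); rewrite !mxE.
    have rE (k : 'I_m) : rev_ord k = inord (2 * n - k).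
      by apply: ord_inj; rewrite revE inordK //; lia.
    by rewrite !rE !inordK.
  split=> [i j im jm|i j im jm|i im].
  - by have /andP[/eqP] := H _ _ im jm.
  - by have /andP[_ /eqP] := H _ _ im jm.
  by have := H2 (inord i); rewrite rowE inordK.
have S i j : A i j = A j i by apply: val_inj; have := S1 _ _ (ltn_ord i) (ltn_ord j); rewrite /entry !inord_val.
split.
  apply/and3P; split.
  - by apply/forallP => i; apply/forallP => j; rewrite mxE; apply: valP.
  - by apply/forallP => i; rewrite rowE S3.
  apply/forallP => j; have := S3 j (ltn_ord j); rewrite -rowE.
  by congr asm_line; apply: eq_map => i; rewrite !mxE S.
apply/forallP => i; apply/forallP => j; rewrite !mxE S eqxx /=.
have := S2 _ _ (ltn_ord i) (ltn_ord j); rewrite /entry !inord_val => ->.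
by rewrite -!revE !inord_val.
Qed.

Lemma entry_canon A i j : A \in DASASM m -> (i < m)%N -> (j < m)%N ->
  entry A i j = entry A (canon n i j).1 (canon n i j).2.
Proof.
move=> /DASASM_P[S1 S2 _] im jm; rewrite /canon; case: ifP => ij /=.
  by rewrite /minn /maxn; case: ifP => // _; apply: S1.
by rewrite /minn /maxn; case: ifP => // _; [rewrite S1 // S2|rewrite S2].
Qed.

Lemma code_walks A : A \in DASASM m ->
  code A \in walks (@nested n) [seq strands n p | p <- triangle n] (s0 _).
Proof.
move=> AD; have [_ _ S3] := DASASM_P _ AD; apply/mem_walks_triangle.
have rE i : (i < m)%N -> [seq entry A (canon n i j).1 (canon n i j).2 | j <- iota 0 m] =
    [seq entry A i j | j <- iota 0 m].
  by move=> im; apply/eq_in_map => j; rewrite mem_iota => jm; rewrite -entry_canon.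
split=> [i ni|]; first by rewrite rE; [apply: S3|]; lia.
have nm : (n < m)%N by lia.
have := S3 n nm; rewrite -rE //.
have -> : iota 0 m = iota 0 n ++ iota n n.+1 by rewrite -iotaD; congr (iota _ _); lia.
by rewrite map_cat alternating_cat => /andP[].
Qed.

Lemma asm_sum (s : seq int) : asm_line s -> \sum_(x <- s) x = 1.
Proof.
move=> /andP[_ /eqP]; rewrite big_filter => <-.
by rewrite [LHS](bigID (fun x => x != 0)) /= [X in _ + X]big1 ?addr0 // => x /negPn/eqP.
Qed.

Lemma canon_triangle i j : (i < m)%N -> (j < m)%N -> ~~ ((i == n) && (j == n)) ->
  canon n i j \in triangle n.
Proof. by move=> im jm ij; rewrite mem_triangle /canon; case: ifP => /=; lia. Qed.

(** All entries but the central one are read off the triangle through [canon]; the central one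
    follows from its row sum 1. *)
Lemma code_inj : {in DASASM m &, injective code}.
Proof.
move=> A A' AD AD' /eq_in_map e.
have E i j : (i < m)%N -> (j < m)%N -> ~~ ((i == n) && (j == n)) ->
    entry A i j = entry A' i j.
  move=> im jm ij; rewrite (entry_canon AD) // (entry_canon AD') //.
  exact/e/canon_triangle.
apply: entry_inj => i j im jm.
case: (boolP ((i == n) && (j == n))) => [/andP[/eqP-> /eqP->]|]; last exact: E.
have row1 B : B \in DASASM m -> \sum_(x <- [seq entry B n j | j <- iota 0 m]) x = 1.
  move=> /DASASM_P[_ _ H]; apply: asm_sum; rewrite asm_lineE ?H //; first by lia.
  by apply/allP => _ /mapP[k _ ->]; apply: entry_signs.
have := row1 _ AD; rewrite -(row1 _ AD') !big_map.
have nI : n \in iota 0 m by rewrite mem_iota; lia.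
rewrite !(bigD1_seq n) ?iota_uniq // => H.
apply: (addIr (\sum_(k <- iota 0 m | k != n) entry A n k)); rewrite H; congr (_ + _).
rewrite big_seq_cond [RHS]big_seq_cond; apply: eq_bigr => k; rewrite mem_iota => /andP[km kn].
by rewrite E ?(negPf kn) ?andbF //; lia.
Qed.

Lemma code_surj t : t \in walks (@nested n) [seq strands n p | p <- triangle n] (s0 _) ->
  exists2 A, A \in DASASM m & t = code A.
Proof.
move=> tW; have := tW; rewrite mem_walks size_map => /andP[/eqP sz _].
pose v p := nth 0 t (index p (triangle n)).
have tE : t = [seq v p | p <- triangle n].
  apply: (@eq_from_nth _ 0); rewrite ?size_map // => i it.
  have iT : (i < size (triangle n))%N by rewrite -sz.
  by rewrite (nth_map (0, 0)%N) // /v index_uniq // uniq_triangle.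
move: tW; rewrite {1}tE => /mem_walks_triangle[H1 H2].
set xs := [seq v (canon n n j) | j <- iota 0 n] in H2.
(* The central entry is forced: the half row before it has sum 0 or 1 and recurs, mirrored, after
   it, so a total of 1 leaves 1 or -1. *)
pose e : int := if final_sum false xs then -1 else 1.
pose b i j := if (i == n) && (j == n) then e else v (canon n i j).
have bS i j : (i < m)%N -> (j < m)%N -> b i j \in signs.
  move=> im jm; rewrite /b; case: (boolP (_ && _)) => ij; first by rewrite /e; case: ifP.
  have := canon_triangle im jm ij; set p := canon n i j => pT.
  have p1 : (p.1 < n)%N by move: pT; rewrite mem_triangle => /and3P[].
  have /alternating_signs/allP := H1 _ p1; apply.
  have : p \in [seq q <- triangle n | on_strand n p.1 q] by rewrite mem_filter pT /on_strand eqxx.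
  by rewrite triangle_strand // => /mapP[k kI pE]; apply/mapP; exists k; rewrite // -pE.
have sym i j : b i j = b j i.
  by rewrite /b andbC; congr (if _ then _ else v _); rewrite /canon addnC minnC maxnC.
have asym i j : (i < m)%N -> (j < m)%N -> b j i = b (2 * n - j)%N (2 * n - i)%N.
  move=> im jm; rewrite /b; have -> : (j == n) && (i == n) = (2 * n - j == n)%N && (2 * n - i == n)%N by lia.
  case: ifP => // ij; congr v; rewrite /canon; case: ifP; case: ifP => ? ?; congr pair; lia.
have zS : 0 \in signs by [].
pose A : 'M[asm_entry]_m := \matrix_(i, j) insubd (SeqSub zS : asm_entry) (b i j).
have AE i j : (i < m)%N -> (j < m)%N -> entry A i j = b i j.
  by move=> im jm; rewrite /entry mxE !inordK // insubdK // bS.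
have AD : A \in DASASM m.
  apply/DASASM_P; split=> [i j im jm|i j im jm|i im].
  - by rewrite !AE // sym.
  - by rewrite !AE; [exact: asym|lia..].
  have -> : [seq entry A i j | j <- iota 0 m] = [seq b i j | j <- iota 0 m].
    by apply/eq_in_map => j; rewrite mem_iota => jm; rewrite AE.
  have lowrow k : (k < n)%N -> alternating true false [seq b k j | j <- iota 0 m].
    by move=> kn; have := H1 k kn; congr alternating; apply: eq_map => j; rewrite /b ltn_eqF.
  have revm : iota 0 m = [seq (2 * n - j)%N | j <- rev (iota 0 m)].
    by rewrite rev_iota_sub ?add0n // subn0 subnn.
  case: (ltngtP i n) => [lt|gt|->]; first exact: lowrow.
    (* The two reflections compose to a half-turn, so a row below the center is a row above it read
       backwards. *)
    rewrite revm -map_comp map_rev alternating_revT.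
    rewrite (_ : map _ _ = [seq b (2 * n - i)%N j | j <- iota 0 m]); first by apply: lowrow; lia.
    apply/eq_in_map => j; rewrite mem_iota => jm /=.
    rewrite sym asym; [|lia|lia]; rewrite (_ : 2 * n - (2 * n - j) = j)%N; last by lia.
    exact: sym.
  have -> : iota 0 m = iota 0 n ++ n :: iota n.+1 n.
    have -> : m = (n + n.+1)%N by lia.
    by rewrite iotaD.
  have -> : iota n.+1 n = [seq (2 * n - j)%N | j <- rev (iota 0 n)].
    by rewrite rev_iota_sub ?add0n; [congr (iota _ _)|]; lia.
  rewrite map_cat map_cons -map_comp map_rev.
  have -> : [seq b n j | j <- iota 0 n] = xs.
    by apply/eq_in_map => j; rewrite mem_iota /b eqxx /= => jn; rewrite ltn_eqF.
  have -> : [seq (b n \o (fun j => 2 * n - j)%N) j | j <- iota 0 n] = xs.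
    apply/eq_in_map => j; rewrite mem_iota => jn /=; rewrite sym asym; [|lia|lia].
    rewrite (_ : 2 * n - (2 * n - j) = j)%N; last by lia.
    rewrite (_ : 2 * n - n = n)%N; last by lia.
    by rewrite sym /b eqxx /= ltn_eqF.
  have bnn : b n n = e by rewrite /b eqxx.
  rewrite alternating_cat H2 /= bnn /e.
  have [r1 r2] := alternating_rev H2.
  case: (final_sum false xs) r1 r2 => /= r1 r2; by rewrite alternating_true r1 r2.
exists A => //; rewrite tE; apply/eq_in_map => -[p1 p2].
rewrite mem_triangle /= => /and3P[p1n p12 p12n].
rewrite AE /b; [|lia|lia]; rewrite (ltn_eqF p1n) /=.
by congr v; rewrite /canon p12n; congr pair; lia.
Qed.

Lemma card_DASASM : #|DASASM m| =
  size (walks (@nested n) [seq strands n p | p <- triangle n] (s0 _)).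
Proof.
rewrite cardE -(size_map code); apply/perm_size/uniq_perm.
- rewrite map_inj_in_uniq ?enum_uniq // => A A'; rewrite !mem_enum.
  exact: code_inj.
- exact: uniq_walks.
move=> t; apply/mapP/idP => [[A]|/code_surj[A AD ->]].
  by rewrite mem_enum => /code_walks H ->.
by exists A; rewrite ?mem_enum.
Qed.

End DASASMCount.

(** * Semistandard tableaux *)

Section GelfandTsetlin.

(* [interl a (b :: c :: ...)] lists the [x :: y :: ...] with
   [a >= x >= b >= y >= c >= ...]. *)
Fixpoint interl (a : nat) (lam : seq nat) : seq (seq nat) :=
  if lam is b :: lam' then
    [seq x :: mu | x <- iota b (a - b).+1, mu <- interl b lam']
  else [:: [::]].

Definition interlaced (lam : seq nat) : seq (seq nat) :=
  if lam is a :: lam' then interl a lam' else [::].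

Fixpoint gtpatterns (k : nat) (lam : seq nat) : seq (seq (seq nat)) :=
  if k is k'.+1 then [seq mu :: p | mu <- interlaced lam, p <- gtpatterns k' mu]
  else [:: [::]].

(** Lower indices decrease, so the last column consists of ones and is eliminated when consecutive
    rows are subtracted in [seqdet_binrows]. *)
Definition binrow (k l : nat) (j : nat) : rat := 'C(l, k.-1 - j)%:R.

Fixpoint binrows (k : nat) (lam : seq nat) : seq (nat -> rat) :=
  if lam is a :: lam' then binrow k (a + size lam') :: binrows k lam' else [::].

Fixpoint diffrows (k a : nat) (lam : seq nat) : seq (nat -> rat) :=
  if lam is b :: lam' then
    (fun j => 'C(a + (size lam').+1, k - j)%:R - 'C(b + size lam', k - j)%:R) ::
    diffrows k b lam'
  else [::].

Lemma size_binrows k lam : size (binrows k lam) = size lam.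
Proof. by elim: lam => //= a lam ->. Qed.

Lemma nth_binrows K lam i : (i < size lam)%N ->
  nth (fun=> 0) (binrows K lam) i = binrow K (nth 0%N lam i + (size lam - i.+1)).
Proof.
by elim: lam i => // a lam IH [|i] /= iL; [rewrite subSS subn0|rewrite subSS IH].
Qed.

Lemma nth_diffrows k a lam i j : (i < size lam)%N ->
  nth (fun=> 0) (diffrows k a lam) i j =
  'C(nth 0%N (a :: lam) i + (size lam - i), k - j)%:R -
  'C(nth 0%N lam i + (size lam - i.+1), k - j)%:R.
Proof.
elim: lam a i => // b lam IH a [|i] /= iL; first by rewrite subSS !subn0.
by rewrite IH // !subSS.
Qed.

Lemma seqdet_expand (R : comNzRingType) m (pre post : seq (nat -> R)) :
  (size pre < m)%N -> exists cof : 'I_m -> R,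
  forall r, seqdet m (pre ++ r :: post) = \sum_(j < m) r j * cof j.
Proof.
move=> pm; pose i0 := Ordinal pm.
pose M r : 'M[R]_m := \matrix_(i, k) nth (fun=> 0) (pre ++ r :: post) i k.
exists (fun j => cofactor (M (fun=> 0)) i0 j) => r.
rewrite /seqdet (expand_det_row _ i0); apply: eq_bigr => j _.
rewrite mxE /= nth_cat ltnn subnn /=; congr (_ * _); rewrite /cofactor; congr (_ * \det _).
apply/matrixP => i k; rewrite !mxE !nth_cat; case: ltnP => // ge.
case E : (lift i0 i - size pre)%N => //=.
have := neq_lift i0 i; rewrite -val_eqE /= /bump; move: ge E; rewrite /= /bump; lia.
Qed.

Lemma hockey_stick a b s p : (b <= a)%N ->
  \sum_(x <- iota b (a - b).+1) ('C(x + s, p)%:R : rat) =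
  'C(a + s.+1, p.+1)%:R - 'C(b + s, p.+1)%:R.
Proof.
move=> ba; rewrite -[in 'C(a + _, _)](subnKC ba); elim: (a - b)%N => [|d IH].
  by rewrite big_cons big_nil addr0 addn0 addnS binS natrD; ring.
rewrite -[d.+2]addn1 iotaD big_cat IH /= big_seq1 !addnS !addSn (binS (b + d + s).+1) natrD.
by ring.
Qed.

(** The parts of [mu] range over independent intervals, so by multilinearity the sum is taken row by
    row with [hockey_stick]; [pre] holds the rows kept fixed meanwhile. *)
Lemma sum_interl k a lam pre :
  sorted geq (a :: lam) -> (size pre + size lam = k)%N ->
  \sum_(mu <- interl a lam) seqdet k (pre ++ binrows k mu) =
  seqdet k (pre ++ diffrows k a lam).
Proof.
elim: lam a pre => [|b lam IH] a pre; first by rewrite /= big_cons big_nil addr0.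
move=> /andP[ba srt] szk; rewrite big_allpairs_dep.
have smu mu : mu \in interl b lam -> size mu = size lam.
  elim: lam b mu {IH szk srt ba} => [|b' lam IH] b mu; first by rewrite inE => /eqP->.
  by move=> /allpairsPdep[x [mu' [_ /IH e ->]]] /=; rewrite e.
transitivity (\sum_(x <- iota b (a - b).+1)
   seqdet k (pre ++ binrow k (x + size lam) :: diffrows k b lam)).
  apply: eq_bigr => x _; rewrite -cat_rcons -IH ?size_rcons ?addSnnS //.
  by apply: eq_big_seq => mu /smu e; rewrite -e cat_rcons.
have pk : (size pre < k)%N by rewrite -szk /= -addSnnS leq_addr.
have [cof E] := seqdet_expand (diffrows k b lam) pk.
rewrite (eq_bigr _ (fun x _ => E _)) E exchange_big; apply: eq_bigr => j _ /=.
rewrite -mulr_suml; congr (_ * _); rewrite /binrow hockey_stick //.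
by have jk := ltn_ord j; rewrite (_ : k - j = (k.-1 - j).+1)%N //; lia.
Qed.

(* Subtracting consecutive rows of the determinant for [a :: lam] gives differences
   of binomial coefficients, which are the sums of binomial coefficients over the
   intervals between the parts. *)
Lemma seqdet_binrows k a lam : size lam = k ->
  seqdet k.+1 (binrows k.+1 (a :: lam)) = seqdet k (diffrows k a lam).
Proof.
move=> sz; pose m := (k + 1)%N; have mE : m = k.+1 by rewrite /m addn1.
rewrite -[X in seqdet X _ = _]mE.
pose M : 'M[rat]_(k + 1) := \matrix_(i, j) nth (fun=> 0) (binrows k.+1 (a :: lam)) i j.
pose U : 'M[rat]_(k + 1) := \matrix_(i, j) ((i == j)%:R - (i.+1 == j)%N%:R).
pose g i j : rat := nth (fun=> 0) (binrows k.+1 (a :: lam)) i j.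
have detU : \det U = 1.
  rewrite -det_tr det_trig.
    by apply: big1 => i _; rewrite !mxE eqxx (_ : (i.+1 == i)%N = false) ?subr0 //; lia.
  apply/is_trig_mxP => i j ij; rewrite !mxE -val_eqE /=.
  rewrite (_ : (j == i :> nat) = false); last by lia.
  by rewrite (_ : (j.+1 == i)%N = false) ?subr0 //; lia.
have UM i j : \sum_l U i l * M l j = g i j - (if (i < k)%N then g i.+1 j else 0).
  rewrite (eq_bigr (fun l : 'I_(k + 1) => (i == l)%:R * g l j - (i.+1 == l)%N%:R * g l j)); last first.
    by move=> l _; rewrite !mxE /g; ring.
  rewrite sumrB; congr (_ - _).
    rewrite (bigD1 i) //= eqxx mul1r big1 ?addr0 // => l li.
    by rewrite eq_sym (negPf li) mul0r.
  case: ltnP => ik.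
    have ik' : (i.+1 < k + 1)%N by lia.
    rewrite (bigD1 (Ordinal ik')) //= eqxx mul1r big1 ?addr0 // => l.
    by rewrite -val_eqE /= eq_sym => /negPf ->; rewrite mul0r.
  rewrite big1 // => l _; rewrite (_ : (i.+1 == l)%N = false) ?mul0r //.
  by have := ltn_ord l; lia.
have gE i j : (i <= k)%N -> g i j = 'C(nth 0%N (a :: lam) i + (k - i), k - j)%:R.
  by move=> ik; rewrite /g nth_binrows /= sz ?ltnS.
have UMblock : U *m M =
    block_mx (\matrix_(i < k, j < k) nth (fun=> 0) (diffrows k a lam) i j) 0
             (dlsubmx (U *m M)) 1%:M.
  rewrite -[LHS]submxK; congr block_mx; apply/matrixP => i j; rewrite !mxE UM /=.
  - by rewrite ltn_ord (gE i.+1) ?ltn_ord // (gE i) ?(ltnW (ltn_ord i)) // nth_diffrows ?sz.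
  - by rewrite ltn_ord (gE i.+1) ?ltn_ord // (gE i) ?(ltnW (ltn_ord i)) // ord1 addn0 subnn !bin0 subrr.
  by rewrite !ord1 addn0 ltnn subr0 gE // !subnn bin0 eqxx.
transitivity (\det (U *m M)); first by rewrite det_mulmx detU mul1r.
by rewrite UMblock det_lblock det1 mulr1.
Qed.

Lemma size_interlaced k lam mu : size lam = k.+1 -> mu \in interlaced lam -> size mu = k.
Proof.
case: lam => // a lam [<-] {k}; elim: lam a mu => [|b lam IH] a mu; first by rewrite inE => /eqP->.
by move=> /allpairsPdep[x [mu' [_ /IH e ->]]] /=; rewrite e.
Qed.

Lemma sorted_interlaced a lam mu : sorted geq (a :: lam) -> mu \in interl a lam ->
  sorted geq mu /\ (head 0 mu <= a)%N.
Proof.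
elim: lam a mu => [|b lam IH] a mu; first by rewrite inE => _ /eqP->.
move=> /andP[ba srt] /allpairsPdep[x [mu' [+ /IH e ->]]].
have [s' h'] := e srt; rewrite mem_iota => /andP[bx xa]; split; last by rewrite /=; lia.
case: mu' s' h' {e} => //= y mu' -> yb; rewrite andbT; lia.
Qed.

Lemma size_gtpatterns k lam : sorted geq lam -> size lam = k ->
  (size (gtpatterns k lam))%:R = seqdet k (binrows k lam).
Proof.
elim: k lam => [|k IH] lam srt sz.
  by rewrite /seqdet det_mx00.
case: lam srt sz => // a lam srt [sz].
rewrite seqdet_binrows // -[diffrows _ _ _]cat0s -sum_interl //=.
rewrite size_allpairs_dep sumnE big_map natr_sum big_seq [RHS]big_seq; apply: eq_bigr => mu Hmu.
by have [smu _] := sorted_interlaced srt Hmu; rewrite IH // (@size_interlaced k (a :: lam)) //= sz.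
Qed.

Lemma binrow_poly p : exists q : {poly rat}, forall l : nat, q.[l%:R] = 'C(l, p)%:R /\ (size q <= p.+1)%N.
Proof.
elim: p => [|p [q qE]].
  by exists 1 => l; rewrite hornerC bin0 size_poly1.
exists ((p.+1%:R)^-1 *: (q * ('X - p%:R%:P))) => l; have [ql sq] := qE l; split.
  rewrite hornerZ hornerM ql hornerXsubC mulrC.
  apply: (canLR (mulfK _)); rewrite ?pnatr_eq0 // -natrM mulnC mul_bin_left natrM.
  case: (leqP p l) => pl; first by rewrite natrB // mulrC.
  by rewrite bin_small // mulr0 mul0r.
apply: leq_trans (size_scale_leq _ _) _; apply: leq_trans (size_polyMleq _ _) _.
by rewrite size_XsubC addn2.
Qed.

(** Each column is a polynomial in [l] of degree below [k]. The constant is left unevaluated: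
    [size_gtpatternsE] eliminates it by comparison with the zero partition, which has a single
    pattern. *)
Lemma seqdet_binrow_vandermonde k : exists kappa : rat, forall s : seq nat, size s = k ->
  seqdet k [seq binrow k l | l <- s] =
  kappa * \prod_(i < k) \prod_(j < k | (i < j)%N) ((nth 0%N s i)%:R - (nth 0%N s j)%:R).
Proof.
have /fin_all_exists [q qE] (j : 'I_k) := binrow_poly (k.-1 - j).
pose C : 'M[rat]_k := \matrix_(d, j) (q j)`_d.
exists (\det C * \prod_(i < k) \prod_(j < k | (i < j)%N) -1) => s sz.
pose V : 'rV[rat]_k := \row_i (nth 0%N s i)%:R.
have -> : seqdet k [seq binrow k l | l <- s] = \det ((Vandermonde k V)^T *m C).
  congr (\det _); apply/matrixP => i j; rewrite !mxE (nth_map 0%N) ?sz // /binrow.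
  have [<- sq] := qE j (nth 0%N s i).
  have kj : (k.-1 - j).+1 = (k - j)%N by have := ltn_ord j; lia.
  have sq' : (size (q j) <= k)%N by rewrite (leq_trans sq) ?kj ?leq_subr.
  rewrite (horner_coef_wide _ sq').
  by apply: eq_bigr => d _; rewrite !mxE mulrC.
rewrite det_mulmx det_tr det_Vandermonde mulrC -mulrA; congr (_ * _).
rewrite -big_split; apply: eq_bigr => i _; rewrite -big_split; apply: eq_bigr => j _ /=.
by rewrite !mxE; ring.
Qed.

Lemma binrows_map k lam : size lam = k ->
  binrows k lam = [seq binrow k l | l <- [seq (nth 0 lam i + (k - i.+1))%N | i <- iota 0 k]].
Proof.
move=> sz; apply: (@eq_from_nth _ (fun=> 0)); rewrite size_binrows ?size_map ?size_iota // => i ik.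
rewrite nth_binrows // (nth_map 0%N) ?size_map ?size_iota -?sz //.
by rewrite (nth_map 0%N) ?size_iota // nth_iota.
Qed.

Lemma size_gtpatterns_nseq0 k : size (gtpatterns k (nseq k 0)) = 1%N.
Proof.
elim: k => // k IH; have -> : gtpatterns k.+1 (nseq k.+1 0) =
  [seq mu :: p | mu <- [:: nseq k 0], p <- gtpatterns k mu]; last first.
  by rewrite size_allpairs_dep /= addn0 IH.
congr flatten; congr map; rewrite /interlaced /=.
by elim: k {IH} => //= k ->.
Qed.

Lemma size_gtpatternsE k lam : sorted geq lam -> size lam = k ->
  (size (gtpatterns k lam))%:R * \prod_(i < k) \prod_(j < k | (i < j)%N) (j - i)%:R =
  \prod_(i < k) \prod_(j < k | (i < j)%N)
     ((nth 0 lam i + (k - i.+1))%:R - (nth 0 lam j + (k - j.+1))%:R) :> rat.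
Proof.
have [kappa kE] := seqdet_binrow_vandermonde k.
have H mu : sorted geq mu -> size mu = k ->
  (size (gtpatterns k mu))%:R = kappa * \prod_(i < k) \prod_(j < k | (i < j)%N)
     ((nth 0 mu i + (k - i.+1))%:R - (nth 0 mu j + (k - j.+1))%:R).
  move=> srt sz; rewrite size_gtpatterns // binrows_map // kE ?size_map ?size_iota //.
  congr (_ * _); apply: eq_bigr => i _; apply: eq_bigr => j _.
  by rewrite !(nth_map 0%N) ?size_iota // !nth_iota.
move=> srt sz; rewrite H // mulrAC.
have := H (nseq k 0) _ (size_nseq _ _); rewrite size_gtpatterns_nseq0 => H0.
suff <- : 1 = kappa * \prod_(i < k) \prod_(j < k | (i < j)%N) (j - i)%:R by rewrite mul1r.
rewrite -[LHS]/(1%:R) H0; last by elim: (k) => // -[|k'].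
congr (_ * _); apply: eq_bigr => i _; apply: eq_bigr => j ij.
rewrite !nth_nseq !if_same !add0n -natrB; first by congr _%:R; have := ltn_ord j; lia.
lia.
Qed.
End GelfandTsetlin.

Local Close Scope ring_scope.

(** * Patterns as triangular arrays *)

Section Patterns.

Definition gtrow (G : nat -> nat -> nat) m := [seq G m i | i <- iota 0 m].
(** Rows [k - 1] down to 0, the last one empty; the top row [k] is the partition itself and is not
    listed. *)
Definition gtrows G k := [seq gtrow G m | m <- rev (iota 0 k)].

Definition interlacing (G : nat -> nat -> nat) k :=
  forall m i, m < k -> i < m -> G m.+1 i.+1 <= G m i <= G m.+1 i.

Lemma mem_interl a lam mu : sorted geq (a :: lam) ->
  (mu \in interl a lam) <-> size mu = size lam /\
    forall i, i < size mu -> nth 0 lam i <= nth 0 mu i <= nth 0 (a :: lam) i.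
Proof.
elim: lam a mu => [|b lam IH] a mu.
  by move=> _; rewrite inE; split=> [/eqP->//|[/size0nil ->]].
move=> /andP[ba srt]; split.
  move=> /allpairsPdep[x [mu' [+ /(IH _ _ srt)[sz H] ->]]]; rewrite mem_iota => xb.
  split=> [|[|i]] /=; rewrite ?sz //; first by lia.
  by rewrite ltnS => ilt; apply: H; rewrite sz.
case: mu => [[]//|x mu] [[sz] H].
apply/allpairsPdep; exists x, mu; split=> //.
  by have := H 0 isT; rewrite mem_iota /=; lia.
by apply/(IH _ _ srt); split=> // i ilt; apply: (H i.+1).
Qed.

Lemma mem_gtpatterns k lam p : sorted geq lam -> size lam = k ->
  (p \in gtpatterns k lam) <->
  exists G, [/\ lam = gtrow G k, p = gtrows G k & interlacing G k].
Proof.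
elim: k lam p => [|k IH] lam p srt sz.
  rewrite inE; split=> [/eqP->|[G [_ -> _]]] //.
  by exists (fun _ _ => 0); split=> //; apply: size0nil.
case: lam srt sz => // a lam srt [sz].
have rowsS G : gtrows G k.+1 = gtrow G k :: gtrows G k.
  by rewrite /gtrows -addn1 iotaD rev_cat /= add0n.
split.
  move=> /allpairsPdep[mu [p' [/[dup] mmu /(mem_interl _ srt)[smu H] + ->]]].
  have [srt' _] := sorted_interlaced srt mmu.
  move=> /(IH _ _ srt' (etrans smu sz))[G [muE pE GI]].
  exists (fun m i => if m == k.+1 then nth 0 (a :: lam) i else G m i); split.
  - rewrite /gtrow eqxx; apply: (@eq_from_nth _ 0) => [|i ilt].
      by rewrite size_map size_iota /= sz.
    by rewrite (nth_map 0) ?size_iota -sz // nth_iota.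
  - rewrite rowsS pE {1}muE; congr (_ :: _).
      by apply/eq_in_map => i; rewrite ltn_eqF.
    apply/eq_in_map => m; rewrite mem_rev mem_iota => /andP[_ mk].
    by apply/eq_in_map => i _; rewrite ltn_eqF // ltnW.
  move=> m i mk im; rewrite ltnS in mk; rewrite (ltn_eqF (_ : m < k.+1)) ?ltnS // eqSS.
  case: (eqVneq m k) => [mk'|mk']; last by apply: GI => //; rewrite ltn_neqAle mk'.
  subst m; have := H i; rewrite smu sz => /(_ im) /=.
  by rewrite muE /gtrow (nth_map 0) ?size_iota // nth_iota.
move=> [G [lamE -> GI]]; rewrite rowsS.
have muE : gtrow G k \in interl a lam.
  apply/(mem_interl _ srt); rewrite size_map size_iota sz; split=> // i ik.
  have nE j : j <= k -> nth 0 (a :: lam) j = G k.+1 j.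
    by move=> jk; rewrite lamE (nth_map 0) ?size_iota // nth_iota.
  rewrite (nth_map 0) ?size_iota // nth_iota // -[nth 0 lam i]/(nth 0 (a :: lam) i.+1).
  by rewrite !nE ?(ltnW ik) //; apply: GI.
have [srt' _] := sorted_interlaced srt muE.
apply/allpairsPdep; exists (gtrow G k), (gtrows G k); split=> //.
apply/(IH _ _ srt'); rewrite ?size_map ?size_iota //.
by exists G; split=> // m i mk im; apply: GI => //; apply: ltnW.
Qed.

Lemma uniq_interl a lam : uniq (interl a lam).
Proof.
elim: lam a => // b lam IH a; apply: allpairs_uniq => //; first exact: iota_uniq.
by move=> [x mu] [x' mu'] _ _ [-> ->].
Qed.

Lemma uniq_gtpatterns k lam : uniq (gtpatterns k lam).
Proof.
elim: k lam => // k IH lam; apply: allpairs_uniq_dep => //.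
  by case: lam => // a lam; apply: uniq_interl.
by move=> [x p] [x' p'] _ _ /= [-> ->].
Qed.

End Patterns.

Lemma count_down (P : pred nat) N :
  (forall i j, i <= j -> j < N -> P j -> P i) ->
  forall j, j < N -> (j < count P (iota 0 N)) = P j.
Proof.
elim: N => // N IH H j; rewrite ltnS -[N.+1]addn1 iotaD count_cat /= add0n addn0 => jN.
have H' i k : i <= k -> k < N -> P k -> P i by move=> ik kN; apply: H => //; apply: ltnW.
case PN: (P N).
  have all1 : all P (iota 0 N).
    by apply/allP => i; rewrite mem_iota => /andP[_ iN]; apply: (H _ N) => //; apply: ltnW.
  have /eqP-> : count P (iota 0 N) == N by rewrite -{2}(size_iota 0 N) -all_count.
  by rewrite addn1 ltnS jN (H _ _ jN).
rewrite addn0; move: jN; rewrite leq_eqVlt => /orP[/eqP->|jN]; last exact: IH.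
rewrite PN; apply/negbTE; rewrite -leqNgt.
by have := count_size P (iota 0 N); rewrite size_iota.
Qed.

(** * From tableaux to patterns *)

Section Tableaux.
Variables (lam : seq nat) (k : nat).
Hypotheses (srt : sorted geq lam) (szk : size lam <= k).

Let row i := nth 0 lam i.

Lemma row_anti i i' : i <= i' -> row i' <= row i.
Proof.
move=> ii; case: (ltnP i' (size lam)) => [lt|ge]; last by rewrite /row (nth_default _ ge).
apply: (sorted_leq_nth _ _ 0 srt) => //; rewrite ?inE //.
- by move=> y x z xy yz; apply: leq_trans yz xy.
- by move=> x; apply: leqnn.
exact: leq_ltn_trans lt.
Qed.

Lemma row_size i j : j < row i -> i < size lam.
Proof. by move=> H; rewrite ltnNge; apply/negP => ge; rewrite /row nth_default in H. Qed.

Definition mkcell i j (H : j < row i) : cell lam :=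
  Tagged (fun i : 'I_(size lam) => 'I_(nth 0 lam i))
    (Ordinal H : 'I_(nth 0 lam (Ordinal (row_size H)))).

Lemma cell_inj (c d : cell lam) :
  cell_row c = cell_row d -> cell_col c = cell_col d -> c = d.
Proof.
case: c d => [i j] [i' j']; rewrite /cell_row /cell_col /= => /val_inj e.
by case: i' / e j' => j' /val_inj ->.
Qed.

Lemma cell_bound (c : cell lam) : cell_col c < row (cell_row c).
Proof. by case: c => i j; rewrite /cell_col /cell_row /=. Qed.

Variable T : {ffun cell lam -> 'I_k.+1}.

Definition tval i j : nat :=
  if [pick c | (cell_row c == i) && (cell_col c == j)] is Some c then T c else 0.

Lemma tvalE c : tval (cell_row c) (cell_col c) = T c.
Proof.
rewrite /tval; case: pickP => [d /andP[/eqP e1 /eqP e2]|/(_ c)].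
  by congr (nat_of_ord (T _)); apply: cell_inj.
by rewrite !eqxx.
Qed.

Lemma tval_mkcell i j (H : j < row i) : tval i j = T (mkcell H).
Proof. by rewrite -tvalE. Qed.

Lemma tval_leq i j : tval i j <= k.
Proof. by rewrite /tval; case: pickP => // c _; rewrite -ltnS. Qed.

Lemma SSYT_P : reflect
  [/\ forall i j, j < row i -> 0 < tval i j,
      forall i j j', j <= j' -> j' < row i -> tval i j <= tval i j' &
      forall i i' j, i < i' -> j < row i' -> tval i j < tval i' j]
  (T \in SSYT lam k).
Proof.
rewrite inE; apply: (iffP and3P) => [[/forallP H1 /forallP H2 /forallP H3]|[H1 H2 H3]].
  split=> [i j ji|i j j' jj ji|i i' j ii ji].
  - by rewrite tval_mkcell.
  - move: jj; rewrite leq_eqVlt => /orP[/eqP->//|jj].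
    have ji' := ltn_trans jj ji; rewrite !tval_mkcell.
    by have /forallP/(_ (mkcell ji))/implyP := H2 (mkcell ji'); apply; rewrite eqxx.
  have ji' := leq_trans ji (row_anti (ltnW ii)); rewrite !tval_mkcell.
  by have /forallP/(_ (mkcell ji))/implyP := H3 (mkcell ji'); apply; rewrite eqxx.
split.
- by apply/forallP => c; rewrite -tvalE H1 // cell_bound.
- apply/forallP => c; apply/forallP => d; apply/implyP => /andP[/eqP e lt].
  by rewrite -!tvalE e; apply: H2; [exact: ltnW|exact: cell_bound].
apply/forallP => c; apply/forallP => d; apply/implyP => /andP[/eqP e lt].
by rewrite -!tvalE e; apply: H3 => //; exact: cell_bound.
Qed.

(** For fixed [m] these are the row lengths of the subtableau of entries at most [m]; the chain of
    these shapes is the pattern of [T]. *)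
Definition tcount m i := count (fun j => tval i j <= m) (iota 0 (row i)).

Hypothesis TS : T \in SSYT lam k.

Lemma tcountP m i j : j < row i -> (j < tcount m i) = (tval i j <= m).
Proof.
have [_ H _] := SSYT_P TS; apply: count_down => a b ab bN.
by apply: leq_trans; apply: H.
Qed.

(** Columns increase strictly from a positive entry. Hence the entries at most [m] fill at most [m]
    rows ([tcount0]), as row [m] of a pattern demands. *)
Lemma tval_gt i j : j < row i -> i < tval i j.
Proof.
have [H1 _ H3] := SSYT_P TS; elim: i => [|i IH] ji; first exact: H1.
by apply: leq_ltn_trans (H3 _ _ _ (ltnSn i) ji); apply/IH/(leq_trans ji)/row_anti.
Qed.

Lemma tcount_leq m i : tcount m i <= row i.
Proof. by rewrite /tcount -{2}(size_iota 0 (row i)) count_size. Qed.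

Lemma tcount0 m i : m <= i -> tcount m i = 0.
Proof.
move=> mi; apply/eqP; rewrite -leqn0 leqNgt; apply/negP => lt.
have r0 : 0 < row i by apply: leq_trans lt (tcount_leq _ _).
by move: lt; rewrite tcountP // leqNgt (leq_ltn_trans mi) // tval_gt.
Qed.

Lemma tcount_top m i : k <= m -> tcount m i = row i.
Proof.
move=> km; rewrite -[RHS](size_iota 0); apply/eqP; rewrite -all_count.
by apply/allP => j _; apply: leq_trans km; apply: tval_leq.
Qed.

(** The lower bound is strictness of columns: directly above an entry at most [m + 1] stands one at
    most [m]. *)
Lemma tcount_interlacing : interlacing tcount k.
Proof.
have [_ _ H3] := SSYT_P TS; move=> m i mk im; apply/andP; split; last first.
  by apply: sub_count => j /= le; apply: leqW.
rewrite leqNgt; apply/negP => lt.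
have b : tcount m i < row i.+1 by apply: leq_trans lt (tcount_leq _ _).
have := lt; rewrite tcountP // => le.
have := leq_trans (H3 _ _ _ (ltnSn i) b) le; rewrite ltnS -tcountP ?ltnn //.
exact: leq_trans b (row_anti (leqnSn i)).
Qed.

End Tableaux.

Section Count.
Variables (lam : seq nat) (k : nat).
Hypotheses (srt : sorted geq lam) (szk : size lam <= k).

Let row i := nth 0 lam i.
(** Zero parts are added because [gtpatterns k] needs exactly [k] parts. *)
Definition padded := lam ++ nseq (k - size lam) 0.

Lemma nth_padded i : nth 0 padded i = row i.
Proof.
rewrite /padded nth_cat; case: ltnP => // ge.
by rewrite nth_nseq if_same /row nth_default.
Qed.

Lemma size_padded : size padded = k.
Proof. by rewrite size_cat size_nseq subnKC. Qed.

Lemma sorted_padded : sorted geq padded.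
Proof.
apply/(sortedP 0) => i _; rewrite /= !nth_padded; exact: (row_anti srt).
Qed.

Definition pattern_of (T : {ffun cell lam -> 'I_k.+1}) := gtrows (tcount T) k.

Lemma gtrows_inj G G' : gtrows G k = gtrows G' k ->
  forall m i, m < k -> i < m -> G m i = G' m i.
Proof.
move=> /eq_in_map H m i mk im; have := H m; rewrite mem_rev mem_iota => /(_ mk).
by move=> /eq_in_map /(_ i); rewrite mem_iota => /(_ im).
Qed.

Lemma pattern_of_inj : {in SSYT lam k &, injective pattern_of}.
Proof.
move=> T T' TS TS' /gtrows_inj e.
have e' m i : tcount T m i = tcount T' m i.
  case: (ltnP m k) => [mk|km]; last by rewrite !tcount_top.
  by case: (ltnP i m) => [im|mi]; [apply: e|rewrite !tcount0].
apply/ffunP => c; apply: val_inj; rewrite /= -!tvalE.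
have cb := cell_bound c; apply/eqP; rewrite eqn_leq; apply/andP; split.
  by rewrite -(tcountP srt TS _ cb) e' (tcountP srt TS' _ cb).
by rewrite -(tcountP srt TS' _ cb) -e' (tcountP srt TS _ cb).
Qed.

Lemma pattern_of_mem T : T \in SSYT lam k -> pattern_of T \in gtpatterns k padded.
Proof.
move=> TS; apply/(mem_gtpatterns _ sorted_padded size_padded).
exists (tcount T); split=> //; last exact: tcount_interlacing.
apply: (@eq_from_nth _ 0); rewrite ?size_map ?size_iota size_padded // => i ik.
by rewrite nth_padded (nth_map 0) ?size_iota // nth_iota // tcount_top.
Qed.

Lemma pattern_of_surj p : p \in gtpatterns k padded ->
  exists2 T, T \in SSYT lam k & p = pattern_of T.
Proof.
move=> /(mem_gtpatterns _ sorted_padded size_padded)[G0 [lamE -> GI0]].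
(* With the value 0 outside the triangle, the interlacing inequalities hold for every [i]. *)
pose G m i := if i < m then G0 m i else 0.
have GI m i : m < k -> G m.+1 i.+1 <= G m i <= G m.+1 i.
  rewrite /G ltnS => mk; case: (ltnP i m) => im; last by rewrite leq0n.
  by rewrite (leqW im); apply: GI0.
have Gtop i : G k i = row i.
  rewrite -nth_padded lamE /G; case: (ltnP i k) => ik.
    by rewrite (nth_map 0) ?size_iota // nth_iota.
  by rewrite nth_default // size_map size_iota.
have Gmono m m' i : m <= m' -> m' <= k -> G m i <= G m' i.
  elim: m' => [|m' IH]; first by rewrite leqn0 => /eqP->.
  rewrite leq_eqVlt => /orP[/eqP->//|mm] mk; apply: leq_trans (IH mm (ltnW mk)) _.
  by case/andP: (GI m' i mk).
have Ganti m i i' : i <= i' -> m <= k -> G m i' <= G m i.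
  move=> ii mk; elim: i' ii => [|i' IH]; first by rewrite leqn0 => /eqP->.
  rewrite leq_eqVlt => /orP[/eqP->//|ii]; apply: leq_trans (IH ii).
  case: m mk {IH} => [|m] mk; first by rewrite /G.
  have /andP[h1 _] := GI m i' mk; apply: leq_trans h1 _; exact: Gmono.
(* The entry of cell [(i, j)] is the least [m] with [j < G m i]; as [G] grows with [m], this is the
   number of [m < k] for which the inequality fails. *)
pose S i j := count (fun m => G m i <= j) (iota 0 k).
have SP i j m : m < k -> (m < S i j) = (G m i <= j).
  by apply: count_down => a b ab bk; apply: leq_trans; apply: Gmono => //; apply: ltnW.
have Sk i j : S i j <= k by rewrite /S -{2}(size_iota 0 k) count_size.
pose T : {ffun cell lam -> 'I_k.+1} := [ffun c => inord (S (cell_row c) (cell_col c))].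
have TE i j : j < row i -> tval T i j = S i j.
  by move=> ji; rewrite (tval_mkcell T ji) ffunE inordK ?ltnS.
have TS : T \in SSYT lam k.
  apply/(SSYT_P srt); split=> [i j ji|i j j' jj ji|i i' j ii ji].
  - rewrite TE // SP; first by rewrite /G.
    by have := row_size ji; lia.
  - by rewrite !TE // ?(leq_ltn_trans jj) //; apply: sub_count => m /= le; apply: leq_trans jj.
  have ji' := leq_trans ji (row_anti srt (ltnW ii)); rewrite !TE //.
  have GS : j < G (S i' j) i'.
    case: (ltnP (S i' j) k) => Sk'; last first.
      by rewrite (_ : S i' j = k) ?Gtop //; apply/eqP; rewrite eqn_leq Sk.
    by rewrite ltnNge -SP // ltnn.
  case E : (S i' j) GS => [|m] GS; first by rewrite /G in GS.
  have mk : m < k by rewrite -E Sk.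
  rewrite ltnS leqNgt SP // -ltnNge; apply: leq_trans GS _.
  by have /andP[h _] := GI m i mk; apply: leq_trans h; apply: Ganti.
exists T => //; rewrite /pattern_of /gtrows; apply/eq_in_map => m.
rewrite mem_rev mem_iota => /andP[_ mk]; apply/eq_in_map => i.
rewrite mem_iota => /andP[_ im]; rewrite /= add0n in mk im.
have -> : G0 m i = G m i by rewrite /G im.
rewrite /tcount (@eq_in_count _ _ (fun j => j < G m i)).
  have le : G m i <= row i by rewrite -Gtop; apply: Gmono => //; apply: ltnW.
  rewrite -[nth 0 lam i](subnKC le) iotaD count_cat add0n.
  have -> : count (fun j => j < G m i) (iota 0 (G m i)) = G m i.
    rewrite -[RHS](size_iota 0); apply/eqP; rewrite -all_count.
    by apply/allP => j; rewrite mem_iota.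
  rewrite (@eq_in_count _ _ pred0) ?count_pred0 ?addn0 // => j.
  by rewrite mem_iota => /andP[ge _]; rewrite ltnNge ge.
by move=> j; rewrite mem_iota => /andP[_ ji]; rewrite /= TE // leqNgt SP // -ltnNge.
Qed.

Lemma card_SSYT : #|SSYT lam k| = size (gtpatterns k padded).
Proof.
rewrite cardE -(size_map pattern_of); apply/perm_size/uniq_perm.
- rewrite map_inj_in_uniq ?enum_uniq // => T T'; rewrite !mem_enum.
  exact: pattern_of_inj.
- exact: uniq_gtpatterns.
move=> p; apply/mapP/idP => [[T]|/pattern_of_surj[T TS ->]].
  by rewrite mem_enum => /pattern_of_mem H ->.
by exists T; rewrite ?mem_enum.
Qed.
End Count.

(** * The double staircase and the product formula *)

Lemma nth_double_staircase n i : nth 0 (double_staircase n) i = n - uphalf i.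
Proof.
case: n => [|n]; first by rewrite nth_nil.
have H m j : nth 0 (flatten [seq [:: k; k] | k <- rev (iota 1 m)]) j = m - j./2.
  elim: m j => [|m IH] j; first by rewrite nth_nil.
  have -> : rev (iota 1 m.+1) = m.+1 :: rev (iota 1 m).
    by rewrite -[in LHS](addn1 m) iotaD rev_cat.
  by case: j => [|[|j]] //; rewrite -[LHS]/(nth 0 (flatten [seq [:: k; k] | k <- rev (iota 1 m)]) j) IH.
case: i => [|i]; first by rewrite subn0.
by rewrite [LHS]/= H.
Qed.

Lemma size_double_staircase n : size (double_staircase n) <= 2 * n + 1.
Proof.
case: n => // n; rewrite [size _]/= size_flatten /shape -map_comp.
rewrite (@eq_map _ _ _ (fun=> 2)) // sumnE big_map big_const_seq iter_addn.
by rewrite count_predT size_rev size_iota; lia.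
Qed.

Lemma sorted_double_staircase n : sorted geq (double_staircase n).
Proof.
apply/(sortedP 0) => i _; rewrite /= !nth_double_staircase.
by apply: leq_sub2l; rewrite uphalf_half; lia.
Qed.

Definition diffprod (e : nat -> nat) m := \prod_(0 <= j < m) \prod_(0 <= i < j) (e j - e i).

Lemma diffprodE (R : comNzRingType) (e : nat -> nat) m :
  (\prod_(i < m) \prod_(j < m | (i < j)%N) (e j - e i)%N%:R = (diffprod e m)%:R :> R)%R.
Proof.
rewrite /diffprod natr_prod (exchange_big_dep xpredT) //= big_mkord; apply: eq_bigr => j _.
rewrite natr_prod big_mkord (big_ord_widen m (fun i => (e j - e i)%N%:R)%R) //.
exact: ltnW.
Qed.

Lemma diffprodS e m : diffprod e m.+1 = diffprod e m * \prod_(0 <= i < m) (e m - e i).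
Proof. by rewrite /diffprod big_nat_recr. Qed.

Lemma diffprod_id m : \prod_(0 <= i < m) (m - i) = m`!.
Proof.
by rewrite fact_prod big_nat_rev /= [RHS]big_add1 /=; apply: eq_big_nat => i; lia.
Qed.

(** Because [stairexp k.+2 = stairexp k + 3], passing from [n] to [n + 1] multiplies by
    [(3n+3)(3n+4)(3n+5)(3n+6)]: the last three factors extend the factorial, the first is
    [3 (n+1)]. *)
Lemma stairexp_prods n :
  (\prod_(0 <= i < n.*2.+1) (stairexp n.*2.+1 - stairexp i)) *
  (\prod_(0 <= i < n.*2.+2) (stairexp n.*2.+2 - stairexp i)) =
  (3 * n.+1)`! * 3 ^ n * n`!.
Proof.
have shift N k : \prod_(0 <= i < k.+2) (N + 3 - stairexp i) =
    (N + 3) * (N + 2) * \prod_(0 <= i < k) (N - stairexp i).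
  rewrite big_nat_recl // big_nat_recl // mulnA.
  congr (_ * _ * _); rewrite ?[stairexp _]/= ?subn0 //; first by rewrite /stairexp /=; lia.
  by apply: eq_big_nat => i _; rewrite stairexpSS subnDr.
elim: n => [|n IH]; first by rewrite !big_nat_recr //= !big_geq.
rewrite !doubleS (stairexpSS n.*2.+1) (stairexpSS n.*2.+2) !shift.
rewrite mulnACA IH (_ : 3 * n.+2 = (3 * n.+1).+3); last by lia.
rewrite !factS (_ : stairexp n.*2.+1 = 3 * n + 1); last by rewrite /stairexp; lia.
rewrite (_ : stairexp n.*2.+2 = 3 * n + 3); last by rewrite /stairexp; lia.
rewrite expnS; nia.
Qed.

Lemma diffprod_stairexp n :
  diffprod stairexp n.*2.+1 * \prod_(0 <= i < n.+1) (n + i)`! =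
  3 ^ 'C(n, 2) * (\prod_(0 <= i < n.+1) (3 * i)`!) * diffprod id n.*2.+1.
Proof.
elim: n => [|n IH]; first by rewrite /diffprod !big_nat1 !big_geq.
rewrite doubleS !(diffprodS _ n.*2.+2) !(diffprodS _ n.*2.+1) !diffprod_id.
(* The extra [n!] serves twice: it extends the product of the [(n + 1 + i)!] downwards to one of the
   [(n + i)!], and it matches the [n!] of [stairexp_prods]. *)
apply/eqP; rewrite -(eqn_pmul2r (fact_gt0 n)) -[X in X == _]mulnA; apply/eqP.
have -> : (\prod_(0 <= i < n.+2) (n.+1 + i)`!) * n`! =
   (\prod_(0 <= i < n.+1) (n + i)`!) * (n.*2.+1)`! * (n.*2.+2)`!.
  have : \prod_(0 <= i < n.+3) (n + i)`! = \prod_(0 <= i < n.+3) (n + i)`! by [].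
  rewrite [in LHS]big_nat_recl // [in RHS]big_nat_recr // [in RHS]big_nat_recr //= addn0.
  rewrite !addnS addnn mulnC => <-; congr (_ * _).
  by apply: eq_big_nat => i _; rewrite addSnnS.
rewrite (big_nat_recr n.+1) //= binS bin1 expnD.
have := stairexp_prods n; move: IH.
set a := diffprod _ _; set b := \prod_(0 <= i < n.+1) _; set x := \prod_(_ <= _ < _) _.
set y := \prod_(_ <= _ < _) _; set z := \prod_(_ <= _ < _) _; set t := diffprod _ _.
move=> IH AB; transitivity (a * b * (y * z) * (n.*2.+1)`! * (n.*2.+2)`!); first by ring.
by rewrite IH AB; ring.
Qed.

Lemma card_SSYT_double_staircase n :
  #|SSYT (double_staircase n) (2 * n + 1)| * diffprod id n.*2.+1 = diffprod stairexp n.*2.+1.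
Proof.
set lam := double_staircase n; set k := 2 * n + 1.
have kE : k = n.*2.+1 by rewrite /k -muln2; lia.
have srt := sorted_double_staircase n; have sz := size_double_staircase n.
rewrite (card_SSYT srt sz) -/lam -kE.
have := size_gtpatternsE (sorted_padded k srt) (size_padded sz).
rewrite (diffprodE _ id) -natrM => H; apply/eqP; rewrite -(eqr_nat rat) H; apply/eqP.
rewrite -(diffprodE _ stairexp).
have lE (i : 'I_k) : (nth 0 (padded lam k) i + (k - i.+1))%N = stairexp (rev_ord i).
  rewrite nth_padded // nth_double_staircase /stairexp /=.
  by have := ltn_ord i; rewrite {2}kE; move: (nat_of_ord i) => j; lia.
rewrite (eq_bigr (fun i : 'I_k => \prod_(j < k | (i < j)%N)
    (stairexp (rev_ord i) - stairexp (rev_ord j))%N%:R)%R); last first.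
  move=> i _; apply: eq_bigr => j ij; rewrite !lE natrB //.
  by apply/stairexp_homo/leq_sub2l; rewrite ltnS ltnW.
rewrite (reindex_inj rev_ord_inj).
rewrite (eq_bigr (fun i : 'I_k => \prod_(j < k | (j < i)%N)
    (stairexp i - stairexp j)%N%:R)%R); last first.
  move=> i _; rewrite (reindex_inj rev_ord_inj).
  apply: eq_big => [j|j _]; last by rewrite !rev_ordK.
  by rewrite /=; have := ltn_ord i; have := ltn_ord j; move: (nat_of_ord i) (nat_of_ord j) => a b; lia.
by rewrite (exchange_big_dep xpredT).
Qed.

Local Open Scope ring_scope.

(** * Specialization to the complex sixth root of unity and conclusion *)

Lemma card_DASASM_diffprod n :
  (#|DASASM (2 * n + 1)| * (3 ^ 'C(n, 2) * diffprod id n.*2.+1) =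
   diffprod stairexp n.*2.+1)%N.
Proof.
pose w : algC := (1 + sqrtC (-3)) / 2.
have w2 : w ^+ 2 = w - 1.
  have e := sqrtCK (-3 : algC); rewrite /w; move: (sqrtC _) e => x e.
  have -> : ((1 + x) / 2) ^+ 2 = (1 + 2 * x + x ^+ 2) / 4 by field.
  by rewrite e; field.
set L := [seq lab n k | k <- iota 0 n].
have sL : size L = n by rewrite size_map size_iota.
have U : uniq (lab n n :: L).
  rewrite -(map_cons (lab n) n) map_inj_in_uniq.
    by rewrite /= iota_uniq andbT mem_iota ltnn.
  have lek k : k \in n :: iota 0 n -> (k <= n)%N by rewrite inE mem_iota; lia.
  by move=> k l /lek kn /lek ln /eqP; rewrite lab_inj // => /eqP.
have card : (size L + 1 < #|'I_n.+2|)%N by rewrite sL card_ord addn1.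
have := Zpart_homogeneous w2 U card.
rewrite Zpart_steps -card_DASASM sL (diffprodE _ id) diffprodE => e.
apply/eqP; rewrite -(eqr_nat algC) !natrM natrX addn1 mulrCA e exprVn.
by rewrite mulVKf ?expf_neq0 ?pnatr_eq0.
Qed.

Lemma diffprod_id_gt0 m : (0 < diffprod id m)%N.
Proof.
by rewrite prodn_gt0 // => j; rewrite diffprod_id fact_gt0.
Qed.

Theorem corollary5 (n : nat) :
  (#|DASASM (2 * n + 1)|%:R : rat)
    = 3%:R ^- ((n * (n - 1))./2) * #|SSYT (double_staircase n) (2 * n + 1)|%:R
  /\ (3%:R : rat) ^- ((n * (n - 1))./2)
       * #|SSYT (double_staircase n) (2 * n + 1)|%:R
    = \prod_(0 <= i < n.+1) ((3 * i)`!%:R / (n + i)`!%:R).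
Proof.
rewrite subn1 -bin2; set N := 'C(n, 2).
have D0 := diffprod_id_gt0 n.*2.+1; have S0 := card_SSYT_double_staircase n.
have N0 : 3 ^+ N != 0 :> rat by rewrite expf_neq0.
have e1 : #|SSYT (double_staircase n) (2 * n + 1)| = (#|DASASM (2 * n + 1)| * 3 ^ N)%N.
  by apply/eqP; rewrite -(eqn_pmul2r D0) S0 -card_DASASM_diffprod mulnA.
split; first by rewrite e1 natrM natrX mulrCA mulVf ?mulr1.
have P0 : \prod_(0 <= i < n.+1) (n + i)`!%:R != 0 :> rat.
  by rewrite prodf_seq_neq0; apply/allP => i _; rewrite pnatr_eq0 -lt0n fact_gt0.
rewrite prodf_div; apply: (mulIf P0); rewrite divfK //.
apply: (mulfI N0); rewrite !mulrA mulfV // mul1r -!natr_prod -!natrM -natrX -natrM.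
congr _%:R; apply/eqP; rewrite -(eqn_pmul2r D0) mulnAC S0.
by rewrite diffprod_stairexp.
Qed.
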